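(* There exist universal constants $K_1>0$ and $p_0>0$, and a positive-valued function $L(\cdot,\cdot,\cdot,\cdot)$, such that the following holds. Let $\rho>2$, $0<\eta<1$, let $p$ and $n\geq 1$ be integers with $p\geq p_0$, and let $\Lambda$ be the toroidal square lattice of size $p\times p$. Let $m'$ be the largest model in $\mathcal{M}_1$ that satisfies $d_{m'}\leq \sqrt{np^2}$. Let $\theta\in\Theta^+_{m',\rho}$ and $\sigma^2>0$, and let $\mathbf{X}_1,\dots,\mathbf{X}_n$ be $n$ independent observations of the centered stationary Gaussian field $X$ on $\Lambda$ with covariance matrix $\Sigma=\sigma^2\left[I_{p^2}-C(\theta)\right]^{-1}$. Let $\mathrm{pen}:\mathcal{M}_1\to\mathbb{R}^+$ be a penalty function such that for every model $m\in\mathcal{M}_1$ $$\mathrm{pen}(m')-\mathrm{pen}(m)\leq K_1(1-\eta)\sigma^2\Big\{\varphi_{\max's\ min}\Big\}_{\theta}\,\frac{d_{m'}-d_m}{np^2},\qquad\text{where } \{\varphi_{\max's\ min}\}_{\theta}:=\varphi_{\min}\left(I_{p^2}-C(\theta)\right)\wedge\left[\rho-\varphi_{\max}\left(I_{p^2}-C(\theta)\right)\right].$$ Let $\widehat{m}_\rho$ be the model selected with this penalty over the whole collection $\mathcal{M}_1$, i.e. $\widehat{m}_\rho\in\arg\min_{m\in\mathcal{M}_1}\left[\gamma_{n,p,p}(\widehat{\theta}_{m,\rho})+\mathrm{pen}(m)\right]$. Then $$\mathbb{P}\left\{d_{\widehat{m}_\rho}>L\left[\sqrt{np^2}\wedge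 p^2\right]\right\}\geq\frac12,$$ where $L=L\big(\eta,\rho,\varphi_{\min}(I_{p^2}-C(\theta)),\varphi_{\max}(I_{p^2}-C(\theta))\big)$ depends only on $\eta$, $\rho$, $\varphi_{\min}(I_{p^2}-C(\theta))$ and $\varphi_{\max}(I_{p^2}-C(\theta))$.
   Context: Lattice and matrices. $\Lambda$ is the $p\times p$ torus: its nodes are pairs $(i,j)$ with both coordinates taken modulo $p$, and entries $A[i,j]$ of any $p\times p$ matrix are indexed modulo $p$. The node $(0,0)$ is a fixed reference node. $a\wedge b$ is the minimum. $\varphi_{\max}(A)$ and $\varphi_{\min}(A)$ are the largest and smallest eigenvalues of a symmetric matrix $A$, and $I_r$ is the $r\times r$ identity. In the penalty condition the quantity in braces indexed by $\theta$ is just the real number given by its displayed definition. Gaussian field. The field $X=(X[i,j])_{(i,j)\in\Lambda}$ is vectorialized as $X^v$ with $X^v[(i-1)p+j]=X[i,j]$, $1\le i,j\le p$, and $\Sigma$ is the covariance matrix of $X^v$. For a $p\times p$ matrix $\theta$, $C(\theta)$ is the $p^2\times p^2$ matrix with $C(\theta)[(i_1-1)p+j_1,(i_2-1)p+j_2]:=\theta[i_2-i_1,j_2-j_1]$ for $1\leq i_1,i_2,j_1,j_2\leq p$. Parameter sets. $\Theta$ is the vector space of real $p\times p$ matrices with $\theta[0,0]=0$ and $\theta[i,j]=\theta[-i,-j]$ for all $(i,j)\in\Lambda$. $\Theta^+:=\{\theta\in\Theta: I_{p^2}-C(\theta)\text{ is positive definite}\}$. Models. With representatives $0\le i,j\le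 p-1$, let $|(i,j)|_t^2:=[i\wedge(p-i)]^2+[j\wedge(p-j)]^2$. The collection $\mathcal{M}_1$ consists of the subsets $m\subset\Lambda\setminus\{(0,0)\}$ of the form $m=\{(i,j)\in\Lambda\setminus\{(0,0)\}: |(i,j)|_t\leq r_m\}$ for some $r_m>0$; it is totally ordered by inclusion and its smallest element is the empty neighborhood. For $m\in\mathcal{M}_1$, $\Theta_m$ is the set of $\theta\in\Theta$ whose support is included in $m$, $d_m$ is the dimension of $\Theta_m$, $\Theta_m^+:=\Theta_m\cap\Theta^+$, and for $\rho>2$, $\Theta^+_{m,\rho}:=\{\theta\in\Theta_m^+:\varphi_{\max}[I_{p^2}-C(\theta)]<\rho\}$. Estimators. The conditional least-squares criterion is $$\gamma_{n,p,p}(\theta'):=\frac{1}{np^2}\sum_{i=1}^n\sum_{(j_1,j_2)\in\Lambda}\Big(\mathbf{X}_i[j_1,j_2]-\sum_{(l_1,l_2)\in\Lambda\setminus\{(0,0)\}}\theta'[l_1,l_2]\,\mathbf{X}_i[j_1+l_1,j_2+l_2]\Big)^2 .$$ $\widehat{\theta}_{m,\rho}$ is the minimizer of $\gamma_{n,p,p}$ over the closure $\overline{\Theta^+_{m,\rho}}$. *)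

(* Defs.v *)
From HB Require Import structures.
From mathcomp Require Import all_boot all_order all_algebra.
From mathcomp Require Import all_classical all_reals all_analysis.

Set Implicit Arguments.
Unset Strict Implicit.
Unset Printing Implicit Defensive.

Import Order.TTheory GRing.Theory Num.Theory.
Import numFieldNormedType.Exports.

Local Open Scope classical_set_scope.
Local Open Scope ring_scope.

(* The torus of side p is parameterized by q = p - 1: 'I_q.+1 carries the
   additive group of the integers modulo p, whereas 'I_p has no group
   structure for a variable p, and 'Z_p is not Z/pZ for p = 1. *)
Notation lattice q := ('I_q.+1 * 'I_q.+1)%type.

Section Matrices.
Context {R : realType}.

(* The eigenvalues form a finite set, nonempty when A is symmetric of positive
   size, so the supremum and the infimum are attained. *)
Definition phi_max n (A : 'M[R]_n) : R := sup [set a | eigenvalue A a].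
Definition phi_min n (A : 'M[R]_n) : R := inf [set a | eigenvalue A a].

Definition posdefmx n (A : 'M[R]_n) : Prop :=
  A^T = A /\ forall v : 'rV[R]_n, v != 0 -> 0 < (v *m A *m v^T) 0 0.

Definition is_subspace (V : vectType R) (S : set V) (U : {vspace V}) : Prop :=
  forall x, x \in U <-> S x.

(* Dimension of a set of vectors that is a linear subspace. *)
Definition dim_set (V : vectType R) (S : set V) : nat :=
  \dim (xget 0%VS [set U : {vspace V} | is_subspace S U]).

Lemma dim_setE (V : vectType R) (S : set V) (U : {vspace V}) :
  is_subspace S U -> dim_set S = \dim U.
Proof.
move=> SU; rewrite /dim_set; case: xgetP => [W _ SW|/(_ U)/(_ SU)//].
congr (\dim _); apply/vspaceP => x.
by apply/idP/idP => [/SW/SU|/SU/SW].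
Qed.

End Matrices.

Section Torus.
Context {R : realType} {q : nat}.

Definition entry (theta : 'M[R]_q.+1) (u : lattice q) : R := theta u.1 u.2.

(* The node (i, j) at position (i-1)p+j of the vectorization, 1 <= i, j <= p.
   Positions k are numbered from 0 here, so k = (i-1)p+(j-1). *)
Definition node (k : 'I_(q.+1 * q.+1)) : lattice q :=
  (inZp (k %/ q.+1).+1, inZp (k %% q.+1).+1).

Definition Cmx (theta : 'M[R]_q.+1) : 'M[R]_(q.+1 * q.+1) :=
  \matrix_(a, b) entry theta (node b - node a).

Definition Theta : set 'M[R]_q.+1 :=
  [set theta | entry theta 0 = 0 /\ forall u, entry theta u = entry theta (- u)].

Definition Theta_plus : set 'M[R]_q.+1 :=
  [set theta | Theta theta /\ posdefmx (1%:M - Cmx theta)].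

Definition torus_norm (u : lattice q) : R :=
  Num.sqrt ((minn u.1 (q.+1 - u.1) ^ 2 + minn u.2 (q.+1 - u.2) ^ 2)%N%:R).

Definition Theta_of (m : {set lattice q}) : set 'M[R]_q.+1 :=
  [set theta | Theta theta /\ forall u, entry theta u != 0 -> u \in m].

Definition Theta_plus_of (m : {set lattice q}) (rho : R) : set 'M[R]_q.+1 :=
  [set theta | [/\ Theta_of m theta, Theta_plus theta
                 & phi_max (1%:M - Cmx theta) < rho]].

Lemma Theta_of_subspace (m : {set lattice q}) :
  exists U : {vspace 'M[R]_q.+1}, is_subspace (Theta_of m) U.
Proof.
pose f (A : 'M[R]_q.+1) : 'M[R]_q.+1 * 'M[R]_q.+1 :=
  (\matrix_(i, j) (A i j - A (- i) (- j)),
   \matrix_(i, j) (A i j *+ (((i, j) \notin m) || ((i == 0) && (j == 0))))).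
have lf : linear f.
  move=> a A B; rewrite /f; congr pair; apply/matrixP => i j; rewrite !mxE.
    by rewrite mulrBr opprD addrACA.
  by rewrite mulrnDl mulrnAr.
pose F : {linear 'M[R]_q.+1 -> _} := HB.pack f (GRing.isLinear.Build _ _ _ _ f lf).
exists (lker (linfun F)) => A; rewrite memv_ker lfunE /=; split.
- move=> /eqP [/matrixP fA /matrixP gA]; split; first split.
  + by have := gA 0 0; rewrite !mxE !eqxx orbT.
  + case=> i j; have := fA i j; rewrite !mxE => /eqP.
    by rewrite subr_eq0 => /eqP.
  + case=> i j; apply: contraNT => um; have := gA i j; rewrite !mxE um /=.
    by move=> /eqP.
- move=> [[A0 AN] Am]; rewrite /f; apply/eqP; congr pair; apply/matrixP => i j;
    rewrite !mxE.
    by apply/eqP; rewrite subr_eq0; apply/eqP; exact: AN (i, j).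
  have [/andP[/eqP -> /eqP ->]|_] := boolP ((i == 0) && (j == 0)).
    by rewrite [A 0 0]A0 mul0rn.
  have := Am (i, j); rewrite /entry /= orbF.
  have [->|_ /(_ isT) ->//] := eqVneq (A i j) 0.
  by rewrite mul0rn.
Qed.

Definition dimension (m : {set lattice q}) : nat := dim_set (Theta_of m).

(* Least-squares criterion of the configurations x_1, ..., x_n. *)
Definition ls_criterion (n : nat) (x : 'I_n -> lattice q -> R) (theta : 'M[R]_q.+1) : R :=
  ((n * q.+1 ^ 2)%N%:R)^-1 *
  \sum_(i < n) \sum_(j : lattice q)
    (x i j - \sum_(l : lattice q | l != 0) entry theta l * x i (j + l)) ^+ 2.

End Torus.

Definition models (R : realType) (q : nat) : set {set lattice q} :=
  [set m | exists2 r : R, 0 < r &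
     m = [set u : lattice q | (u != 0) && (torus_norm u <= r)]%SET].

Definition is_argmin {T : Type} {R : realType} (f : T -> R) (S : set T) (x : T)
  : Prop := S x /\ forall y, S y -> f x <= f y.

Section Fields.
Context {d : measure_display} {T : measurableType d} {R : realType}.
Variable P : probability T R.

(* normal_prob is not the Gaussian law when the standard deviation is 0; the
   degenerate Gaussian is the Dirac mass. *)
Definition gaussian_law (Y : T -> R) : Prop :=
  exists mu s : R, 0 <= s /\ forall B : set R, measurable B ->
    P (Y @^-1` B) = if s == 0 then dirac mu B else normal_prob mu s B.

Definition gaussian_field {q} (X : lattice q -> {RV P >-> R}) : Prop :=
  forall a : lattice q -> R, gaussian_law (fun w => \sum_u a u * X u w).

Definition centered_field {q} (X : lattice q -> {RV P >-> R}) : Prop :=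
  forall u, ('E_P[X u] = 0)%E.

(* Invariance of the joint law under translations; measurable rectangles form
   a pi-system generating the product sigma-algebra. *)
Definition stationary_field {q} (X : lattice q -> {RV P >-> R}) : Prop :=
  forall (t : lattice q) (B : lattice q -> set R), (forall u, measurable (B u)) ->
    P [set w | forall u, B u (X (u + t) w)] = P [set w | forall u, B u (X u w)].

Definition has_covmx {q} (X : lattice q -> {RV P >-> R})
    (Sigma : 'M[R]_(q.+1 * q.+1)) : Prop :=
  forall a b, covariance P (X (node a)) (X (node b)) = (Sigma a b)%:E.

Definition field_sigma {q} (X : lattice q -> {RV P >-> R}) : set (set T) :=
  <<s [set E | exists u (B : set R), measurable B /\ E = X u @^-1` B] >>.

Definition independent_fields {n q} (X : 'I_n -> lattice q -> {RV P >-> R}) : Prop :=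
  forall (J : {set 'I_n}) (E : 'I_n -> set T),
    (forall i, field_sigma (X i) (E i)) ->
    P (\bigcap_(i in [set` J]) E i) = (\prod_(i in J) P (E i))%E.

End Fields.

(* Main.v *)
Require Import Defs.
From HB Require Import structures.
From mathcomp Require Import all_boot all_order all_algebra.
From mathcomp Require Import all_classical all_reals all_analysis.
From mathcomp Require Import measurable_realfun ring lra zify.

Set Implicit Arguments.
Unset Strict Implicit.
Unset Printing Implicit Defensive.

Import Order.TTheory GRing.Theory Num.Theory.
Import numFieldNormedType.Exports.

Local Open Scope classical_set_scope.
Local Open Scope ring_scope.

(* Every matrix I - C(theta) with theta even is diagonalized by the real Hartley
   basis cas(2 pi k.u / p), with eigenvalues lambda_k = 1 - spec theta k.  In
   this basis the criterion at theta' is, up to the factor sigma^2 / (n p^2),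
   sum_k (1 - spec theta' k)^2 / lambda_k * S_k, where the S_k behave like
   independent chi-square variables with n degrees of freedom.  Only their mixed
   moments up to order 4 enter, through Chebyshev's inequality; they are obtained
   from Wick's formula, itself derived by polarization from the moments of the
   normal law.

   The score of the criterion along the cosines indexed by m' has squared norm
   of order n p^2 d_{m'}, so with probability at least 3/4 a small step along it
   decreases the criterion by a multiple of sigma^2 d_{m'} / (n p^2), starting
   from theta, or from theta / 16 when it is compared with the empty model.  On
   the other hand no element of Theta_{m1} can beat theta by more than a multiple
   of (sigma^2 / (n p^2)) (d_{m1} + 1).  Hence, when d_{m1} is a small fraction of
   d_{m'}, the gain exceeds the increase of the penalty and no submodel of m1 is
   selected; it remains to take for m1 the largest model with
   d_{m1} <= L (sqrt (n p^2) /\ p^2), a quantity at most 72 |m'|. *)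

(** * Trigonometric characters of the torus *)

(** [K1] and [p0] must be universal although [theta] may lie arbitrarily close to the boundary of
    its domain; this is why there are two comparisons. If [L * mu >= 1], with [mu] the minimum of
    [sqrt (n p^2)] and [p^2], then [|m1| + 1 <= 216 L |m'|], and the choice of [L] absorbs the noise
    around [theta]. If [L * mu < 1], then [m1] is empty and only a universal lower bound on [|m'|]
    is at hand, whereas comparing [theta] itself with 0 would involve fluctuations governed by the
    inverse of its smallest eigenvalue. Shrinking to [theta / 16] and truncating the weights
    [1 / lambda_k] at 2 makes every constant absolute. A failure probability of 1/2 is allowed in
    total, so Markov bounds suffice. Uniformity over the parameters comes from bounding the operator
    norm of a random matrix by its Frobenius norm, and [d_{m'} <= sqrt (n p^2)] is what keeps that
    Frobenius norm of order [n p^2]. *)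

Section torus_characters.
Context {R : realType} {q : nat}.
Local Notation p := q.+1.
Implicit Types (u v w k l : lattice q).

Definition tcos (m : nat) : R := cos (2 * pi * m%:R / p%:R).
Definition tsin (m : nat) : R := sin (2 * pi * m%:R / p%:R).

Lemma tcosD m n : tcos (m + n) = tcos m * tcos n - tsin m * tsin n.
Proof. by rewrite /tcos natrD mulrDr mulrDl cosD. Qed.

Lemma tsinD m n : tsin (m + n) = tsin m * tcos n + tcos m * tsin n.
Proof. by rewrite /tsin natrD mulrDr mulrDl sinD. Qed.

Lemma tcos0 : tcos 0 = 1.
Proof. by rewrite /tcos mulr0 mul0r cos0. Qed.

Lemma tsin0 : tsin 0 = 0.
Proof. by rewrite /tsin mulr0 mul0r sin0. Qed.

Lemma tcos2Dtsin2 m : tcos m ^+ 2 + tsin m ^+ 2 = 1.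
Proof. exact: cos2Dsin2. Qed.

Lemma trig_period m : tcos (m * p) = 1 /\ tsin (m * p) = 0.
Proof.
elim: m => [|m [IHc IHs]]; first by rewrite mul0n tcos0 tsin0.
have c1 : tcos p = 1.
  by rewrite /tcos mulfK ?pnatr_eq0// mulr_natl cos2pi.
have s1 : tsin p = 0.
  by rewrite /tsin mulfK ?pnatr_eq0// mulr_natl sin2pi.
by rewrite mulSn tcosD tsinD IHc IHs c1 s1 !(mulr0, mulr1, mul0r, subr0, addr0).
Qed.

Lemma tcos_mod m : tcos (m %% p) = tcos m.
Proof.
rewrite {2}(divn_eq m p) tcosD; have [-> ->] := trig_period (m %/ p).
by rewrite mul1r mul0r subr0.
Qed.

Lemma tsin_mod m : tsin (m %% p) = tsin m.
Proof.
rewrite {2}(divn_eq m p) tsinD; have [-> ->] := trig_period (m %/ p).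
by rewrite mul1r mul0r add0r.
Qed.

Lemma tcos_eq m n : m = n %[mod p] -> tcos m = tcos n.
Proof. by rewrite -tcos_mod => ->; rewrite tcos_mod. Qed.

Lemma tsin_eq m n : m = n %[mod p] -> tsin m = tsin n.
Proof. by rewrite -tsin_mod => ->; rewrite tsin_mod. Qed.

Lemma tcos_neq1 m : (0 < m < p)%N -> tcos m != 1.
Proof.
move=> /andP[m0 mp]; rewrite /tcos.
have -> : 2 * pi * m%:R / p%:R = (pi * m%:R / p%:R) *+ 2 :> R.
  by rewrite -mulr_natl; ring.
rewrite cos_mulr2n lt_eqF //.
have s0 : 0 < sin (pi * m%:R / p%:R : R).
  rewrite sin_gt0_pi// ltr_pdivrMr ?ltr0n // divr_gt0 ?mulr_gt0 ?pi_gt0 ?ltr0n //=.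
  by rewrite ltr_pM2l ?pi_gt0 // ltr_nat.
have := cos2Dsin2 (pi * m%:R / p%:R : R); have := exprn_gt0 2 s0; lra.
Qed.

Definition hc u v : R := tcos (u.1 * v.1 + u.2 * v.2).
Definition hs u v : R := tsin (u.1 * v.1 + u.2 * v.2).

Lemma hcC u v : hc u v = hc v u.
Proof. by rewrite /hc mulnC [X in (_ + X)%N]mulnC. Qed.

Lemma hsC u v : hs u v = hs v u.
Proof. by rewrite /hs mulnC [X in (_ + X)%N]mulnC. Qed.

(** The products are taken on natural representatives, so additivity is stated modulo [p]; the
    periodicity of [tcos] and [tsin] makes this enough. *)
Lemma lattice_dotDl u v w :
  ((u + v)%R.1 * w.1 + (u + v)%R.2 * w.2 =
   u.1 * w.1 + u.2 * w.2 + (v.1 * w.1 + v.2 * w.2) %[mod p])%N.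
Proof.
have -> : nat_of_ord (u + v)%R.1 = ((u.1 + v.1) %% p)%N by [].
have -> : nat_of_ord (u + v)%R.2 = ((u.2 + v.2) %% p)%N by [].
rewrite -[LHS]modnDm !modnMml modnDm; congr (_ %% _)%N; lia.
Qed.

Lemma hcD u v w : hc (u + v) w = hc u w * hc v w - hs u w * hs v w.
Proof. by rewrite /hc /hs (tcos_eq (lattice_dotDl u v w)) tcosD. Qed.

Lemma hsD u v w : hs (u + v) w = hs u w * hc v w + hc u w * hs v w.
Proof. by rewrite /hc /hs (tsin_eq (lattice_dotDl u v w)) tsinD. Qed.

Lemma hc0 w : hc 0 w = 1.
Proof. by rewrite /hc tcos0. Qed.

Lemma hs0 w : hs 0 w = 0.
Proof. by rewrite /hs tsin0. Qed.

Lemma hc2Dhs2 u w : hc u w ^+ 2 + hs u w ^+ 2 = 1.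
Proof. exact: tcos2Dtsin2. Qed.

Lemma hc_sqr_le1 u w : hc u w ^+ 2 <= 1.
Proof. by rewrite -(hc2Dhs2 u w) lerDl sqr_ge0. Qed.

Lemma hc_norm_le1 u w : `|hc u w| <= 1.
Proof. by rewrite -(@expr_le1 _ 2) // -normrX ger0_norm ?sqr_ge0 ?hc_sqr_le1. Qed.

(** The addition formulas at [u + (- u) = 0] form a linear system of determinant 1 for the cosine
    and sine at [- u]; no computation with the representative of [- u] is needed. *)
Lemma hcN u w : hc (- u) w = hc u w.
Proof.
have := hcD u (- u) w; have := hsD u (- u) w.
rewrite subrr hc0 hs0; have := hc2Dhs2 u w.
move: (hc u w) (hs u w) (hc (- u) w) (hs (- u) w) => a b c d e1 e2 e3.
suff : c * (a ^+ 2 + b ^+ 2) = a by rewrite e1 mulr1.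
have -> : c * (a ^+ 2 + b ^+ 2) = a * (a * c - b * d) + b * (b * c + a * d) by ring.
by rewrite -e2 -e3 mulr1 mulr0 addr0.
Qed.

Lemma hsN u w : hs (- u) w = - hs u w.
Proof.
have := hcD u (- u) w; have := hsD u (- u) w.
rewrite subrr hc0 hs0; have := hc2Dhs2 u w.
move: (hc u w) (hs u w) (hc (- u) w) (hs (- u) w) => a b c d e1 e2 e3.
suff : d * (a ^+ 2 + b ^+ 2) = - b by rewrite e1 mulr1.
have -> : d * (a ^+ 2 + b ^+ 2) = a * (b * c + a * d) - b * (a * c - b * d) by ring.
by rewrite -e2 -e3 mulr1 mulr0 add0r.
Qed.

(** Nontriviality of the character [w], tested at a unit vector along an axis where [w] is
    nonzero. *)
Lemma exists_hc_neq1 w : w != 0 -> exists v, hc v w != 1.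
Proof.
case: w => w1 w2 w0; have [w10|w10] := eqVneq w1 0.
  exists (0, inZp 1); rewrite /hc /= mul0n add0n tcos_neq1 //.
  have w20 : (0 < w2 < p)%N.
    by rewrite ltn_ord andbT lt0n; apply: contraNneq w0 => w20; apply/eqP;
       congr pair => //; apply: val_inj.
  (* For [q = 0] the class of 1 is 0, but then [w2] cannot be positive. *)
  by case: (q) w2 w20 {w0} => [|q'] w2 w20; rewrite ?modn_small ?mul1n //; lia.
exists (inZp 1, 0); rewrite /hc /= mul0n addn0 tcos_neq1 //.
have w1' : (0 < w1 < p)%N.
  by rewrite ltn_ord andbT lt0n; apply: contraNneq w10 => w10; apply/eqP;
     apply: val_inj.
by case: (q) w1 w1' {w10 w0} => [|q'] w1 w20; rewrite ?modn_small ?mul1n //; lia.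
Qed.

(** Translating the summation index by [v] rotates the pair of sums by the angle of the character at
    [v]. If this angle is nontrivial only the zero vector is fixed: [(1 - a) ^+ 2 + b ^+ 2] is the
    determinant of the rotation minus the identity. *)
Lemma sum_hc_hs w :
  \sum_u hc u w = (w == 0)%:R * (p ^ 2)%:R /\ \sum_u hs u w = 0.
Proof.
have [->|w0] := eqVneq w 0.
  rewrite (eq_bigr (fun=> 1)); last by move=> u _; rewrite hcC hc0.
  rewrite sumr_const card_prod card_ord mul1r; split=> //.
  by rewrite big1 // => u _; rewrite hsC hs0.
rewrite mul0r; have [v v1] := exists_hc_neq1 w0.
have eC : \sum_u hc u w = (\sum_u hc u w) * hc v w - (\sum_u hs u w) * hs v w.
  rewrite {1}(reindex_inj (addIr v)) /= !mulr_suml -sumrB.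
  by apply: eq_bigr => u _; rewrite hcD.
have eS : \sum_u hs u w = (\sum_u hs u w) * hc v w + (\sum_u hc u w) * hs v w.
  rewrite {1}(reindex_inj (addIr v)) /= !mulr_suml -big_split.
  by apply: eq_bigr => u _; rewrite hsD.
move: (\sum_u hc u w) (\sum_u hs u w) eC eS => C S.
have := hc2Dhs2 v w; move: v1; move: (hc v w) (hs v w) => a b a1 ab eC eS.
have D0 : (1 - a) ^+ 2 + b ^+ 2 != 0.
  rewrite paddr_eq0 ?sqr_ge0 // !sqrf_eq0 negb_and subr_eq0 eq_sym a1 //.
have C0 : ((1 - a) ^+ 2 + b ^+ 2) * C = 0.
  have -> : ((1 - a) ^+ 2 + b ^+ 2) * C =
     (1 - a) * (C - (C * a - S * b)) - b * (S - (S * a + C * b)) by ring.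
  by rewrite -eC -eS !subrr !mulr0 subr0.
have S0 : ((1 - a) ^+ 2 + b ^+ 2) * S = 0.
  have -> : ((1 - a) ^+ 2 + b ^+ 2) * S =
     (1 - a) * (S - (S * a + C * b)) + b * (C - (C * a - S * b)) by ring.
  by rewrite -eC -eS !subrr !mulr0 addr0.
by move: C0 S0 => /eqP; rewrite mulf_eq0 (negbTE D0) /= => /eqP -> /eqP;
  rewrite mulf_eq0 (negbTE D0) /= => /eqP ->.
Qed.

Lemma sum_hc w : \sum_u hc u w = (w == 0)%:R * (p ^ 2)%:R.
Proof. by case: (sum_hc_hs w). Qed.

Lemma sum_hs w : \sum_u hs u w = 0.
Proof. by case: (sum_hc_hs w). Qed.

Lemma sum_hcM k l :
  \sum_u hc k u * hc l u = ((k == l)%:R + (k == - l)%:R) * (p ^ 2)%:R / 2.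
Proof.
have e u : hc k u * hc l u = (hc u (k - l) + hc u (k + l)) / 2.
  by rewrite ![hc u _]hcC !hcD hcN hsN; field.
rewrite (eq_bigr _ (fun u _ => e u)) -mulr_suml big_split /= !sum_hc.
by rewrite subr_eq0 addr_eq0 -mulrDl.
Qed.

Definition cas k u : R := hc k u + hs k u.

(** The product is a cosine of the difference plus a sine of the sum, and sine sums vanish: [cas] is
    a real orthogonal basis in which no frequency has to be paired with its opposite. *)
Lemma sum_casM u v : \sum_k cas k u * cas k v = (u == v)%:R * (p ^ 2)%:R.
Proof.
have e k : cas k u * cas k v = hc k (u - v) + hs k (u + v).
  by rewrite hcC hsC hcD hsD hcN hsN /cas !(hcC _ k) !(hsC _ k); ring.
by rewrite (eq_bigr _ (fun u _ => e u)) big_split /= sum_hc sum_hs addr0 subr_eq0.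
Qed.

Lemma casC k u : cas k u = cas u k.
Proof. by rewrite /cas hcC hsC. Qed.

Definition hartley (x : lattice q -> R) k : R := (\sum_u x u * cas k u) / p%:R.

Lemma hartleyB x y k :
  hartley (fun u => x u - y u) k = hartley x k - hartley y k.
Proof.
by rewrite /hartley -mulrBl -sumrB; congr (_ / _); apply: eq_bigr => u _; rewrite mulrBl.
Qed.

Lemma hartleyM x y : \sum_k hartley x k * hartley y k = \sum_u x u * y u.
Proof.
have e k : hartley x k * hartley y k =
    (p%:R ^- 2) * \sum_u \sum_v x u * y v * (cas k u * cas k v).
  rewrite /hartley mulrACA -expr2 exprVn mulrC big_distrlr /=; congr (_ * _).
  by apply: eq_bigr => u _; apply: eq_bigr => v _; ring.
rewrite (eq_bigr _ (fun u _ => e u)) -mulr_sumr exchange_big mulr_sumr /=.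
apply: eq_bigr => u _; rewrite exchange_big /=.
rewrite (eq_bigr (fun v => x u * y v * ((u == v)%:R * (p ^ 2)%:R))); last first.
  by move=> v _; rewrite -mulr_sumr sum_casM.
rewrite (bigD1 u) //= big1 => [|v vu]; last by rewrite eq_sym (negbTE vu) mul0r mulr0.
by rewrite addr0 eqxx mul1r natrX; field.
Qed.

Lemma parseval x : \sum_k hartley x k ^+ 2 = \sum_u x u ^+ 2.
Proof. exact: hartleyM. Qed.

Definition spec (theta : 'M[R]_p) k : R := \sum_l entry theta l * hc l k.

(** Evenness kills the sine part of the transform of [theta]; otherwise the convolution would mix
    the frequencies [k] and [- k]. *)
Lemma conv_cas (theta : 'M[R]_p) k v :
  (forall u, entry theta u = entry theta (- u)) ->
  \sum_l entry theta l * cas k (v + l) = spec theta k * cas k v.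
Proof.
move=> even.
have odd0 : \sum_l entry theta l * hs l k = 0.
  suff : \sum_l entry theta l * hs l k = - \sum_l entry theta l * hs l k.
    by move=> h; lra.
  rewrite {1}(reindex_inj (@oppr_inj (lattice q))) /= -sumrN; apply: eq_bigr => l _.
  by rewrite -even hsN mulrN.
rewrite (eq_bigr (fun l => cas k v * (entry theta l * hc l k) +
   (hc k v - hs k v) * (entry theta l * hs l k))); last first.
  by move=> l _; rewrite /cas (hcC k) (hsC k) hcD hsD !(hcC k) !(hsC k); ring.
by rewrite big_split /= -!mulr_sumr odd0 mulr0 addr0 mulrC.
Qed.

Lemma hartley_conv (theta : 'M[R]_p) (x : lattice q -> R) k :
  (forall u, entry theta u = entry theta (- u)) ->
  hartley (fun j => \sum_l entry theta l * x (j + l)) k = spec theta k * hartley x k.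
Proof.
move=> even; rewrite /hartley mulrA; congr (_ / _).
have e (l : lattice q) : \sum_(j : lattice q) x (j + l) * cas k j =
    \sum_u x u * cas k (u - l).
  by rewrite (reindex_inj (addIr (- l))) /=; apply: eq_bigr => u _; rewrite addrNK.
rewrite (eq_bigr (fun j => \sum_l entry theta l * (x (j + l) * cas k j))); last first.
  by move=> j _; rewrite mulr_suml; apply: eq_bigr => l _; rewrite mulrA.
rewrite exchange_big /=.
rewrite (eq_bigr (fun l => \sum_u x u * (entry theta l * cas k (u - l)))); last first.
  by move=> l _; rewrite -mulr_sumr e mulr_sumr; apply: eq_bigr => u _; rewrite mulrCA.
rewrite exchange_big mulr_sumr; apply: eq_bigr => u _ /=.
rewrite -mulr_sumr (reindex_inj (@oppr_inj (lattice q))) /=.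
under eq_bigr do rewrite -even opprK.
by rewrite conv_cas // mulrCA.
Qed.

Lemma specD (a b : 'M[R]_p) k : spec (a + b) k = spec a k + spec b k.
Proof.
by rewrite /spec -big_split; apply: eq_bigr => l _; rewrite /entry mxE mulrDl.
Qed.

Lemma specZ c (a : 'M[R]_p) k : spec (c *: a) k = c * spec a k.
Proof.
by rewrite /spec mulr_sumr; apply: eq_bigr => l _; rewrite /entry mxE mulrA.
Qed.

(** Fourier inversion at the origin. On [Theta] it says that the eigenvalues [1 - spec a k] have
    mean 1. *)
Lemma sum_spec (a : 'M[R]_p) : \sum_k spec a k = (p ^ 2)%:R * entry a 0.
Proof.
rewrite /spec exchange_big /= (bigD1 (0 : lattice q)) //= [X in _ + X]big1 ?addr0; last first.
  move=> l l0; rewrite -mulr_sumr (eq_bigr _ (fun k _ => hcC l k)) sum_hc.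
  by rewrite (negbTE l0) mul0r mulr0.
by rewrite -mulr_sumr (eq_bigr _ (fun k _ => hcC 0 k)) sum_hc eqxx mul1r mulrC.
Qed.

Lemma sum_spec_sqr (a : 'M[R]_p) : (forall u, entry a u = entry a (- u)) ->
  \sum_k spec a k ^+ 2 = (p ^ 2)%:R * \sum_l entry a l ^+ 2.
Proof.
move=> even.
have e k : spec a k ^+ 2 = \sum_l \sum_l' entry a l * entry a l' * (hc l k * hc l' k).
  rewrite expr2 /spec big_distrlr /=.
  by apply: eq_bigr => u _; apply: eq_bigr => v _; ring.
rewrite (eq_bigr _ (fun u _ => e u)) exchange_big mulr_sumr /=.
apply: eq_bigr => l _; rewrite exchange_big /=.
rewrite (eq_bigr (fun l' => entry a l * entry a l' * ((p ^ 2)%:R / 2 * (l == l')%:R)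
   + entry a l * entry a l' * ((p ^ 2)%:R / 2 * (l == - l')%:R))); last first.
  by move=> l' _; rewrite -mulr_sumr sum_hcM; ring.
rewrite big_split /= [X in X + _](bigD1 l) //= big1 ?addr0; last first.
  by move=> i il; rewrite eq_sym (negbTE il) !mulr0.
rewrite [X in _ + X](bigD1 (- l)) //= big1 ?addr0; last first.
  by move=> i il; rewrite eq_sym eqr_oppLR (negbTE il) !mulr0.
by rewrite opprK !eqxx -even mulr1; field.
Qed.

(** The cosines at [l] and [- l] coincide, so the family is not orthogonal; the sum over all [l] is
    nevertheless [p ^ 2] times the squared norm of the even part of [f]. *)
Lemma bessel_hc (P : {set lattice q}) (f : lattice q -> R) :
  \sum_(l in P) (\sum_k f k * hc l k) ^+ 2 <= (p ^ 2)%:R * \sum_k f k ^+ 2.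
Proof.
apply: (@le_trans _ _ (\sum_l (\sum_k f k * hc l k) ^+ 2)).
  by rewrite [leRHS](bigID (mem P)) /= lerDl sumr_ge0 // => i _; rewrite sqr_ge0.
have e l : (\sum_k f k * hc l k) ^+ 2 =
    \sum_k \sum_k' f k * f k' * (hc k l * hc k' l).
  rewrite expr2 big_distrlr /=.
  by apply: eq_bigr => u _; apply: eq_bigr => v _; rewrite !(hcC l); ring.
rewrite (eq_bigr _ (fun u _ => e u)) exchange_big /=.
rewrite (eq_bigr (fun k => (p ^ 2)%:R / 2 * f k ^+ 2 +
   (p ^ 2)%:R / 2 * (f k * f (- k)))); last first.
  move=> k _; rewrite exchange_big /=.
  rewrite (eq_bigr (fun l' => f k * f l' * ((p ^ 2)%:R / 2 * (k == l')%:R)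
     + f k * f l' * ((p ^ 2)%:R / 2 * (k == - l')%:R))); last first.
    by move=> l' _; rewrite -mulr_sumr sum_hcM; ring.
  rewrite big_split /= [X in X + _](bigD1 k) //= big1 ?addr0; last first.
    by move=> i il; rewrite eq_sym (negbTE il) !mulr0.
  rewrite [X in _ + X](bigD1 (- k)) //= big1 ?addr0; last first.
    by move=> i il; rewrite eq_sym eqr_oppLR (negbTE il) !mulr0.
  by rewrite opprK !eqxx !mulr1; ring.
(* Symmetrized in this proportion the inequality holds term by term: the difference is a quarter of
   [p ^ 2 * (f k - f (- k)) ^+ 2]. *)
have -> : \sum_k f k ^+ 2 = \sum_k (f k ^+ 2 * (3 / 4) + f (- k) ^+ 2 / 4).
  rewrite big_split /= [X in _ + X](reindex_inj (@oppr_inj (lattice q))) /=.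
  by rewrite -big_split /=; apply: eq_bigr => k _; rewrite opprK; field.
rewrite mulr_sumr ler_sum // => k _.
have : 0 <= (p ^ 2)%:R * (f k - f (- k)) ^+ 2 by rewrite mulr_ge0 ?sqr_ge0.
move: (p ^ 2)%:R (f k) (f (- k)) => V a b; nra.
Qed.

End torus_characters.

(** * Spectrum of the circulant matrices *)

Section circulant_spectrum.
Context {R : realType} {q : nat}.
Local Notation p := q.+1.
Implicit Types (theta : 'M[R]_p) (k u : lattice q).

Lemma node_inj : injective (@node q).
Proof.
move=> a b e; have /= e1 := congr1 (fun u => val u.1) e.
have /= e2 := congr1 (fun u => val u.2) e.
have p0 : (0 < p)%N by [].
have h (i j : nat) : (i < p)%N -> (j < p)%N -> (i.+1 %% p = j.+1 %% p)%N -> i = j.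
  move=> ip jp; have [/eqP ei|ei] := eqVneq i.+1 p; have [/eqP ej|ej] := eqVneq j.+1 p.
  - by move: ei ej => /eqP ei /eqP ej _; apply: succn_inj; rewrite ei ej.
  - by rewrite (eqP ei) modnn modn_small //; lia.
  - by rewrite (eqP ej) modnn modn_small //; lia.
  - by rewrite !modn_small //; lia.
apply: val_inj => /=; rewrite (divn_eq a p) (divn_eq b p); congr (_ * _ + _)%N.
  by apply: h => //; rewrite ltn_divLR ?ltn_ord.
by apply: h => //; rewrite ltn_pmod.
Qed.

Lemma card_node : (#|{: lattice q}| <= #|'I_(p * p)|)%N.
Proof. by rewrite card_prod !card_ord. Qed.

Definition unnode u : 'I_(p * p) := iinv (inj_card_onto node_inj card_node u).

Lemma unnodeK : cancel unnode (@node q).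
Proof. by move=> u; rewrite /unnode f_iinv. Qed.

Lemma nodeK : cancel (@node q) unnode.
Proof. by move=> a; apply: node_inj; rewrite unnodeK. Qed.

Lemma sum_node (F : lattice q -> R) : \sum_a F (node a) = \sum_u F u.
Proof.
rewrite [RHS](reindex (@node q)) //.
by exists unnode => ? _; rewrite ?nodeK ?unnodeK.
Qed.

Definition field_of (v : 'rV[R]_(p * p)) u : R := v 0 (unnode u).

Lemma row_of_field (x : lattice q -> R) u : field_of (\row_a x (node a)) u = x u.
Proof. by rewrite /field_of mxE unnodeK. Qed.

Lemma field_of_eq0 (v : 'rV[R]_(p * p)) : (forall u, field_of v u = 0) -> v = 0.
Proof.
by move=> v0; apply/rowP => a; rewrite mxE -[a]nodeK; exact: v0.
Qed.

Lemma field_ofB v w u : field_of (v - w) u = field_of v u - field_of w u.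
Proof. by rewrite /field_of !mxE. Qed.

Lemma dot_field (v w : 'rV[R]_(p * p)) :
  (v *m w^T) 0 0 = \sum_u field_of v u * field_of w u.
Proof.
rewrite mxE -sum_node; apply: eq_bigr => a _.
by rewrite /field_of nodeK mxE.
Qed.

Lemma hartley_eq0 (x : lattice q -> R) : (forall k, hartley x k = 0) -> forall u, x u = 0.
Proof.
move=> h0 u; have : \sum_u x u ^+ 2 == 0.
  by rewrite -parseval big1 // => k _; rewrite h0 expr0n.
rewrite psumr_eq0 => [|i _]; last exact: sqr_ge0.
by move=> /allP /(_ u (mem_index_enum _)); rewrite sqrf_eq0 => /eqP.
Qed.

Section even_kernel.
Variable theta : 'M[R]_p.
Hypothesis even : forall u, entry theta u = entry theta (- u).
Local Notation A := (1%:M - Cmx theta).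
Local Notation lam := (fun k => 1 - spec theta k).

Lemma mul_Cmx (v : 'rV[R]_(p * p)) u :
  field_of (v *m Cmx theta) u = \sum_l entry theta l * field_of v (u + l).
Proof.
rewrite /field_of mxE.
rewrite (eq_bigr (fun a => field_of v (node a) * entry theta (u - node a))); last first.
  by move=> a _; rewrite mxE /field_of nodeK unnodeK.
rewrite (sum_node (fun w => field_of v w * entry theta (u - w))).
rewrite (reindex_inj (addrI u)) /=; apply: eq_bigr => l _.
by rewrite opprD addrA subrr add0r -even mulrC.
Qed.

Lemma hartley_mulA (v : 'rV[R]_(p * p)) k :
  hartley (field_of (v *m A)) k = lam k * hartley (field_of v) k.
Proof.
rewrite mulmxBr mulmx1 mulrBl mul1r -hartley_conv // -hartleyB.
congr hartley; apply/funext => u.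
by rewrite field_ofB mul_Cmx.
Qed.

Lemma quad_formA (v : 'rV[R]_(p * p)) :
  (v *m A *m v^T) 0 0 = \sum_k lam k * hartley (field_of v) k ^+ 2.
Proof.
rewrite dot_field -hartleyM; apply: eq_bigr => k _.
by rewrite hartley_mulA; ring.
Qed.

Lemma hartley_cas k l : hartley (cas k) l = (k == l)%:R * p%:R :> R.
Proof.
rewrite /hartley (eq_bigr (fun u => cas u k * cas u l)); last first.
  by move=> u _; rewrite !(casC _ u).
by rewrite sum_casM natrX; field.
Qed.

Lemma cas_row_neq0 k : (\row_a cas k (node a) : 'rV[R]_(p * p)) != 0.
Proof.
apply/eqP => e; have := hartley_cas k k.
rewrite eqxx mul1r (_ : hartley _ _ = 0); last first.
  rewrite /hartley big1 ?mul0r // => u _.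
  by rewrite -(row_of_field (cas k)) e /field_of mxE mul0r.
by move=> /eqP; rewrite eq_sym pnatr_eq0.
Qed.

Lemma cas_row_eigen k :
  (\row_a cas k (node a)) *m A = lam k *: (\row_a cas k (node a)).
Proof.
apply/rowP => a; rewrite -[a]nodeK.
have e (v : 'rV[R]_(p * p)) : v 0 (unnode (node a)) = field_of v (node a) by [].
rewrite [RHS]mxE !e mulmxBr mulmx1 field_ofB mul_Cmx row_of_field.
rewrite (eq_bigr (fun l => entry theta l * cas k (node a + l))); last first.
  by move=> l _; rewrite row_of_field.
by rewrite conv_cas // mulrBl mul1r.
Qed.

Lemma eigenvalue_lam k : eigenvalue A (lam k).
Proof.
apply/eigenvalueP; exists (\row_a cas k (node a)); first exact: cas_row_eigen.
exact: cas_row_neq0.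
Qed.

(** A row vector whose eigenvalue avoids every [lam k] has a zero Hartley transform. *)
Lemma eigenvalueE a : eigenvalue A a -> exists k, a = lam k.
Proof.
move=> /eigenvalueP [v vA v0]; apply: contrapT => /forallNP na.
case/eqP: v0; apply: field_of_eq0; apply: hartley_eq0 => k.
have := hartley_mulA v k; rewrite vA.
have -> : hartley (field_of (a *: v)) k = a * hartley (field_of v) k.
  rewrite /hartley mulrA mulr_sumr; congr (_ / _); apply: eq_bigr => u _.
  by rewrite /field_of mxE mulrA.
move=> /eqP; rewrite -subr_eq0 -mulrBl mulf_eq0 subr_eq0 => /orP[/eqP /na//|/eqP//].
Qed.

Lemma phi_max_lam : exists2 k0, phi_max A = lam k0 & forall k, lam k <= phi_max A.
Proof.
pose k0 := [arg max_(k > (0 : lattice q)) lam k]%O.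
have k0P k : lam k <= lam k0 by rewrite /k0; case: arg_maxP => // i _ /(_ k isT).
have e : phi_max A = lam k0.
  apply/eqP; rewrite eq_le; apply/andP; split.
    apply: ge_sup; first by exists (lam k0); exact: eigenvalue_lam.
    by move=> a /eigenvalueE [k ->].
  apply: ub_le_sup; last exact: eigenvalue_lam.
  by exists (lam k0) => a /eigenvalueE [k ->].
by exists k0 => // k; rewrite e.
Qed.

Lemma phi_min_lam : exists2 k0, phi_min A = lam k0 & forall k, phi_min A <= lam k.
Proof.
pose k0 := [arg min_(k < (0 : lattice q)) lam k]%O.
have k0P k : lam k0 <= lam k by rewrite /k0; case: arg_minP => // i _ /(_ k isT).
have e : phi_min A = lam k0.
  apply/eqP; rewrite eq_le; apply/andP; split; last first.
    apply: lb_le_inf; first by exists (lam k0); exact: eigenvalue_lam.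
    by move=> a /eigenvalueE [k ->].
  apply: ge_inf; last exact: eigenvalue_lam.
  by exists (lam k0) => a /eigenvalueE [k ->].
by exists k0 => // k; rewrite e.
Qed.

Lemma posdefA : posdefmx A <-> forall k, 0 < lam k.
Proof.
split=> [[_ pos] k|pos]; last split.
- have := pos _ (cas_row_neq0 k); rewrite cas_row_eigen -scalemxAl mxE dot_field.
  rewrite pmulr_lgt0 //; under eq_bigr do rewrite -expr2.
  rewrite -parseval (bigD1 k) //= ltr_pwDl ?sumr_ge0 //; last by move=> i _; rewrite sqr_ge0.
  rewrite (_ : field_of _ = cas k); last by apply/funext => u; rewrite row_of_field.
  by rewrite hartley_cas eqxx mul1r exprn_gt0 ?ltr0n.
- rewrite linearB /= trmx1; congr (_ - _); apply/matrixP => a b; rewrite !mxE.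
  by rewrite even opprB.
- move=> v v0; rewrite quad_formA lt_neqAle sumr_ge0 ?andbT; last first.
    by move=> k _; rewrite mulr_ge0 ?sqr_ge0 ?ltW.
  rewrite eq_sym; apply: contraNneq v0 => /eqP.
  rewrite psumr_eq0; last by move=> k _; rewrite mulr_ge0 ?sqr_ge0 ?ltW.
  move=> /allP h; apply/eqP/field_of_eq0/hartley_eq0 => k.
  have := h k (mem_index_enum _); rewrite /= mulf_eq0 sqrf_eq0 gt_eqF //=.
  by move=> /eqP.
Qed.

(** Up to [sigma2 / p ^ 2], the double sum is the covariance of two Hartley coefficients of the
    field. It is computed by inserting [A *m invmx A = 1] between two [cas] rows and letting [A] act
    on its eigenvector. *)
Lemma invmx_cas k l : (forall k, 0 < lam k) ->
  lam k * \sum_a \sum_b cas k (node a) * invmx A a b * cas l (node b) =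
  (k == l)%:R * (p ^ 2)%:R.
Proof.
move=> pos; have uA : A \in unitmx.
  rewrite -row_free_unit; apply: inj_row_free => v vA.
  apply/field_of_eq0/hartley_eq0 => k'.
  have := hartley_mulA v k'; rewrite vA (_ : hartley _ _ = 0).
    by move=> /esym /eqP; rewrite mulf_eq0 gt_eqF //= => /eqP.
  by rewrite /hartley big1 ?mul0r // => u _; rewrite /field_of mxE mul0r.
pose c k : 'rV[R]_(p * p) := \row_a cas k (node a).
have : (c k *m A *m invmx A *m (c l)^T) 0 0 = (k == l)%:R * (p ^ 2)%:R.
  rewrite mulmxK // dot_field.
  rewrite (eq_bigr (fun u => cas u k * cas u l)) ?sum_casM //.
  by move=> u _; rewrite !row_of_field !(casC u).
rewrite cas_row_eigen -!scalemxAl mxE => <-; congr (_ * _).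
rewrite mxE exchange_big /=; apply: eq_bigr => b _.
rewrite !mxE mulr_suml; apply: eq_bigr => a _.
by rewrite mxE.
Qed.

End even_kernel.

Lemma Theta_even theta : Theta theta -> forall u, entry theta u = entry theta (- u).
Proof. by case. Qed.

(** Turns the matrix conditions into bounds on each eigenvalue, so that perturbations are checked
    frequency by frequency. *)
Lemma Theta_plus_ofP (m : {set lattice q}) (rho : R) theta :
  Theta_plus_of m rho theta <->
  Theta_of m theta /\ forall k, 0 < 1 - spec theta k < rho.
Proof.
split=> [[mt [_ pos] rt]|[mt h]].
  have ev := Theta_even mt.1; split=> // k; rewrite (posdefA ev).1 //=.
  by have [k0 _ /(_ k) h] := phi_max_lam ev; exact: le_lt_trans rt.
have ev := Theta_even mt.1; split=> //.
  split; first exact: mt.1.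
  by apply/(posdefA ev) => k; case/andP: (h k).
by have [k0 -> _] := phi_max_lam ev; case/andP: (h k0).
Qed.

(** As [theta] vanishes at the origin, the excluded term [l = 0] can be restored, which makes the
    inner sum a full convolution; Parseval does the rest. *)
Lemma ls_criterion_spec n (x : 'I_n -> lattice q -> R) theta : Theta theta ->
  ls_criterion x theta = ((n * p ^ 2)%N%:R)^-1 *
    \sum_(i < n) \sum_k (1 - spec theta k) ^+ 2 * hartley (x i) k ^+ 2.
Proof.
move=> [t0 ev]; rewrite /ls_criterion; congr (_ * _); apply: eq_bigr => i _.
rewrite (eq_bigr (fun j => (x i j - \sum_l entry theta l * x i (j + l)) ^+ 2)); last first.
  by move=> j _; rewrite [X in _ = (_ - X) ^+ 2](bigD1 (0 : lattice q)) //= t0 mul0r add0r.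
rewrite -parseval; apply: eq_bigr => k _.
by rewrite hartleyB hartley_conv // -exprMn mulrBl mul1r.
Qed.

End circulant_spectrum.

(** * Dimension of the models *)

Section dimension_of_models.
Context {R : realType} {q : nat}.
Local Notation p := q.+1.
Implicit Types (m : {set lattice q}) (u l : lattice q).

(** At a node with [u = - u] the entry is 2 instead of 1; it only matters that it is nonzero. *)
Definition sym_delta u : 'M[R]_p :=
  \matrix_(i, j) (((i, j) == u)%:R + ((i, j) == - u)%:R).

Lemma entry_sym_delta u l : entry (sym_delta u) l = (l == u)%:R + (l == - u)%:R.
Proof. by case: l => i j; rewrite /entry mxE. Qed.

Lemma entryD (a b : 'M[R]_p) l : entry (a + b) l = entry a l + entry b l.
Proof. by rewrite /entry mxE. Qed.

Lemma entryZ c (a : 'M[R]_p) l : entry (c *: a) l = c * entry a l.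
Proof. by rewrite /entry mxE. Qed.

Lemma entry_sum (I : finType) (P : pred I) (F : I -> 'M[R]_p) l :
  entry (\sum_(i | P i) F i) l = \sum_(i | P i) entry (F i) l.
Proof. by rewrite /entry summxE. Qed.

Lemma entry_inj (a b : 'M[R]_p) : (forall l, entry a l = entry b l) -> a = b.
Proof. by move=> h; apply/matrixP => i j; exact: (h (i, j)). Qed.

(** Reading off the entries indexed by [m] is injective on matrices supported in [m]. *)
Lemma dimension_le_card m : (dimension (R := R) m <= #|m|)%N.
Proof.
rewrite /dimension; have [U mU] := Theta_of_subspace (R := R) m.
rewrite (dim_setE mU).
pose f (a : 'M[R]_p) : 'rV[R]_#|m| := \row_i entry a (enum_val i).
have lf : linear f by move=> c a b; apply/rowP => i; rewrite !mxE /entry !mxE.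
pose F : {linear 'M[R]_p -> _} := HB.pack f (GRing.isLinear.Build _ _ _ _ f lf).
have inj : (U :&: lker (linfun F))%VS = 0%VS.
  apply/eqP; rewrite -subv0; apply/subvP => a; rewrite memv_cap memv0.
  move=> /andP[/mU [_ am]]; rewrite memv_ker lfunE => /eqP /rowP fa.
  apply/eqP/entry_inj => l; rewrite [RHS]mxE.
  have [//|al] := eqVneq (entry a l) 0; have lm := am l al.
  have := fa (enum_rank_in lm l); rewrite !mxE.
  by rewrite enum_rankK_in.
rewrite -(limg_dim_eq inj) (leq_trans (dimvS (subvf _))) //.
by rewrite dimvf dim_matrix [leqLHS]mul1n.
Qed.

(** The matrices [sym_delta] of one representative per pair of opposite nodes are linearly
    independent. [H] picks the representative of smaller [enum_rank] and keeps the nodes equal to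
    their opposite. *)
Lemma card_le_dimension m : (forall u, u \in m -> - u \in m) -> 0 \notin m ->
  (#|m| <= 2 * dimension (R := R) m)%N.
Proof.
move=> mN m0; rewrite /dimension; have [U mU] := Theta_of_subspace (R := R) m.
rewrite (dim_setE mU).
pose H : {set lattice q} := [set l in m | (enum_rank l <= enum_rank (- l)%R)%N]%SET.
have cH : (#|m| <= 2 * #|H|)%N.
  have mH : m \subset H :|: (fun l : lattice q => - l) @: H.
    apply/fintype.subsetP => l lm; rewrite !inE lm /=.
    have [//|/ltnW le] := leqP (enum_rank l) (enum_rank (- l)).
    by apply/imsetP; exists (- l); rewrite ?opprK // inE mN //= opprK.
  rewrite (leq_trans (subset_leq_card mH)) //.
  rewrite (leq_trans (leq_card_setU _ _).1) //.
  by rewrite mul2n -addnn leq_add2l leq_imset_card.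
suff hU : (#|H| <= \dim U)%N by rewrite (leq_trans cH) // leq_mul2l hU orbT.
pose f (c : 'rV[R]_#|H|) : 'M[R]_p := \sum_i c 0 i *: sym_delta (enum_val i).
have lf : linear f.
  move=> c a b; rewrite /f scaler_sumr -big_split; apply: eq_bigr => i _.
  by rewrite !mxE scalerDl scalerA.
pose F : {linear 'rV[R]_#|H| -> _} := HB.pack f (GRing.isLinear.Build _ _ _ _ f lf).
have Hpm l l' : l \in H -> l' \in H -> l = - l' -> l = l'.
  rewrite !inE => /andP[_ h1] /andP[_ h2] e; apply: enum_rank_inj; apply: val_inj.
  apply/eqP; rewrite eqn_leq; apply/andP; split; last by move: h2; rewrite -e.
  by move: h1; rewrite {2}e opprK.
have inj : (fullv :&: lker (linfun F))%VS = 0%VS.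
  apply/eqP; rewrite -subv0; apply/subvP => c; rewrite memv_cap memv0 memvf andTb.
  rewrite memv_ker lfunE /= => /eqP fc; apply/eqP/rowP => i; rewrite mxE.
  have := congr1 (fun a => entry a (enum_val i)) fc.
  rewrite /= /f entry_sum [RHS]mxE (bigD1 i) //= big1 => [|j ji]; last first.
    rewrite entryZ entry_sym_delta (inj_eq enum_val_inj) eq_sym (negbTE ji).
    case: eqP => [/Hpm e|_]; rewrite ?addr0 ?mulr0 //.
    move: ji; rewrite -(inj_eq enum_val_inj) -e ?eqxx ?enum_valP //.
  rewrite addr0 entryZ entry_sym_delta eqxx => /eqP; rewrite mulf_eq0 => /orP[/eqP //|].
  by rewrite -natrD pnatr_eq0.
have := limg_dim_eq inj; rewrite dimvf dim_matrix [RHS]mul1n => <-.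
apply: dimvS; apply/subvP => a /memv_imgP [c _ ->]; rewrite lfunE; apply/mU.
have Hm l : l \in H -> l \in m by rewrite inE => /andP[].
split; first split.
- rewrite /= /f entry_sum big1 // => i _; rewrite entryZ entry_sym_delta.
  have im := Hm _ (enum_valP i).
  rewrite eq_sym (_ : enum_val i == 0 = false); last first.
    by apply/eqP => e; move: m0; rewrite -e im.
  rewrite eq_sym oppr_eq0 (_ : enum_val i == 0 = false) ?addr0 ?mulr0 //.
  by apply/eqP => e; move: m0; rewrite -e im.
- move=> u; rewrite /= /f !entry_sum; apply: eq_bigr => i _.
  by rewrite !entryZ !entry_sym_delta eqr_opp eqr_oppLR addrC.
- move=> u; rewrite /= /f entry_sum; apply: contraNT => um.
  apply/eqP; rewrite big1 // => i _; rewrite entryZ entry_sym_delta.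
  have im := Hm _ (enum_valP i).
  rewrite (_ : u == _ = false); last by apply/eqP => e; rewrite e im in um.
  rewrite (_ : u == _ = false) ?addr0 ?mulr0 //.
  by apply/eqP => e; rewrite e mN in um.
Qed.

Definition torus_norm2 u : nat :=
  minn u.1 (p - u.1) ^ 2 + minn u.2 (p - u.2) ^ 2.

Lemma torus_normE u : torus_norm u = Num.sqrt (torus_norm2 u)%:R :> R.
Proof. by []. Qed.

Lemma minn_ordN (i : 'I_p) : minn (- i)%R (p - (- i)%R) = minn i (p - i).
Proof.
have e : nat_of_ord (- i)%R = ((p - i) %% p)%N by [].
rewrite e; have := ltn_ord i; move: (nat_of_ord i) => k kp.
have [->|k0] := posnP k; first by rewrite subn0 modnn subn0 min0n.
by rewrite modn_small ?ltn_subrL ?k0 // subKn 1?ltnW // minnC.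
Qed.

Lemma torus_norm2N u : torus_norm2 (- u) = torus_norm2 u.
Proof. by rewrite /torus_norm2 [(- u).1]/(- u.1) [(- u).2]/(- u.2) !minn_ordN. Qed.

Lemma models_opp m : models R m -> forall u, u \in m -> - u \in m.
Proof.
move=> [r r0 ->] u; rewrite !inE oppr_eq0 => /andP[-> /=].
by rewrite !torus_normE torus_norm2N.
Qed.

Lemma models_0 m : models R m -> 0 \notin m.
Proof. by move=> [r r0 ->]; rewrite inE eqxx. Qed.

Lemma models_card_le m : models R m -> (#|m| <= 2 * dimension (R := R) m)%N.
Proof. by move=> mm; apply: card_le_dimension; [exact: models_opp | exact: models_0]. Qed.

Lemma models_total m1 m2 : models R m1 -> models R m2 -> (m1 \subset m2) || (m2 \subset m1).
Proof.
move=> [r1 _ ->] [r2 _ ->]; have [le|/ltW le] := leP r1 r2; apply/orP; [left|right];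
  apply/fintype.subsetP => u; rewrite !inE => /andP[-> /=] h; exact: le_trans h le.
Qed.

Definition ball_model (r : nat) : {set lattice q} :=
  [set u : lattice q | (u != 0) && (torus_norm2 u <= r ^ 2)%N]%SET.

Lemma ball_models r : (0 < r)%N -> models R (ball_model r).
Proof.
move=> r0; exists r%:R; first by rewrite ltr0n.
apply/setP => u; rewrite !inE; congr (_ && _).
rewrite torus_normE -[in RHS](@ler_pXn2r _ 2) ?nnegrE ?sqrtr_ge0 //.
by rewrite sqr_sqrtr // -natrX ler_nat.
Qed.

(** The arc consists of the residues [0, ..., r] and of the [r] residues just below [p]; the two
    sets may overlap when [r] is large. *)
Lemma card_minn_le r : (#|[set i : 'I_p | (minn i (p - i) <= r)%N]%SET| <= 2 * r + 1)%N.
Proof.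
pose A : {set 'I_p} := [set inord j | j : 'I_r.+1]%SET.
pose B : {set 'I_p} := [set inord (p - r + j)%N | j : 'I_r]%SET.
have AB : [set i : 'I_p | (minn i (p - i) <= r)%N]%SET \subset A :|: B.
  apply/fintype.subsetP => i; rewrite !inE geq_min => /orP[ir|ir]; apply/orP; [left|].
    by apply/imsetP; exists (Ordinal (ir : (i < r.+1)%N)); rewrite //= inord_val.
  have [ir'|ir'] := leqP i r; [left|right].
    by apply/imsetP; exists (Ordinal (ir' : (i < r.+1)%N)); rewrite //= inord_val.
  have h : (i - (p - r) < r)%N by have := ltn_ord i; lia.
  apply/imsetP; exists (Ordinal h) => //=; apply: val_inj => /=.
  by rewrite inordK; have := ltn_ord i; lia.
rewrite (leq_trans (subset_leq_card AB)) // (leq_trans (leq_card_setU _ _).1) //.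
have hA : (#|A| <= r.+1)%N by rewrite (leq_trans (leq_imset_card _ _)) ?card_ord.
have hB : (#|B| <= r)%N by rewrite (leq_trans (leq_imset_card _ _)) ?card_ord.
rewrite (leq_trans (leq_add hA hB)) //; lia.
Qed.

Lemma card_ball_le r : (#|ball_model r| <= (2 * r + 1) ^ 2)%N.
Proof.
pose S := [set i : 'I_p | (minn i (p - i) <= r)%N]%SET.
have sub : ball_model r \subset finset.setX S S.
  apply/fintype.subsetP => -[i j]; rewrite !inE => /andP[_] /=; rewrite /torus_norm2 /= => h.
  by rewrite -!(@leq_exp2r _ r 2) //; apply/andP; split; lia.
rewrite (leq_trans (subset_leq_card sub)) // cardsX -mulnn.
by rewrite leq_mul // card_minn_le.
Qed.

(** The ball contains the square of coordinates at most [r./2], where the squared norm is at most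
    [r ^ 2 / 2]; the [+ 1] counts the origin, which belongs to the square only. *)
Lemma card_ball_ge r : (r./2 <= q)%N -> (r./2.+1 ^ 2 <= #|ball_model r| + 1)%N.
Proof.
move=> rq; pose g (a : 'I_r./2.+1 * 'I_r./2.+1) : lattice q := (inord a.1, inord a.2).
have gi : injective g.
  move=> [a b] [c d] /= [] /(congr1 val) /=.
  have lt (i : 'I_r./2.+1) : (i < p)%N by rewrite (leq_trans (ltn_ord i)).
  rewrite !inordK // => /val_inj -> /(congr1 val) /=; rewrite !inordK //.
  by move=> /val_inj ->.
have : ([set g a | a in [set: 'I_r./2.+1 * 'I_r./2.+1]] \subset (0 : lattice q)%R |: ball_model r)%SET.
  apply/fintype.subsetP => u /imsetP [[a b] _ ->]; rewrite !inE.
  have lt (i : 'I_r./2.+1) : (i < p)%N by rewrite (leq_trans (ltn_ord i)).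
  case: eqVneq => //= _; rewrite /torus_norm2 /= !inordK //.
  have h (i : 'I_r./2.+1) k : (minn i k ^ 2 <= r./2 ^ 2)%N.
    by rewrite leq_exp2r // geq_min -ltnS ltn_ord.
  rewrite (leq_trans (leq_add (h a _) (h b _))) //.
  have := odd_double_half r; lia.
move=> /subset_leq_card; rewrite card_imset // cardsT card_prod !card_ord mulnn.
by move=> h; rewrite (leq_trans h) // cardsU1 addnC leq_add2l leq_b1.
Qed.

(** A ball of radius about half the square root of [min (sqrt V) (p ^ 2)] has at most that minimum
    of nodes, hence an admissible dimension, and so lies in [m]. Counting its nodes from below gives
    the bounds. *)
Lemma largest_model_card n m : (0 < n)%N -> (72 <= p)%N ->
  (forall m1, models R m1 ->
    (dimension (R := R) m1)%:R <= Num.sqrt ((n * p ^ 2)%N%:R : R) -> m1 \subset m) ->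
  p%:R <= 72 * (#|m|%:R : R) /\
  Num.min (Num.sqrt (n * p ^ 2)%N%:R) (p ^ 2)%N%:R <= 72 * (#|m|%:R : R).
Proof.
move=> n0 p72 hm; set x : R := Num.sqrt _; set b : R := Num.min _ _.
have xp : p%:R <= x.
  rewrite -[p%:R]ger0_norm // -sqrtr_sqr ler_wsqrtr // -natrX ler_nat.
  by rewrite -{1}[(p ^ 2)%N]mul1n leq_mul2r n0 orbT.
have bp : p%:R <= b.
  by rewrite le_min xp ler_nat -mulnn leq_pmulr.
have b0 : 0 <= b by rewrite (le_trans _ bp).
pose t := Num.truncn (Num.sqrt b).
have /andP[t1 t2] : t%:R <= Num.sqrt b < t.+1%:R by apply: truncn_itv; rewrite sqrtr_ge0.
have tb : (t ^ 2)%:R <= b.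
  by rewrite natrX -[leRHS](sqr_sqrtr b0) ler_pXn2r ?nnegrE ?sqrtr_ge0.
have bt : b < (t.+1 ^ 2)%:R.
  by rewrite natrX -[ltLHS](sqr_sqrtr b0) ltr_pXn2r ?nnegrE ?sqrtr_ge0.
(* Here [72 <= p] enters: it forces [r./2 >= 1], so that the lower count of the ball is positive
   once the origin is removed. *)
have t8 : (8 <= t)%N.
  have : (72 < t.+1 ^ 2)%N by rewrite -(ltr_nat R) (le_lt_trans _ bt) // (le_trans _ bp) ?ler_nat.
  by rewrite -mulnn; move: (t) => t'; nia.
have tp : (t <= p)%N.
  rewrite -(@leq_exp2r _ _ 2) // -(ler_nat R) (le_trans tb) // ge_min lexx orbT //.
pose r := (t.-1)./2.
have rt : (2 * r + 1 <= t)%N by have := odd_double_half t.-1; lia.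
have tr : (t <= 2 * r + 2)%N by have := odd_double_half t.-1; lia.
have r0 : (0 < r)%N by lia.
have sub : ball_model r \subset m.
  apply: hm; first exact: ball_models.
  apply: (@le_trans _ _ b); last by rewrite ge_min lexx.
  rewrite (le_trans _ tb) // ler_nat (leq_trans (dimension_le_card _)) //.
  by rewrite (leq_trans (card_ball_le _)) // leq_exp2r.
have := subset_leq_card sub; have := @card_ball_ge r.
have r2 := odd_double_half r.
have -> : (r./2 <= q)%N by lia.
move=> /(_ isT) c1 c2.
suff : b <= 72 * (#|m|%:R : R) by move=> h; split => //; exact: le_trans h.
rewrite (le_trans (ltW bt)) // -natrM ler_nat.
have : (r + 1 <= 2 * r./2.+1)%N by lia.
nia.
Qed.

End dimension_of_models.

(** * Integration against image densities and independence *)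

Section integral_density.
Context d d' (T : measurableType d) (T' : measurableType d') (R : realType).
Variables (P : {measure set T -> \bar R}) (m : {measure set T' -> \bar R}).
Variables (phi : T -> T') (h : T -> R).
Hypotheses (mphi : measurable_fun setT phi) (mh : measurable_fun setT h).
Hypothesis h0 : forall x, 0 <= h x.
Hypothesis mE : forall E, measurable E ->
  m E = (\int[P]_x (\1_E (phi x) * h x)%:E)%E.
Local Open Scope ereal_scope.
Import HBNNSimple.

Let mprod (g : T' -> R) : measurable_fun setT g ->
  measurable_fun setT (fun x => (g (phi x) * h x)%:E).
Proof.
move=> mg; apply/measurable_EFinP/measurable_funM => //.
exact: measurableT_comp mg mphi.
Qed.

Let integral_density_nnsfun (f : {nnsfun T' >-> R}) :
  \int[m]_y (f y)%:E = \int[P]_x (f (phi x) * h x)%:E.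
Proof.
under [LHS]eq_integral do rewrite fimfunE -fsumEFin//.
rewrite [LHS]ge0_integral_fsum//; last 2 first.
  - by move=> r; exact/measurable_EFinP/measurableT_comp.
  - by move=> n x _; rewrite EFinM nnfun_muleindic_ge0.
transitivity (\int[P]_x
    (\sum_(r \in range f) (r * \1_(f @^-1` [set r]) (phi x) * h x)%:E)); last first.
  apply: eq_integral => x _; rewrite [in RHS]fimfunE fsumEFin //; congr EFin.
  by rewrite mulr_fsuml.
rewrite ge0_integral_fsum//; last 2 first.
  - move=> r; apply: (@mprod (fun y => r * \1_(f @^-1` [set r]) y)%R).
    exact: measurable_funM.
  - move=> r x _; rewrite EFinM; apply: mule_ge0; last by rewrite lee_fin.
    by rewrite EFinM; exact: nnfun_muleindic_ge0.
apply: eq_fsbigr => r _; rewrite integralZl_indic_nnsfun //.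
rewrite integral_indic // setIT mE //.
have [->|r0] := eqVneq r 0%R.
  by rewrite mul0e integral0_eq // => x _; rewrite !mul0r.
have [[y fy]|nr] := pselect (exists y, f y = r).
  rewrite -ge0_integralZl //=.
  - by apply: eq_integral => x _; rewrite -EFinM mulrA.
  - apply: mprod => //.
  - by move=> x _; rewrite lee_fin mulr_ge0.
  - by rewrite lee_fin -fy.
have e0 : f @^-1` [set r] = set0.
  by apply/seteqP; split=> y //= fy; apply: nr; exists y.
rewrite e0; rewrite !integral0_eq ?mule0 // => x _; by rewrite indic0 ?mulr0 mul0r.
Qed.

(** [mE] is the case of indicators, extended through simple functions and monotone convergence. It
    serves to pass from a normal law to its density, and to peel one factor off an expectation of
    independent factors. *)
Lemma ge0_integral_density (f : T' -> \bar R) :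
  measurable_fun setT f -> (forall y, 0 <= f y) ->
  \int[m]_y f y = \int[P]_x (f (phi x) * (h x)%:E).
Proof.
move=> mf f0; pose f_ := nnsfun_approx measurableT mf.
transitivity (lim (\int[m]_y (f_ n y)%:E @[n --> \oo])).
  rewrite -monotone_convergence//=.
  - apply: eq_integral => ? /[!inE] xD; apply/esym/cvg_lim => //=.
    exact: cvg_nnsfun_approx.
  - by move=> n; exact/measurable_EFinP/measurable_funTS.
  - by move=> n ? _; rewrite lee_fin.
  - by move=> ? _ ? ? mn; rewrite lee_fin; exact/lefP/nd_nnsfun_approx.
transitivity (lim (\int[P]_x (f_ n (phi x) * h x)%:E @[n --> \oo])).
  by apply: congr_lim; apply/funext => n /=; exact: integral_density_nnsfun.
rewrite -monotone_convergence//=.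
- apply: eq_integral => x _; apply/cvg_lim => //=.
  under eq_fun do rewrite EFinM.
  apply: cvgeZr => //; exact: (@cvg_nnsfun_approx _ _ _ _ measurableT _ mf (fun y _ => f0 y)).
- by move=> n; apply: mprod.
- by move=> n x _; rewrite lee_fin mulr_ge0.
- move=> x _ a b ab; rewrite lee_fin ler_wpM2r //; exact/lefP/nd_nnsfun_approx.
Qed.

End integral_density.

(** * Expectation of a product of independent factors *)

Section independent_product.
Context d (T : measurableType d) (R : realType) (P : probability T R).
Variables (n : nat) (G : 'I_n -> set (set T)).
Hypothesis mG : forall i A, G i A -> measurable A.
Hypothesis indep : forall E : 'I_n -> set T, (forall i, <<s G i >> (E i)) ->
  P (\bigcap_i E i) = (\prod_(i < n) P (E i))%E.

Lemma sigma_measurable i A : <<s G i >> A -> measurable A.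
Proof.
move: A; apply: smallest_sub; last exact: mG.
exact: sigma_algebra_measurable.
Qed.

Lemma measurable_sub_sigma i (f : T -> R) :
  measurable_fun setT (f : g_sigma_algebraType (G i) -> R) -> measurable_fun setT f.
Proof.
move=> mf _ B mB; rewrite setTI.
by have := mf measurableT B mB; rewrite setTI => /sigma_measurable.
Qed.

Lemma measurable_id_sub_sigma i :
  measurable_fun setT (id : T -> g_sigma_algebraType (G i)).
Proof. by move=> _ B /sigma_measurable mB; rewrite setTI. Qed.

(** Induction on the number of factors not known to be indicators. Replacing such a factor [j] by
    indicators shows that, on [G j], weighting [P] by the product [h] of the other factors amounts
    to scaling it by a constant; the factor [j] is then integrated against this scaled measure. *)
Lemma integral_prod_independent (f : 'I_n -> T -> R) (a : 'I_n -> R) :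
  (forall i x, 0 <= f i x) ->
  (forall i, measurable_fun setT (f i : g_sigma_algebraType (G i) -> R)) ->
  (forall i, \int[P]_x (f i x)%:E = (a i)%:E)%E ->
  (\int[P]_x (\prod_(i < n) f i x)%:E = (\prod_(i < n) a i)%:E)%E.
Proof.
suff main (J : {set 'I_n}) : forall (f : 'I_n -> T -> R) (a : 'I_n -> R),
    (forall i x, 0 <= f i x) ->
    (forall i, measurable_fun setT (f i : g_sigma_algebraType (G i) -> R)) ->
    (forall i, \int[P]_x (f i x)%:E = (a i)%:E)%E ->
    (forall i, i \notin J -> exists2 E, <<s G i >> E & f i = \1_E) ->
    (\int[P]_x (\prod_(i < n) f i x)%:E = (\prod_(i < n) a i)%:E)%E.
  by move=> f0 mf fa; apply: (main [set: 'I_n]%SET) => // i; rewrite finset.in_setT.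
move en : #|J| => k; elim: k J en => [|k IH] J Jk {}f {}a f0 mf fa fE.
  move/eqP: Jk; rewrite cards_eq0 => /eqP J0.
  have {}fE i : exists E, <<s G i >> E /\ f i = \1_E.
    by have [|E sE e] := fE i; [rewrite J0 finset.in_set0 | exists E].
  have [E sE] := choice fE.
  rewrite (eq_integral (fun x => (\1_(\bigcap_i E i) x)%:E)); last first.
    move=> x _; congr EFin; rewrite indicE.
    case: (boolP (x \in _)) => [/set_mem xE|/negP nx].
      rewrite big1 // => i _; rewrite (sE i).2 indicE mem_set //; exact: xE.
    have [i xi] : exists i, ~ E i x.
      by apply/existsNP => h; apply: nx; apply/mem_set => i _; exact: h.
    rewrite (bigD1 i) //= (sE i).2 indicE memNset ?mul0r //.
  rewrite integral_indic //; last first.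
    apply: fin_bigcap_measurable => // i _; apply: sigma_measurable; exact: (sE i).1.
  rewrite setIT; transitivity (P (\bigcap_i E i)) => //.
  rewrite indep => [|i]; last exact: (sE i).1.
  rewrite -prodEFin; apply: eq_bigr => i _; rewrite -fa (sE i).2 integral_indic ?setIT //.
  by apply: sigma_measurable; exact: (sE i).1.
have [j jJ] : exists j, j \in J by apply/finset.set0Pn; rewrite -card_gt0 Jk.
pose h x := \prod_(i < n | i != j) f i x.
pose c := \prod_(i < n | i != j) a i.
have a0 i : 0 <= a i by rewrite -lee_fin -fa integral_ge0 // => x _; rewrite lee_fin.
have c0 : 0 <= c by apply: prodr_ge0.
have mh : measurable_fun setT h.
  rewrite /h; under eq_fun do rewrite -big_filter.
  by apply: measurable_prod => i _; exact: measurable_sub_sigma (mf i).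
(* The identity, seen as a map to the coarser sigma-algebra: the scaled measure agrees with the
   weighted one on events of [G j] only. *)
pose X : {mfun T >-> g_sigma_algebraType (G j)} :=
  HB.pack (id : T -> g_sigma_algebraType (G j))
    (isMeasurableFun.Build _ _ _ _ _ (@measurable_id_sub_sigma j)).
pose m : {measure set (g_sigma_algebraType (G j)) -> \bar R} :=
  mscale (NngNum c0) (distribution P X).
have mE (E : set (g_sigma_algebraType (G j))) : measurable E -> m E = (\int[P]_x (\1_E (X x) * h x)%:E)%E.
  move=> sE; have mE : d.-measurable (E : set T) by exact: sigma_measurable sE.
  pose f' i := if i == j then \1_E else f i.
  pose a' i := if i == j then fine (P E) else a i.
  have PE : P E = (fine (P E))%:E by rewrite fineK // fin_num_measure.
  have ea : \prod_(i < n) a' i = fine (P E) * c.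
    rewrite (bigD1 j) //= /a' eqxx; congr (_ * _).
    by apply: eq_bigr => i /negbTE ij; rewrite ij.
  have -> : m E = (\prod_(i < n) a' i)%:E by rewrite ea mulrC EFinM -PE.
  rewrite -(IH (J :\ j)%SET _ f' a').
  - apply: eq_integral => x _; congr EFin; rewrite (bigD1 j) //= /f' eqxx.
    by congr (_ * _); apply: eq_bigr => i /negbTE ij; rewrite ij.
  - by move: Jk; rewrite (cardsD1 j) jJ => -[].
  - by move=> i x; rewrite /f'; case: ifP => // _; rewrite indicE.
  - move=> i; rewrite /f'; have [->|ij] := eqVneq i j; last exact: mf.
    exact: measurable_indic.
  - move=> i; rewrite /f' /a'; have [_|ij] := eqVneq i j; last exact: fa.
    by rewrite -PE integral_indic // setIT.
  - move=> i; rewrite /f' finset.in_setD1 negb_and negbK.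
    have [->|ij] := eqVneq i j; first by exists E.
    exact: fE.
have := @ge0_integral_density _ _ T (g_sigma_algebraType (G j)) R P m X h.
have mX : measurable_fun setT (X : T -> g_sigma_algebraType (G j)).
  exact: measurable_funP.
have h0 x : 0 <= h x by rewrite prodr_ge0.
move=> /(_ mX mh h0 mE (EFin \o f j)).
have mfj : measurable_fun setT (EFin \o f j : g_sigma_algebraType (G j) -> \bar R).
  by apply/measurable_EFinP; exact: mf.
move=> /(_ mfj (fun y => ltac:(by rewrite lee_fin))) e.
rewrite [in RHS](bigD1 j) //= -/c.
transitivity (\int[P]_x ((EFin \o f j) (X x) * (h x)%:E))%E.
  by apply: eq_integral => x _; rewrite (bigD1 j).
rewrite -e ge0_integral_mscale //=; last by move=> y _; rewrite lee_fin.
rewrite ge0_integral_distribution; [|exact: mfj|by move=> y; rewrite lee_fin].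
by rewrite EFinM muleC; congr (_ * _)%E; exact: fa.
Qed.

End independent_product.

(** * Expectation on the algebra of functions with moments of all orders *)

Section moments.
Context d (T : measurableType d) (R : realType) (P : probability T R).
Implicit Types f g : T -> R.

Definition Ex f : R := \int[P]_x f x.

(** All powers are required to be integrable, which makes the class stable under products as well as
    sums. *)
Definition moments f : Prop := measurable_fun setT f /\
  forall k, P.-integrable setT (fun x => (f x ^+ k)%:E).

Lemma moments_measurable f : moments f -> measurable_fun setT f.
Proof. by case. Qed.

Lemma moments_integrable f : moments f -> P.-integrable setT (EFin \o f).
Proof. by move=> [_ /(_ 1)]. Qed.

Lemma moments_cst c : moments (fun=> c).
Proof.
split=> [|k]; first exact: measurable_cst.
exact: finite_measure_integrable_cst.
Qed.

(** [|f g| ^ k <= f ^ (2 k) + g ^ (2 k)]. *)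
Lemma momentsM f g : moments f -> moments g -> moments (fun x => f x * g x).
Proof.
move=> [mf If] [mg Ig]; split=> [|k]; first exact: measurable_funM.
have I : P.-integrable setT (fun x => (f x ^+ (k.*2) + g x ^+ (k.*2))%:E).
  by have := integrableD measurableT (If k.*2) (Ig k.*2).
apply: le_integrable I => //.
  by apply/measurable_EFinP/measurable_funX; exact: measurable_funM.
move=> x _; rewrite lee_fin -!muln2 !exprM [leRHS]ger0_norm ?addr_ge0 ?sqr_ge0 //.
rewrite exprMn normrM -(real_normK (num_real (f x ^+ k))).
rewrite -(real_normK (num_real (g x ^+ k))).
have := sqr_ge0 (`|f x ^+ k| - `|g x ^+ k|).
have := normr_ge0 (f x ^+ k); have := normr_ge0 (g x ^+ k).
move: `|f x ^+ k| `|g x ^+ k| => a b; nra.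
Qed.

Lemma momentsX f k : moments f -> moments (fun x => f x ^+ k).
Proof.
move=> mf; elim: k => [|k IH]; first exact: (moments_cst 1).
under eq_fun do rewrite exprS.
exact: momentsM.
Qed.

Lemma momentsZ c f : moments f -> moments (fun x => c * f x).
Proof. by move=> mf; apply: momentsM => //; exact: moments_cst. Qed.

Lemma momentsD f g : moments f -> moments g -> moments (fun x => f x + g x).
Proof.
move=> mf mg; split=> [|k].
  by apply: measurable_funD; [exact: mf.1 | exact: mg.1].
under eq_fun do rewrite exprDn -sumEFin.
apply: integrable_sum => // i _.
by apply: moments_integrable; rewrite /comp; under eq_fun do rewrite -mulr_natl;
  apply: momentsZ; apply: momentsM; exact: momentsX.
Qed.

Lemma momentsN f : moments f -> moments (fun x => - f x).
Proof. by move=> mf; under eq_fun do rewrite -mulN1r; exact: momentsZ. Qed.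

Lemma momentsB f g : moments f -> moments g -> moments (fun x => f x - g x).
Proof. by move=> mf mg; apply: momentsD => //; exact: momentsN. Qed.

Lemma moments_sum (I : Type) (s : seq I) (Q : pred I) (F : I -> T -> R) :
  (forall i, moments (F i)) -> moments (fun x => \sum_(i <- s | Q i) F i x).
Proof.
move=> mF; elim: s => [|i s IH].
  by under eq_fun do rewrite big_nil; exact: moments_cst.
under eq_fun do rewrite big_cons.
by case: (Q i) => //; exact: momentsD.
Qed.

Lemma moments_prod (I : Type) (s : seq I) (Q : pred I) (F : I -> T -> R) :
  (forall i, moments (F i)) -> moments (fun x => \prod_(i <- s | Q i) F i x).
Proof.
move=> mF; elim: s => [|i s IH].
  by under eq_fun do rewrite big_nil; exact: moments_cst.
under eq_fun do rewrite big_cons.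
by case: (Q i) => //; exact: momentsM.
Qed.

Lemma Ex_cst c : Ex (fun=> c) = c.
Proof.
rewrite /Ex Rintegral_cst // (_ : fine _ = 1) ?mulr1 //.
by transitivity (fine (P setT)) => //; rewrite probability_setT.
Qed.

Lemma ExD f g : moments f -> moments g -> Ex (fun x => f x + g x) = Ex f + Ex g.
Proof. by move=> mf mg; rewrite /Ex RintegralD //; exact: moments_integrable. Qed.

Lemma ExZ c f : moments f -> Ex (fun x => c * f x) = c * Ex f.
Proof. by move=> mf; rewrite /Ex RintegralZl //; exact: moments_integrable. Qed.

Lemma eq_Ex f g : f =1 g -> Ex f = Ex g.
Proof. by move=> /funext ->. Qed.

Lemma Ex_sum (I : Type) (s : seq I) (Q : pred I) (F : I -> T -> R) :
  (forall i, moments (F i)) ->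
  Ex (fun x => \sum_(i <- s | Q i) F i x) = \sum_(i <- s | Q i) Ex (F i).
Proof.
move=> mF; elim: s => [|i s IH].
  by rewrite big_nil -[RHS](Ex_cst 0); apply: eq_Ex => x; rewrite big_nil.
rewrite big_cons -IH; under eq_Ex do rewrite big_cons.
by case: (Q i) => //; rewrite ExD //; exact: moments_sum.
Qed.

Lemma ExE f : moments f -> (\int[P]_x (f x)%:E = (Ex f)%:E)%E.
Proof.
by move=> mf; rewrite /Ex /Rintegral fineK //; apply: integrable_fin_num => //;
  exact: moments_integrable.
Qed.

Lemma markov_Ex f a : moments f -> (forall x, 0 <= f x) -> 0 < a ->
  (P [set x | a <= f x]%R <= (Ex f / a)%:E)%E.
Proof.
move=> mf f0 a0; rewrite EFinM -ExE // lee_pdivlMr //.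
have mA : measurable [set x | a <= f x]%R.
  have -> : [set x | a <= f x]%R = setT `&` f @^-1` `[a, +oo[%classic.
    by apply/seteqP; split=> x /=; rewrite in_itv /= andbT => -[].
  by case: mf => mf _; apply: mf => //; exact: measurable_itv.
rewrite muleC -integral_cst // integral_mkcond /=.
apply: ge0_le_integral => //=.
- move=> x _; rewrite patchE; case: ifP => // _; rewrite lee_fin; exact: ltW.
- by apply/(measurable_restrictT _ mA); exact: measurable_cst.
- by apply/measurable_EFinP; exact: mf.1.
- move=> x _; rewrite patchE; case: ifPn => [/set_mem//|_]; rewrite lee_fin.
  exact: f0.
Qed.

End moments.

(** * Moments of Gaussian fields *)

Section integral_of_derivative.
Context {R : realType}.
Local Notation mu := (@lebesgue_measure R).

(** Fundamental theorem of calculus on [[-n, n]], with dominated convergence by [|f|]; this plays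
    the part of integration by parts for the normal density. *)
Lemma integral_derivative_eq0 (F f : R -> R) :
  (forall x : R, is_derive x 1 F (f x)) -> continuous f ->
  mu.-integrable setT (EFin \o f) ->
  F n%:R @[n --> \oo] --> (0 : R) -> F (- n%:R) @[n --> \oo] --> (0 : R) ->
  (\int[mu]_x (f x)%:E = 0)%E.
Proof.
move=> dF cf If Fy FNy.
pose I n : set R := `[- n%:R, n%:R]%classic.
have mI n : measurable (I n) by exact: measurable_itv.
have drF (x : R) : derivable F x 1 by have [] := dF x.
have cF : continuous F.
  by move=> x; apply: differentiable_continuous; apply/derivable1_diffP; exact: drF.
have mf : measurable_fun setT f by exact: continuous_measurable_fun.
have mEf : measurable_fun setT (EFin \o f) by apply/measurable_EFinP.
have [||||_ _ lim] := @dominated_convergence _ _ _ mu setT measurableT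
  (fun n => (EFin \o f) \_ (I n)) (EFin \o f) (fun x => `|(f x)%:E|)%E _ mEf.
- by move=> n; apply/(measurable_restrictT _ (mI n)); exact: measurable_funTS.
- apply: aeW => x _.
  apply: cvg_near_cst.
  have [k xk] : exists k : nat, `|x| <= k%:R.
    by exists (Num.truncn `|x|).+1; rewrite ltW // truncnS_gt.
  exists k => // n /= kn; rewrite patchE mem_set // /I /= in_itv /= -ler_norml.
  by rewrite (le_trans xk) // ler_nat.
- exact: integrable_abse.
- apply: aeW => x n _; rewrite patchE; case: ifP => // _.
  by rewrite abse0 abse_ge0.
have e : (F n%:R - F (- n%:R))%:E @[n --> \oo] --> (\int[mu]_x (f x)%:E)%E.
  apply: cvg_trans lim; apply: near_eq_cvg; exists 1 => // n /= n1.
  rewrite -integral_mkcond (@continuous_FTC2 _ _ F) ?EFinB //.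
  - by rewrite (@lt_trans _ _ 0) ?oppr_lt0 ?ltr0n.
  - exact: continuous_subspaceT.
  - split.
    + by move=> x _; exact: drF.
    + by apply: cvg_at_right_filter; exact: cF.
    + by apply: cvg_at_left_filter; exact: cF.
  - by move=> x _; rewrite derive1E; have [_ ->] := dF x.
apply: (cvg_unique _ e) => //.
have -> : 0%E = (0 - 0 : R)%:E by rewrite subr0.
apply: cvg_EFin; first by apply: nearW.
exact: cvgB.
Qed.

End integral_of_derivative.

(** * Central moments of the normal density *)

Section normal_moments.
Context {R : realType}.
Local Notation mu := (@lebesgue_measure R).
Variables (m s : R).
Hypothesis s0 : s != 0.
Local Notation phi := (normal_pdf m s).

(** The factor [k%:R] makes the formula right at [k = 0], where [k.-1] is 0. Integrating it gives
    the recurrence of the moments. *)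
Lemma is_derive_pow_normal k (x : R) :
  is_derive x 1 (fun x => (x - m) ^+ k * phi x)
    (k%:R * ((x - m) ^+ k.-1 * phi x) - ((x - m) ^+ k.+1 * phi x) / s ^+ 2).
Proof.
have s20 : s ^+ 2 != 0 by rewrite sqrf_eq0.
have d1 : is_derive x 1 (fun y : R => y - m) 1.
  have := is_deriveB (is_derive_id x 1) (is_derive_cst m x 1).
  by rewrite subr0.
pose c := (s ^+ 2 *+ 2)^-1.
pose G (y : R) := - c * (y - m) ^+ 2.
have d2 : is_derive x 1 G (- (x - m) / s ^+ 2).
  have := is_deriveZ (- c) (is_deriveX 2 d1).
  rewrite (_ : _ *: _ = - (x - m) / s ^+ 2) //.
  by rewrite /GRing.scale /= /c; field.
have d3 := @is_derive1_comp R expR G x _ _ (is_derive_expR (G x)) d2.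
have d4 := is_deriveM (is_deriveX k d1) (is_deriveZ (normal_peak s) d3).
rewrite (_ : (fun x => _) = ((fun y : R => y - m) ^+ k *
   (normal_peak s \*: (expR \o G)))).
  apply: (is_derive_eq d4).
  transitivity (((fun y : R => y - m) ^+ k) x *
      (normal_peak s * (expR (G x) * (- (x - m) / s ^+ 2))) +
      (normal_peak s * expR (G x)) * (k%:R * (x - m) ^+ k.-1 * 1)) => //.
  rewrite !normal_pdfE // /normal_fun.
  have -> : - (x - m) ^+ 2 / (s ^+ 2 *+ 2) = G x by rewrite /G /c; ring.
  rewrite (_ : ((fun y : R => y - m) ^+ k) x = (x - m) ^+ k); last by rewrite exprfctE.
  by case: (k) => [|j] /=; rewrite ?expr0 ?exprS; field.
apply/funext => y; rewrite normal_pdfE // /normal_fun.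
have -> : - (y - m) ^+ 2 / (s ^+ 2 *+ 2) = G y by rewrite /G /c; ring.
by rewrite -[RHS]/(_ y * _ y) exprfctE.
Qed.

(** With [y = (x - m) ^ 2 / (4 s ^ 2)] the density is a constant times [exp (- 2 y)]. One factor
    [exp (- y)] is the profile of variance [2 s ^ 2]; the other absorbs the power because
    [y ^ (k + 1) <= (k + 1)! exp y]. *)
Lemma pow_normal_le k : exists2 C, 0 <= C &
  forall x, `|x - m| ^+ k * phi x <= C * normal_pdf m (Num.sqrt 2 * s) x.
Proof.
have s20 : 0 < s ^+ 2 by rewrite exprn_even_gt0.
pose K : R := 1 + (4 * s ^+ 2) ^+ k.+1 * (k.+1)`!%:R.
have K0 : 0 <= K by rewrite addr_ge0 // mulr_ge0 // exprn_ge0 // mulr_ge0 // ltW.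
have r2 : Num.sqrt 2 != 0 :> R by rewrite gt_eqF // sqrtr_gt0.
pose pk := normal_peak s / normal_peak (Num.sqrt 2 * s).
have pk0 : 0 <= pk by rewrite divr_ge0 ?normal_peak_ge0.
exists (K * pk) => [|x]; first exact: mulr_ge0.
rewrite !normal_pdfE ?mulf_neq0 //.
have -> : K * pk * (normal_peak (Num.sqrt 2 * s) * normal_fun m (Num.sqrt 2 * s) x) =
    normal_peak s * (K * normal_fun m (Num.sqrt 2 * s) x).
  by rewrite /pk; field; rewrite gt_eqF // normal_peak_gt0 // mulf_neq0.
rewrite mulrCA ler_wpM2l ?normal_peak_ge0 //.
rewrite /normal_fun exprMn sqr_sqrtr //.
pose y := (x - m) ^+ 2 / (4 * s ^+ 2).
have -> : - (x - m) ^+ 2 / (2 * s ^+ 2 *+ 2) = - y by rewrite /y; field.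
have -> : - (x - m) ^+ 2 / (s ^+ 2 *+ 2) = - y - y by rewrite /y; field.
rewrite expRD mulrA ler_wpM2r ?expR_ge0 //.
rewrite expRN ler_pdivrMr ?expR_gt0 //.
have y0 : 0 <= y by rewrite divr_ge0 ?sqr_ge0 // mulr_ge0 // ltW.
have e1 := expR_ge1Dxn k y0.
have e2 : `|x - m| ^+ k <= 1 + `|x - m| ^+ (k.+1).*2.
  have [l1|l1] := leP `|x - m| 1.
    by rewrite (@le_trans _ _ 1) ?exprn_ile1 ?lerDl ?exprn_ge0.
  rewrite (@le_trans _ _ (`|x - m| ^+ (k.+1).*2)) ?lerDr //.
  by rewrite ler_weXn2l 1?ltW // -addnn; lia.
apply: le_trans e2 _; rewrite -mul2n exprM real_normK ?num_real //.
have -> : (x - m) ^+ 2 = 4 * s ^+ 2 * y.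
  by rewrite /y; field.
rewrite exprMn /K [leRHS]mulrDl mul1r; apply: lerD.
  by rewrite -expR0 ler_expR.
have p4 : 0 <= 4 * s ^+ 2 by rewrite mulr_ge0 ?sqr_ge0.
rewrite -mulrA ler_wpM2l ?(exprn_ge0 _ p4) //.
rewrite -ler_pdivrMl ?ltr0n ?fact_gt0 // mulrC (le_trans _ e1) // lerDr //.
Qed.

Lemma integrable_pow_normal k :
  mu.-integrable setT (fun x : R => ((x - m) ^+ k * phi x)%:E).
Proof.
have [C C0 hC] := pow_normal_le k.
have mp : measurable_fun setT (fun x : R => (x - m) ^+ k * phi x).
  apply: measurable_funM; last exact: measurable_normal_pdf.
  by apply: measurable_funX; exact: measurable_funB.
have := integrableZl measurableT C (integrable_normal_pdf m (Num.sqrt 2 * s)).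
apply: le_integrable => //; first exact/measurable_EFinP.
move=> x _; rewrite -EFinM lee_fin [leLHS]normrM normrX.
rewrite [X in _ * X <= _]ger0_norm ?normal_pdf_ge0 //.
by rewrite (le_trans (hC x)) // ler_norm.
Qed.

Lemma pow_normal_bounded k : exists C, forall x, `|(x - m) ^+ k * phi x| <= C.
Proof.
have [C C0 hC] := pow_normal_le k.
exists (C * normal_peak (Num.sqrt 2 * s)) => x.
rewrite normrM normrX [X in _ * X]ger0_norm ?normal_pdf_ge0 // (le_trans (hC x)) //.
by rewrite ler_wpM2l // normal_pdf_ub // mulf_neq0.
Qed.

(** Boundedness for the exponents [k] and [k.+1] gives a decay in [1 / n]; [e] is the sign of the
    end of the line. *)
Lemma pow_normal_cvg0 k (e : R) : `|e| = 1 ->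
  (e * n%:R - m) ^+ k * phi (e * n%:R) @[n --> \oo] --> (0 : R).
Proof.
move=> e1; have [C hC] := pow_normal_bounded k; have [D hD] := pow_normal_bounded k.+1.
pose K := D + `|m| * C + C.
pose F n := (e * n%:R - m) ^+ k * phi (e * n%:R).
have bound n : `|F n| <= K * harmonic n.
  rewrite /harmonic ler_pdivlMr // -natr1 mulrDr mulr1 /K.
  apply: lerD; last exact: hC.
  rewrite (_ : `|F n| * _ = `|F n| * `|e * n%:R|); last first.
    by congr (_ * _); rewrite normrM e1 mul1r normr_nat.
  rewrite -[e * n%:R](subrK m).
  apply: (@le_trans _ _ (`|F n| * (`|e * n%:R - m| + `|m|))).
    by rewrite ler_wpM2l // ler_normD.
  rewrite mulrDr; apply: lerD; last by rewrite mulrC ler_wpM2l //; exact: hC.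
  by rewrite -normrM (le_trans _ (hD (e * n%:R))) // /F exprS mulrC mulrA.
apply/norm_cvg0P; apply: (@squeeze_cvgr _ _ _ _ (fun=> 0) (fun n => K * harmonic n)).
- by apply: nearW => n; rewrite normr_ge0 bound.
- exact: cvg_cst.
- rewrite -[X in _ --> X](mulr0 K); apply: cvgM; first exact: cvg_cst.
  exact: cvg_harmonic.
Qed.

Definition normal_moment k : R := \int[mu]_x ((x - m) ^+ k * phi x).

(** The derivative of [(x - m) ^+ k * phi x] integrates to 0. The case [k = 0] says that [m] is the
    mean. *)
Lemma normal_moment_rec k :
  normal_moment k.+1 = k%:R * s ^+ 2 * normal_moment k.-1.
Proof.
have s20 : s ^+ 2 != 0 by rewrite sqrf_eq0.
pose f x := k%:R * ((x - m) ^+ k.-1 * phi x) - ((x - m) ^+ k.+1 * phi x) / s ^+ 2.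
have I1 : mu.-integrable setT (EFin \o (fun x : R => k%:R * ((x - m) ^+ k.-1 * phi x))).
  exact: (integrableZl measurableT k%:R (integrable_pow_normal k.-1)).
have I2 : mu.-integrable setT (EFin \o (fun x : R => ((x - m) ^+ k.+1 * phi x) / s ^+ 2)).
  exact: (integrableZr measurableT _ (integrable_pow_normal k.+1)).
have If : mu.-integrable setT (EFin \o f) by have := integrableB measurableT I1 I2.
have cpow j : continuous (fun x : R => (x - m) ^+ j * phi x).
  move=> x; have := @is_derive_pow_normal j x => -[dr _].
  by apply: differentiable_continuous; apply/derivable1_diffP.
have cf : continuous f.
  move=> x; apply: cvgB; last by apply: cvgM; [exact: cpow | exact: cvg_cst].
  by apply: cvgM; [exact: cvg_cst | exact: cpow].
have := @integral_derivative_eq0 _ _ f (is_derive_pow_normal k) cf If.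
have c1 : (n%:R - m) ^+ k * phi n%:R @[n --> \oo] --> (0 : R).
  have := @pow_normal_cvg0 k 1; rewrite normr1 => /(_ erefl).
  by under eq_fun do rewrite mul1r.
have c2 : (- n%:R - m) ^+ k * phi (- n%:R) @[n --> \oo] --> (0 : R).
  have := @pow_normal_cvg0 k (- 1); rewrite normrN1 => /(_ erefl).
  by under eq_fun do rewrite mulN1r.
move=> /(_ c1 c2) e.
have : \int[mu]_x f x = 0 by rewrite /Rintegral e.
rewrite /f RintegralB // RintegralZl //; last exact: integrable_pow_normal.
rewrite RintegralZr //; last exact: integrable_pow_normal.
rewrite -!/(normal_moment _) => /eqP; rewrite subr_eq0 => /eqP h.
by rewrite mulrAC h; field.
Qed.

Lemma normal_moment0 : normal_moment 0 = 1.
Proof.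
rewrite /normal_moment; under eq_Rintegral do rewrite mul1r.
by rewrite /Rintegral integral_normal_pdf.
Qed.

End normal_moments.

Section gaussian_moments.
Context d (T : measurableType d) (R : realType) (P : probability T R).
Local Notation leb := (@lebesgue_measure R).

Section nondegenerate.
Variables (Y : T -> R) (m s : R).
Hypotheses (mY : measurable_fun setT Y) (s0 : s != 0).
Hypothesis lawY : forall B : set R, measurable B -> P (Y @^-1` B) = normal_prob m s B.

Lemma ge0_integral_gaussian (g : R -> R) :
  measurable_fun setT g -> (forall x, 0 <= g x) ->
  (\int[P]_x (g (Y x))%:E = \int[leb]_x (g x * normal_pdf m s x)%:E)%E.
Proof.
move=> mg g0.
pose Z : {mfun T >-> R} := HB.pack Y (isMeasurableFun.Build _ _ _ _ Y mY).
rewrite -[LHS](@ge0_integral_distribution _ _ _ _ _ P Z (EFin \o g)); first last.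
- by move=> y; rewrite lee_fin.
- exact/measurable_EFinP.
apply: (@ge0_integral_density _ _ _ _ R leb (distribution P Z) id (normal_pdf m s)).
- exact: measurable_id.
- exact: measurable_normal_pdf.
- exact: normal_pdf_ge0.
- move=> E mE; transitivity (P (Y @^-1` E)) => //.
  rewrite lawY // /= /normal_prob [LHS]integral_mkcond; apply: eq_integral => x _.
  by rewrite patchE indicE; case: (_ \in _); rewrite ?mul1r ?mul0r.
- exact/measurable_EFinP.
- by move=> y; rewrite lee_fin.
Qed.

Let measurable_pow k : measurable_fun setT (fun x : R => (x - m) ^+ k).
Proof. by apply: measurable_funX; exact: measurable_funB. Qed.

Lemma moments_gaussianB : moments P (fun x => Y x - m).
Proof.
split=> [|k]; first exact: measurable_funB.
apply/integrableP; split.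
  by apply/measurable_EFinP/measurable_funX; exact: measurable_funB.
have /integrableP [_] := integrable_pow_normal m s0 k.
rewrite (@ge0_integral_gaussian (fun x => `|(x - m) ^+ k|)) //; last first.
  by apply: measurableT_comp => //; exact: measurable_pow.
congr (_ < _)%E; apply: eq_integral => x _.
by rewrite /= normrM [X in _ * X]ger0_norm ?normal_pdf_ge0.
Qed.

(** The change of law is available for nonnegative functions. A power of any parity is reached
    through [1 + t ^ (2 k) + t ^ k], which is nonnegative, by subtracting the even terms. *)
Lemma Ex_gaussianB k : Ex P (fun x => (Y x - m) ^+ k) = normal_moment m s k.
Proof.
have mW := moments_gaussianB.
have I j := integrable_pow_normal m s0 j.
pose g x : R := 1 + (x - m) ^+ k.*2 + (x - m) ^+ k.
have g0 x : 0 <= g x.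
  rewrite /g -muln2 exprM; move: ((x - m) ^+ k) => a.
  by have := sqr_ge0 (a + 1); have := sqr_ge0 a; lra.
have mg : measurable_fun setT g.
  by apply: measurable_funD; [apply: measurable_funD|]; rewrite // ?measurable_pow.
have e1 : Ex P (fun x => g (Y x)) =
    1 + Ex P (fun x => (Y x - m) ^+ k.*2) + Ex P (fun x => (Y x - m) ^+ k).
  by rewrite !ExD ?Ex_cst //; repeat first [exact: momentsX | exact: moments_cst | apply: momentsD].
have even j : Ex P (fun x => (Y x - m) ^+ j.*2) = normal_moment m s j.*2.
  rewrite /Ex /Rintegral (@ge0_integral_gaussian (fun x => (x - m) ^+ j.*2)) //.
  by move=> x; rewrite -muln2 exprM sqr_ge0.
have e2 : Ex P (fun x => g (Y x)) =
    normal_moment m s 0 + normal_moment m s k.*2 + normal_moment m s k.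
  rewrite /Ex /Rintegral ge0_integral_gaussian //.
  have I2 := integrableD measurableT (I 0) (I k.*2).
  rewrite /normal_moment -RintegralD //; try exact: I.
  rewrite -RintegralD //; last exact: I.
  by congr fine; apply: eq_integral => x _; congr EFin; rewrite /g !mulrDl.
move: e2; rewrite e1 even normal_moment0 //; lra.
Qed.

End nondegenerate.

(** For a Dirac mass, centering puts the atom at 0 and both sides vanish; otherwise this is the
    normal recurrence. The variance is written as an expectation so that no parameter of the law
    remains and the identity can be polarized. *)
Lemma gaussian_law_moments (Y : T -> R) : measurable_fun setT Y ->
  gaussian_law P Y -> Ex P Y = 0 ->
  moments P Y /\
  forall k, Ex P (fun x => Y x ^+ k.+2) =
    k.+1%:R * Ex P (fun x => Y x ^+ 2) * Ex P (fun x => Y x ^+ k).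
Proof.
move=> mY [m [s [s0 law]]] EY0.
have [se|sn] := eqVneq s 0.
  have {law} : P (Y @^-1` [set m]) = 1%E.
    by rewrite law // se eqxx diracE mem_set.
  have mA : measurable (Y @^-1` [set m]).
    by rewrite -[X in measurable X]setTI; exact: mY.
  move=> PA.
  have Ym : {ae P, forall x, setT x -> Y x = m}.
    exists (~` (Y @^-1` [set m])); split; first exact: measurableC.
      by rewrite probability_setC // PA subee.
    by move=> x /= nYx h; apply: nYx => _; exact: h.
  have EYk k : (\int[P]_x (Y x ^+ k)%:E = (m ^+ k)%:E)%E.
    rewrite (ae_eq_integral (fun=> (m ^+ k)%:E)) //.
    - by have := ExE (moments_cst P (m ^+ k)); rewrite Ex_cst.
    - by apply/measurable_EFinP; exact: measurable_funX.
    - by apply: filterS Ym => x h Tx; rewrite h.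
  have mY' : moments P Y.
    split=> // k; apply/integrableP; split.
      by apply/measurable_EFinP; exact: measurable_funX.
    rewrite (ae_eq_integral (fun=> `|m ^+ k|%:E)) //.
    - by have := ExE (moments_cst P `|m ^+ k|); rewrite Ex_cst => ->; rewrite ltry.
    - by apply/measurable_EFinP; apply: measurableT_comp => //; exact: measurable_funX.
    - by apply: filterS Ym => x h Tx; rewrite h.
  have m0 : m = 0.
    by have := EYk 1%N; rewrite ExE // => -[]; under eq_Ex do rewrite expr1; rewrite EY0.
  split => // k.
  have e j : Ex P (fun x => Y x ^+ j) = m ^+ j.
    by have := EYk j; rewrite ExE; [case | exact: momentsX].
  by rewrite !e m0 !expr0n /= mulr0 mul0r.
have {}law B : measurable B -> P (Y @^-1` B) = normal_prob m s B.
  by move=> mB; rewrite law // (negbTE sn).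
have mW := moments_gaussianB mY sn law.
have YW : Y = (fun x => (Y x - m) + m) by apply/funext => x; rewrite subrK.
have mY' : moments P Y by rewrite YW; apply: momentsD => //; exact: moments_cst.
have m0 : m = 0.
  move: EY0; rewrite {1}YW ExD ?Ex_cst //; last exact: moments_cst.
  have := Ex_gaussianB mY sn law 1; under eq_Ex do rewrite expr1.
  by rewrite normal_moment_rec // mul0r mul0r => ->; rewrite add0r.
have e k : Ex P (fun x => Y x ^+ k) = normal_moment m s k.
  by rewrite -(Ex_gaussianB mY sn law); apply: eq_Ex => x; rewrite m0 subr0.
split=> // k; rewrite !e [in LHS]normal_moment_rec // [X in _ = _ * X * _]normal_moment_rec //=.
by rewrite normal_moment0 // mul1r mulr1.
Qed.

End gaussian_moments.

(** * Wick's formula by polarization *)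

Section wick.
Context d (T : measurableType d) (R : realType) (P : probability T R).
Local Notation Ex := (Ex P).
Local Notation moments := (moments P).

Lemma poly_fun_eq0 (p : {poly R}) : (forall t, p.[t] = 0) -> p = 0.
Proof.
move=> p0; apply/eqP; apply: contraT => pn0.
have := max_poly_roots pn0 (rs := [seq i%:R | i <- iota 0 (size p)]).
rewrite size_map size_iota ltnn => ->//.
  by apply/allP => t _; apply/eqP; exact: p0.
by rewrite map_inj_uniq ?iota_uniq // => i j /eqP; rewrite eqr_nat => /eqP.
Qed.

Definition moments_linear (Lam : (T -> R) -> R) :=
  (forall F G, moments F -> moments G -> Lam (fun x => F x + G x) = Lam F + Lam G) /\
  (forall c F, moments F -> Lam (fun x => c * F x) = c * Lam F).

Lemma moments_linear_sum Lam (I : finType) (F : I -> T -> R) :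
  moments_linear Lam -> (forall i, moments (F i)) ->
  Lam (fun x => \sum_i F i x) = \sum_i Lam (F i).
Proof.
move=> [lD lZ] mF; elim: (index_enum I) => [|i s IH].
  rewrite big_nil -[RHS](mul0r (Lam (fun=> 0))) -lZ; last exact: moments_cst.
  by congr Lam; apply/funext => x; rewrite big_nil mul0r.
rewrite big_cons -IH -lD //; last exact: moments_sum.
by congr Lam; apply/funext => x; rewrite big_cons.
Qed.

Section perturbation.
Variables (f h : T -> R) (Lam : (T -> R) -> R).
Hypotheses (mf : moments f) (mh : moments h) (lin : moments_linear Lam).

(** The polynomial [t |-> Lam ((f + t h) ^ m)]: an identity valid along a line of Gaussian functions
    becomes an identity of polynomials, whose coefficients can be compared. *)
Definition power_poly m : {poly R} :=
  \poly_(i < m.+1) ('C(m, i)%:R * Lam (fun x => f x ^+ (m - i) * h x ^+ i)).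

Lemma horner_power_poly m t :
  (power_poly m).[t] = Lam (fun x => (f x + t * h x) ^+ m).
Proof.
have mfh i : moments (fun x => f x ^+ (m - i) * h x ^+ i).
  by apply: momentsM; exact: momentsX.
rewrite horner_poly.
rewrite (eq_bigr (fun i : 'I_m.+1 =>
   Lam (fun x => 'C(m, i)%:R * t ^+ i * (f x ^+ (m - i) * h x ^+ i)))); last first.
  by move=> i _; rewrite lin.2 //; ring.
rewrite -moments_linear_sum // => [|i]; last exact: momentsZ.
congr Lam; apply/funext => x; rewrite exprDn; apply: eq_bigr => i _.
by rewrite exprMn -mulr_natl; ring.
Qed.

Lemma coef0_power_poly m : (power_poly m)`_0 = Lam (fun x => f x ^+ m).
Proof.
rewrite coef_poly /= bin0 mul1r; congr Lam; apply/funext => x.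
by rewrite subn0 mulr1.
Qed.

Lemma coef1_power_poly m :
  (power_poly m)`_1 = m%:R * Lam (fun x => f x ^+ m.-1 * h x).
Proof.
rewrite coef_poly ltnS lt0n; case: eqVneq => [->|m0]; first by rewrite mul0r.
by rewrite bin1; congr (_ * Lam _); apply/funext => x; rewrite subn1.
Qed.

End perturbation.

Lemma coef1M (p r : {poly R}) : (p * r)`_1 = p`_0 * r`_1 + p`_1 * r`_0.
Proof. by rewrite coefM !big_ord_recl big_ord0 addr0. Qed.

Variable V : (T -> R) -> Prop.
Hypothesis V_line : forall f g t, V f -> V g -> V (fun x => f x + t * g x).
Hypothesis V_moments : forall f, V f -> moments f.
Hypothesis V_mean : forall f, V f -> Ex f = 0.
Hypothesis V_rec : forall f k, V f ->
  Ex (fun x => f x ^+ k.+2) = k.+1%:R * Ex (fun x => f x ^+ 2) * Ex (fun x => f x ^+ k).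

Lemma Ex_linear : moments_linear Ex.
Proof. by split=> *; [exact: ExD | exact: ExZ]. Qed.

Lemma Ex_linearM g : moments g -> moments_linear (fun F => Ex (fun x => F x * g x)).
Proof.
move=> mg; split=> [F G mF mG|c F mF].
  rewrite -ExD; last by apply: momentsM.
    by apply: eq_Ex => x; rewrite mulrDl.
  by apply: momentsM.
rewrite -ExZ; last by apply: momentsM.
by apply: eq_Ex => x; rewrite mulrA.
Qed.

(** Gaussian integration by parts for powers: the coefficient of [t] in the moment recurrence of
    [f + t g]. *)
Lemma stein_power f g k : V f -> V g ->
  Ex (fun x => f x ^+ k * g x) =
  k%:R * Ex (fun x => f x * g x) * Ex (fun x => f x ^+ k.-1).
Proof.
move=> Vf Vg; have mf := V_moments Vf; have mg := V_moments Vg.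
elim/ltn_ind: k => -[|k] IH.
  by rewrite mul0r mul0r -(V_mean Vg); apply: eq_Ex => x; rewrite mul1r.
pose p := power_poly f g Ex.
have e : p k.+2 = k.+1%:R *: (p 2 * p k).
  apply/eqP; rewrite -subr_eq0; apply/eqP/poly_fun_eq0 => t.
  rewrite hornerD hornerN hornerZ hornerM !horner_power_poly //; try exact: Ex_linear.
  by rewrite V_rec ?mulrA ?subrr //; exact: V_line.
have := congr1 (fun r : {poly R} => r`_1) e.
rewrite /= coefZ coef1M /p !coef1_power_poly !coef0_power_poly /=.
have -> : Ex (fun x => f x ^+ 1 * g x) = Ex (fun x => f x * g x).
  by apply: eq_Ex => x; rewrite expr1.
move=> h; have k2 : k.+2%:R != 0 :> R by rewrite pnatr_eq0.
apply: (mulfI k2); rewrite h {h}.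
case: k IH k2 {e} => [|k] IH k2.
  by rewrite (_ : Ex (fun x => f x ^+ 0) = 1) ?[0%:R * _]mul0r /=; [ring|rewrite Ex_cst].
have step : k%:R * Ex (fun x => f x ^+ 2) * Ex (fun x => f x ^+ k.-1) =
    Ex (fun x => f x ^+ k.+1).
  case: (k) => [|j]; last by rewrite [RHS]V_rec.
  by rewrite !mul0r -(V_mean Vf); apply: eq_Ex => x; rewrite expr1.
rewrite (IH k) //= -step -!natr1; ring.
Qed.

Lemma moments_prod_in (s : seq (T -> R)) : (forall u, List.In u s -> V u) ->
  moments (fun x => \prod_(u <- s) u x).
Proof.
elim: s => [|v s IH] Vs.
  by under eq_fun do rewrite big_nil; exact: moments_cst.
under eq_fun do rewrite big_cons.
apply: momentsM; first by apply: V_moments; apply: Vs; left.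
by apply: IH => u us; apply: Vs; right.
Qed.

(** The Wick terms that pair [g] with an element of the list; [F] collects the factors already
    passed. *)
Fixpoint contractions (g : T -> R) (F : T -> R) (s : seq (T -> R)) : R :=
  if s is h :: s' then
    Ex (fun x => h x * g x) * Ex (fun x => F x * \prod_(u <- s') u x) +
    contractions g (fun x => F x * h x) s'
  else 0.

Lemma contractions_linear g s : (forall u, List.In u s -> V u) ->
  moments_linear (fun F => contractions g F s).
Proof.
elim: s => [|h s IH] Vs /=.
  by split=> *; rewrite ?addr0 ?mulr0.
have mh : moments h by apply: V_moments; apply: Vs; left.
have mp : moments (fun x => \prod_(u <- s) u x).
  by apply: moments_prod_in => u us; apply: Vs; right.
have [lD lZ] : moments_linear (fun F => contractions g F s).
  by apply: IH => u us; apply: Vs; right.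
have [eD eZ] := Ex_linearM mp.
split=> [F G mF mG|c F mF].
  rewrite eD // -addrACA -mulrDr -lD; try exact: momentsM.
  by congr (_ + contractions _ _ _); apply/funext => x; rewrite mulrDl.
rewrite eZ // mulrDr -lZ; last exact: momentsM.
by rewrite mulrCA; congr (_ + contractions _ _ _); apply/funext => x; rewrite mulrA.
Qed.

(* Polarization: the coefficient of t in the identity for [f + t h] moves one
   factor [h] from the power to the product. *)
Lemma stein f g s k : V f -> V g -> (forall u, List.In u s -> V u) ->
  Ex (fun x => f x ^+ k * (g x * \prod_(u <- s) u x)) =
  k%:R * Ex (fun x => f x * g x) * Ex (fun x => f x ^+ k.-1 * \prod_(u <- s) u x) +
  contractions g (fun x => f x ^+ k) s.
Proof.
move=> Vf Vg; elim: s k f Vf => [|h s IH] k f Vf Vs.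
  have e j : Ex (fun x => f x ^+ j * \prod_(u <- [::]) u x) = Ex (fun x => f x ^+ j).
    by apply: eq_Ex => x; rewrite big_nil mulr1.
  rewrite addr0 e -stein_power //; apply: eq_Ex => x.
  by rewrite big_nil mulr1.
have Vh : V h by apply: Vs; left.
have {}Vs u : List.In u s -> V u by move=> us; apply: Vs; right.
have mf := V_moments Vf; have mg := V_moments Vg; have mh := V_moments Vh.
have mp := moments_prod_in Vs.
pose Pi x := \prod_(u <- s) u x.
pose A := power_poly f h (fun F => Ex (fun x => F x * (g x * Pi x))) k.+1.
pose B := power_poly f h (fun F => Ex (fun x => F x * g x)) 1.
pose C := power_poly f h (fun F => Ex (fun x => F x * Pi x)) k.
pose D := power_poly f h (fun F => contractions g F s) k.+1.
have lA := Ex_linearM (momentsM mg mp); have lB := Ex_linearM mg.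
have lC := Ex_linearM mp; have lD := @contractions_linear g s Vs.
have e : A = k.+1%:R *: (B * C) + D.
  apply/eqP; rewrite -subr_eq0; apply/eqP/poly_fun_eq0 => t.
  rewrite hornerD hornerN hornerD hornerZ hornerM !horner_power_poly //.
  rewrite (IH k.+1 (fun x => f x + t * h x)) //; last exact: V_line.
  rewrite -mulrA; under [X in _ - (_ * (X * _) + _)]eq_Ex do rewrite expr1.
  by rewrite subrr.
have := congr1 (fun r : {poly R} => r`_1) e.
rewrite /= coefD coefZ coef1M /A /B /C /D !coef1_power_poly !coef0_power_poly /=.
under [X in X * (k%:R * _) + _]eq_Ex do rewrite expr1.
under [X in _ + (1 * X) * _]eq_Ex do rewrite expr0 mul1r.
move=> {}e.
have k1 : k.+1%:R != 0 :> R by rewrite pnatr_eq0.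
apply: (mulfI k1).
have -> : Ex (fun x => f x ^+ k * (g x * \prod_(u <- h :: s) u x)) =
    Ex (fun x => f x ^+ k * h x * (g x * Pi x)).
  by apply: eq_Ex => x; rewrite big_cons /Pi; ring.
have -> : Ex (fun x => f x ^+ k.-1 * \prod_(u <- h :: s) u x) =
    Ex (fun x => f x ^+ k.-1 * h x * Pi x).
  by apply: eq_Ex => x; rewrite big_cons /Pi; ring.
rewrite e -/Pi; ring.
Qed.

Section orthonormal.
Context {I : eqType} (Z : I -> T -> R).
Hypothesis VZ : forall a, V (Z a).
Hypothesis Z_orth : forall a b, Ex (fun x => Z a x * Z b x) = (a == b)%:R.

(** One copy of [Z a] is paired with its twin, which contributes 1, or with one of the two copies of
    [Z a] given by each occurrence of [a] in [s]; orthonormality kills the other pairings. No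
    independence of the [Z a] has to be established. *)
Lemma Ex_prod_sqr_rec a s :
  Ex (fun x => Z a x ^+ 2 * \prod_(b <- s) Z b x ^+ 2) =
  (1 + 2 * (count_mem a s)%:R) * Ex (fun x => \prod_(b <- s) Z b x ^+ 2).
Proof.
pose dbl := flatten [seq [:: Z b; Z b] | b <- s].
have dblE x : \prod_(u <- dbl) u x = \prod_(b <- s) Z b x ^+ 2.
  rewrite /dbl; elim: (s) => [|b s' IH] /=; first by rewrite !big_nil.
  by rewrite !big_cons IH expr2 mulrA.
have Vdbl u : List.In u dbl -> V u.
  rewrite /dbl; elim: (s) => [|b s' IH] //= [<-|[<-|/IH//]]; exact: VZ.
have := stein 1 (VZ a) (VZ a) Vdbl.
rewrite Z_orth eqxx !mul1r /=.
under eq_Ex do rewrite dblE expr1 mulrA -expr2.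
under [X in _ = X + _]eq_Ex do rewrite dblE mul1r.
move=> ->; rewrite mulrDl mul1r; congr (_ + _).
(* [M] holds the squares already passed in the list, so that the induction goes through. *)
suff main M : moments M -> contractions (Z a) (fun x => Z a x * M x) dbl =
    2 * (count_mem a s)%:R * Ex (fun x => M x * \prod_(b <- s) Z b x ^+ 2).
  transitivity (contractions (Z a) (fun x => Z a x * 1) dbl).
    by congr contractions; apply/funext => x; rewrite expr1 mulr1.
  rewrite main; last exact: moments_cst.
  by congr (_ * _); apply: eq_Ex => x; rewrite mul1r.
rewrite {dblE Vdbl} /dbl; elim: (s) M => [|b s' IH] M mM /=; first by rewrite mulr0 mul0r.
have dblE x : \prod_(u <- flatten [seq [:: Z b; Z b] | b <- s']) u x =
    \prod_(b <- s') Z b x ^+ 2.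
  elim: (s') => [|c s'' IH'] /=; first by rewrite !big_nil.
  by rewrite !big_cons IH' expr2 mulrA.
have mb := V_moments (VZ b).
have -> : contractions (Z a) (fun x => Z a x * M x * Z b x * Z b x)
      (flatten [seq [:: Z b0; Z b0] | b0 <- s']) =
    contractions (Z a) (fun x => Z a x * (M x * Z b x ^+ 2))
      (flatten [seq [:: Z b0; Z b0] | b0 <- s']).
  by congr contractions; apply/funext => x; ring.
rewrite IH; last by apply: momentsM => //; exact: momentsX.
have -> : Ex (fun x => M x * \prod_(b0 <- b :: s') Z b0 x ^+ 2) =
    Ex (fun x => M x * Z b x ^+ 2 * \prod_(b0 <- s') Z b0 x ^+ 2).
  by apply: eq_Ex => x; rewrite big_cons mulrA.
rewrite Z_orth; have [->|ba] := eqVneq b a; last by rewrite !mul0r !add0r.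
rewrite !mul1r natrD !mulrDr !mulrDl /= mulr1 !addrA.
have -> : Ex (fun x => Z a x * M x * \prod_(u <- Z a ::
     flatten [seq [:: Z b0; Z b0] | b0 <- s']) u x) =
    Ex (fun x => M x * Z a x ^+ 2 * \prod_(b0 <- s') Z b0 x ^+ 2).
  by apply: eq_Ex => x; rewrite big_cons dblE; ring.
have -> : Ex (fun x => Z a x * M x * Z a x *
     \prod_(u <- flatten [seq [:: Z b0; Z b0] | b0 <- s']) u x) =
    Ex (fun x => M x * Z a x ^+ 2 * \prod_(b0 <- s') Z b0 x ^+ 2).
  by apply: eq_Ex => x; rewrite dblE; ring.
by rewrite !mul1r.
Qed.

End orthonormal.
End wick.

(** * Chi-square forms of the whitened field *)

Section chi_square_forms.
Context d (T : measurableType d) (R : realType) (P : probability T R).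
Local Notation Ex := (Ex P).
Local Notation moments := (moments P).
Context {I : finType} (Z : I -> T -> R).
Hypothesis mZ : forall a, moments (Z a).
Hypothesis Z_rec : forall a s,
  Ex (fun x => Z a x ^+ 2 * \prod_(b <- s) Z b x ^+ 2) =
  (1 + 2 * (count_mem a s)%:R) * Ex (fun x => \prod_(b <- s) Z b x ^+ 2).

Definition chi2 (c : I -> R) x := \sum_a c a * Z a x ^+ 2.
Definition cchi2 (c : I -> R) x := \sum_a c a * (Z a x ^+ 2 - 1).

Lemma moments_chi2 c : moments (chi2 c).
Proof. by apply: moments_sum => a; apply: momentsZ; exact: momentsX. Qed.

Lemma cchi2E c x : cchi2 c x = chi2 c x - \sum_a c a.
Proof. by rewrite -sumrB; apply: eq_bigr => a _; rewrite mulrBr mulr1. Qed.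

Definition mixed (s : seq I) (cs : seq (I -> R)) : R :=
  Ex (fun x => \prod_(b <- s) Z b x ^+ 2 * \prod_(c <- cs) chi2 c x).

Let moments_mixed s (cs : seq (I -> R)) :
  moments (fun x => \prod_(b <- s) Z b x ^+ 2 * \prod_(c <- cs) chi2 c x).
Proof.
apply: momentsM; last by apply: moments_prod => c; exact: moments_chi2.
by apply: moments_prod => b; exact: momentsX.
Qed.

Lemma mixed_cons s c cs : mixed s (c :: cs) = \sum_b c b * mixed (b :: s) cs.
Proof.
rewrite /mixed; under [RHS]eq_bigr do rewrite -ExZ //.
rewrite -Ex_sum => [|b]; last exact: momentsZ.
apply: eq_Ex => x; rewrite big_cons /chi2 mulr_suml mulr_sumr.
by apply: eq_bigr => b _; rewrite big_cons; ring.
Qed.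

(** Wick terms joining two quadratic forms: a join of diagonal forms is again diagonal, with the
    product of the coefficients. *)
Fixpoint absorb (c : I -> R) (G : seq (I -> R) -> R) cs : R :=
  if cs is c' :: cs' then
    G ((fun a => c a * c' a) :: cs') + absorb c (fun l => G (c' :: l)) cs'
  else 0.

Lemma absorb_sum c (w : I -> R) (G : I -> seq (I -> R) -> R) cs :
  absorb c (fun l => \sum_b w b * G b l) cs = \sum_b w b * absorb c (G b) cs.
Proof.
elim: cs G => [|c' cs IH] G /=; first by rewrite big1 // => b _; rewrite mulr0.
by rewrite IH -big_split; apply: eq_bigr => b _; rewrite mulrDr.
Qed.

Lemma eq_absorb c G H cs : G =1 H -> absorb c G cs = absorb c H cs.
Proof. by elim: cs G H => [|c' cs IH] G H GH //=; rewrite GH (IH _ _ (fun l => GH _)). Qed.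

(** The form [c] contributes its trace, or is joined to a square of [s], or to another form, each
    join occurring in two ways. In the induction the next form is expanded over its squares, which
    lengthens [s]; this is why [s] is carried along. *)
Lemma mixed_rec s c cs :
  mixed s (c :: cs) =
  (\sum_a c a + 2 * \sum_(b <- s) c b) * mixed s cs + 2 * absorb c (mixed s) cs.
Proof.
elim: cs s => [|c' cs IH] s.
  rewrite mixed_cons mulr0 addr0.
  have e b : mixed (b :: s) [::] = (1 + 2 * (count_mem b s)%:R) * mixed s [::].
    rewrite /mixed; under eq_Ex do rewrite big_nil mulr1 big_cons.
    by rewrite Z_rec; congr (_ * _); apply: eq_Ex => x; rewrite big_nil mulr1.
  rewrite (eq_bigr _ (fun b _ => congr1 (GRing.mul (c b)) (e b))).
  under eq_bigr do rewrite mulrA mulrDr mulr1 mulrCA.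
  rewrite -mulr_suml big_split /= -mulr_sumr; congr ((_ + _ * _) * _).
  elim: s {e} => [|b s IH]; first by rewrite big_nil big1 // => a _; rewrite mulr0.
  rewrite big_cons -IH (eq_bigr (fun a => (c a * (b == a)%:R) + c a * (count_mem a s)%:R)).
    rewrite big_split /=; congr (_ + _); rewrite (bigD1 b) //= eqxx mulr1 big1 ?addr0 // => a ab.
    by rewrite eq_sym (negbTE ab) mulr0.
  by move=> a _; rewrite /= natrD mulrDr.
have swap : mixed s [:: c, c' & cs] = mixed s [:: c', c & cs].
  by apply: eq_Ex => x; rewrite !big_cons; ring.
rewrite swap mixed_cons (eq_bigr _ (fun b _ => congr1 (GRing.mul (c' b)) (IH _))).
rewrite [absorb _ _ _]/= [in RHS](@eq_absorb _ _ (fun l => \sum_b c' b * mixed (b :: s) l)); last first.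
  by move=> l; exact: mixed_cons.
rewrite (absorb_sum c c' (fun b => mixed (b :: s))) [mixed s (c' :: _)]mixed_cons (mixed_cons _ (fun _ => _)).
rewrite mulrDr !mulr_sumr -!big_split /=; apply: eq_bigr => b _.
by rewrite big_cons -mulr_sumr; ring.
Qed.

Section two_forms.
Variables c c' : I -> R.

(** Joining only produces monomials in [c] and [c'], so pairs of exponents encode all the joint
    moments and the recursion becomes a computation. *)
Let mon (ij : nat * nat) a := c a ^+ ij.1 * c' a ^+ ij.2.
Let S i j := \sum_a mon (i, j) a.
Let W (l : seq (nat * nat)) := mixed [::] [seq mon ij | ij <- l].

Let monM ij kl : (fun a => mon ij a * mon kl a) = mon ((ij.1 + kl.1)%N, (ij.2 + kl.2)%N).
Proof. by apply/funext => a; rewrite /mon /= !exprD; ring. Qed.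

Let W0 : W [::] = 1.
Proof.
rewrite /W /mixed -[RHS](Ex_cst P); apply: eq_Ex => x.
by rewrite !big_nil mulr1.
Qed.

Let Wrec ij l : W (ij :: l) = S ij.1 ij.2 * W l + 2 * absorb (mon ij) (mixed [::]) [seq mon ij | ij <- l].
Proof. by case: ij => i j; rewrite /W /= mixed_rec big_nil mulr0 addr0. Qed.

Let W1 a : W [:: a] = S a.1 a.2.
Proof. by rewrite Wrec W0 /= mulr1 mulr0 addr0. Qed.

Let W2 a b : W [:: a; b] = S a.1 a.2 * W [:: b] + 2 * W [:: ((a.1 + b.1)%N, (a.2 + b.2)%N)].
Proof. by rewrite Wrec /= addr0 monM. Qed.

Let W3 a b e : W [:: a; b; e] = S a.1 a.2 * W [:: b; e] +
  2 * (W [:: ((a.1 + b.1)%N, (a.2 + b.2)%N); e] + W [:: b; ((a.1 + e.1)%N, (a.2 + e.2)%N)]).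
Proof. by rewrite Wrec /= addr0 !monM. Qed.

Let W4 a b e g : W [:: a; b; e; g] = S a.1 a.2 * W [:: b; e; g] +
  2 * (W [:: ((a.1 + b.1)%N, (a.2 + b.2)%N); e; g] +
      (W [:: b; ((a.1 + e.1)%N, (a.2 + e.2)%N); g] +
       W [:: b; e; ((a.1 + g.1)%N, (a.2 + g.2)%N)])).
Proof. by rewrite Wrec /= addr0 !monM. Qed.

Let ExW (F : T -> R) l : (forall x, F x = \prod_(ij <- l) chi2 (mon ij) x) -> Ex F = W l.
Proof.
by move=> FE; apply: eq_Ex => x; rewrite big_nil mul1r big_map.
Qed.

Let cE : mon (1, 0)%N = c.
Proof. by apply/funext => a; rewrite /mon /= mulr1. Qed.

Let cE' : mon (0, 1)%N = c'.
Proof. by apply/funext => a; rewrite /mon /= mul1r. Qed.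

Lemma Ex_cchi2M : Ex (fun x => cchi2 c x * cchi2 c' x) = 2 * \sum_a c a * c' a.
Proof.
pose t := \sum_a c a; pose t' := \sum_a c' a.
have m := moments_chi2.
transitivity (Ex (fun x => chi2 c x * chi2 c' x + (- t') * chi2 c x + (- t) * chi2 c' x + t * t')).
  by apply: eq_Ex => x; rewrite !cchi2E -/t -/t'; ring.
rewrite !ExD ?ExZ ?Ex_cst //; do ?[exact: moments_cst | exact: momentsZ | exact: momentsM | apply: momentsD].
rewrite (@ExW _ [:: (1, 0)%N; (0, 1)%N]) => [|x]; last by rewrite !big_cons big_nil mulr1 cE cE'.
rewrite (@ExW (chi2 c) [:: (1, 0)%N]) => [|x]; last by rewrite big_seq1 cE.
rewrite (@ExW (chi2 c') [:: (0, 1)%N]) => [|x]; last by rewrite big_seq1 cE'.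
rewrite W2 !W1 /= (_ : S 1 0 = t); last by rewrite /S cE.
rewrite (_ : S 0 1 = t'); last by rewrite /S cE'.
by rewrite (_ : S _ _ = \sum_a c a * c' a); [ring | apply: eq_bigr => a _].
Qed.

(** Product of the variances, twice the squared covariance, and the joint fourth cumulant, with its
    constant [2 ^ 3 * 3! = 48]. *)
Lemma Ex_cchi2_sqrM : Ex (fun x => cchi2 c x ^+ 2 * cchi2 c' x ^+ 2) =
  4 * (\sum_a c a ^+ 2) * (\sum_a c' a ^+ 2) + 8 * (\sum_a c a * c' a) ^+ 2 +
  48 * \sum_a c a ^+ 2 * c' a ^+ 2.
Proof.
pose t := \sum_a c a; pose t' := \sum_a c' a.
have m := moments_chi2.
transitivity (Ex (fun x =>
   chi2 c x * chi2 c x * (chi2 c' x * chi2 c' x)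
   + (- 2 * t') * (chi2 c x * chi2 c x * chi2 c' x)
   + t' ^+ 2 * (chi2 c x * chi2 c x)
   + (- 2 * t) * (chi2 c x * (chi2 c' x * chi2 c' x))
   + (4 * t * t') * (chi2 c x * chi2 c' x)
   + (- 2 * t * t' ^+ 2) * chi2 c x
   + t ^+ 2 * (chi2 c' x * chi2 c' x)
   + (- 2 * t ^+ 2 * t') * chi2 c' x + t ^+ 2 * t' ^+ 2)).
  by apply: eq_Ex => x; rewrite !cchi2E -/t -/t'; ring.
rewrite !ExD ?ExZ ?Ex_cst //; do ?[exact: moments_cst | exact: m | apply: momentsZ | apply: momentsM | apply: momentsD].
rewrite (@ExW _ [:: (1, 0)%N; (1, 0)%N; (0, 1)%N; (0, 1)%N]) => [|x]; last first.
  by rewrite !big_cons big_nil mulr1 cE cE'; ring.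
rewrite (@ExW _ [:: (1, 0)%N; (1, 0)%N; (0, 1)%N]) => [|x]; last first.
  by rewrite !big_cons big_nil mulr1 cE cE'; ring.
rewrite (@ExW _ [:: (1, 0)%N; (1, 0)%N]) => [|x]; last first.
  by rewrite !big_cons big_nil mulr1 cE.
rewrite (@ExW _ [:: (1, 0)%N; (0, 1)%N; (0, 1)%N]) => [|x]; last first.
  by rewrite !big_cons big_nil mulr1 cE cE'.
rewrite (@ExW _ [:: (1, 0)%N; (0, 1)%N]) => [|x]; last first.
  by rewrite !big_cons big_nil mulr1 cE cE'.
rewrite (@ExW (chi2 c) [:: (1, 0)%N]) => [|x]; last by rewrite big_seq1 cE.
rewrite (@ExW _ [:: (0, 1)%N; (0, 1)%N]) => [|x]; last first.
  by rewrite !big_cons big_nil mulr1 cE'.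
rewrite (@ExW (chi2 c') [:: (0, 1)%N]) => [|x]; last by rewrite big_seq1 cE'.
do ?[rewrite W4 /= | rewrite W3 /= | rewrite W2 /= | rewrite W1 /=].
rewrite !addn0 !add0n ?addSn ?addn0 ?add0n.
rewrite (_ : S 1 0 = t); last by rewrite /S cE.
rewrite (_ : S 0 1 = t'); last by rewrite /S cE'.
rewrite (_ : S 2 0 = \sum_a c a ^+ 2); last by apply: eq_bigr => a _; rewrite /mon /= mulr1.
rewrite (_ : S 0 2 = \sum_a c' a ^+ 2); last by apply: eq_bigr => a _; rewrite /mon /= mul1r.
rewrite (_ : S 1 1 = \sum_a c a * c' a); last by apply: eq_bigr => a _.
rewrite (_ : S 2 2 = \sum_a c a ^+ 2 * c' a ^+ 2); last by apply: eq_bigr => a _.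
ring.
Qed.

End two_forms.
End chi_square_forms.

(** * Whitened Hartley coefficients of the observations *)

Section whitened_field.
Context d (T : measurableType d) (R : realType) (P : probability T R).
Local Notation Ex := (Ex P).
Local Notation moments := (moments P).

Section one_field.
Context {q : nat} (X : lattice q -> {RV P >-> R}).
Hypotheses (gX : gaussian_field X) (cX : centered_field X).

Definition field_span (f : T -> R) : Prop :=
  exists a : lattice q -> R, f = fun w => \sum_u a u * X u w.

Lemma measurable_field u : measurable_fun setT (X u).
Proof. exact: measurable_funP. Qed.

Lemma field_span_field u : field_span (X u).
Proof.
exists (fun v => (v == u)%:R); apply/funext => w.
rewrite (bigD1 u) //= eqxx mul1r big1 ?addr0 // => v vu.
by rewrite (negbTE vu) mul0r.
Qed.

Lemma Ex_field u : Ex (X u) = 0.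
Proof. by rewrite /Ex /Rintegral -expectation_def cX. Qed.

Lemma moments_field u : moments (X u).
Proof.
have [a Xa] := field_span_field u.
have : gaussian_law P (X u) by rewrite Xa; exact: gX.
by move=> /(gaussian_law_moments (measurable_field u)) /(_ (Ex_field u)) [].
Qed.

Lemma field_span_gaussian f : field_span f -> [/\ moments f, Ex f = 0 &
  forall k, Ex (fun x => f x ^+ k.+2) =
    k.+1%:R * Ex (fun x => f x ^+ 2) * Ex (fun x => f x ^+ k)].
Proof.
move=> [a fa].
have mf : moments f.
  by rewrite fa; apply: moments_sum => u; apply: momentsZ; exact: moments_field.
have f0 : Ex f = 0.
  rewrite fa Ex_sum => [|u]; last by apply: momentsZ; exact: moments_field.
  rewrite big1 // => u _; rewrite ExZ ?Ex_field ?mulr0 //; exact: moments_field.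
have gf : gaussian_law P f by rewrite fa; exact: gX.
by have [_ h] := gaussian_law_moments (moments_measurable mf) gf f0.
Qed.

Lemma field_span_line f g t : field_span f -> field_span g ->
  field_span (fun x => f x + t * g x).
Proof.
move=> [a ->] [b ->]; exists (fun u => a u + t * b u); apply/funext => w.
by rewrite mulr_sumr -big_split; apply: eq_bigr => u _; rewrite mulrDl mulrA.
Qed.

Lemma Ex_field_spanM (a b : lattice q -> R) (Sigma : 'M[R]_(q.+1 * q.+1)) :
  has_covmx X Sigma ->
  Ex (fun w => (\sum_u a u * X u w) * (\sum_u b u * X u w)) =
  \sum_i \sum_j a (node i) * Sigma i j * b (node j).
Proof.
move=> cov; have mX := moments_field.
have e i j : Ex (fun w => X (node i) w * X (node j) w) = Sigma i j.
  apply: EFin_inj; rewrite -cov -ExE; last exact: momentsM.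
  rewrite covariance.unlock !cX expectation.unlock; apply: eq_integral => w _.
  by congr EFin; rewrite -[RHS]/((X (node i) w - 0) * (X (node j) w - 0)) !subr0.
rewrite (eq_Ex P (g := fun w => \sum_i \sum_j
    a (node i) * b (node j) * (X (node i) w * X (node j) w))); last first.
  move=> w; rewrite -!(sum_node (fun u => _ * X u w)) big_distrlr /=.
  by apply: eq_bigr => i _; apply: eq_bigr => j _; ring.
have m i j : moments (fun w => a (node i) * b (node j) * (X (node i) w * X (node j) w)).
  by apply: momentsZ; exact: momentsM.
rewrite Ex_sum => [|i]; last exact: moments_sum.
apply: eq_bigr => i _; rewrite Ex_sum //; apply: eq_bigr => j _.
rewrite ExZ ?e; [by ring | exact: momentsM].
Qed.

End one_field.

Context {n q : nat} (X : 'I_n -> lattice q -> {RV P >-> R}).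
Variables (theta : 'M[R]_q.+1) (sigma2 : R).
Hypothesis even : forall u, entry theta u = entry theta (- u).
Hypothesis pos : forall k, 0 < 1 - spec theta k.
Hypothesis sigma2_gt0 : 0 < sigma2.
Hypothesis gX : forall i, gaussian_field (X i).
Hypothesis cX : forall i, centered_field (X i).
Hypothesis covX : forall i, has_covmx (X i) (sigma2 *: invmx (1%:M - Cmx theta)).
Hypothesis indep : independent_fields X.

(** The factor normalizes the variance of the Hartley coefficient, which is
    [sigma2 / (1 - spec theta k)]. *)
Definition whitened (a : 'I_n * lattice q) w : R :=
  Num.sqrt ((1 - spec theta a.2) / sigma2) * hartley (fun u => X a.1 u w) a.2.

Lemma whitenedE a : whitened a = fun w =>
  \sum_u (Num.sqrt ((1 - spec theta a.2) / sigma2) / q.+1%:R * cas a.2 u) * X a.1 u w.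
Proof.
apply/funext => w; rewrite /whitened /hartley mulrA mulrAC -mulrA mulr_sumr.
by rewrite mulr_sumr; apply: eq_bigr => u _; ring.
Qed.

Lemma whitened_span a : field_span (X a.1) (whitened a).
Proof. by rewrite whitenedE; eexists. Qed.

Lemma moments_whitened a : moments (whitened a).
Proof. by have [] := field_span_gaussian (gX a.1) (cX a.1) (whitened_span a). Qed.

Lemma hartley_whitened i k w :
  hartley (fun u => X i u w) k ^+ 2 = sigma2 / (1 - spec theta k) * whitened (i, k) w ^+ 2.
Proof.
have l0 := lt0r_neq0 (pos k); have s0 := lt0r_neq0 sigma2_gt0.
rewrite /whitened [in RHS]exprMn sqr_sqrtr ?divr_ge0 // ?ltW //=.
by field; rewrite l0 s0.
Qed.

Lemma whitened_orthonormal i k l :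
  Ex (fun w => whitened (i, k) w * whitened (i, l) w) = (k == l)%:R.
Proof.
rewrite !whitenedE (Ex_field_spanM (gX i) (cX i) _ _ (covX i)) /=.
set s1 := Num.sqrt _; set s2 := Num.sqrt _.
transitivity (s1 * s2 * sigma2 / (q.+1 ^ 2)%:R *
   \sum_i0 \sum_j cas k (node i0) * invmx (1%:M - Cmx theta) i0 j * cas l (node j)).
  rewrite mulr_sumr; apply: eq_bigr => a _; rewrite mulr_sumr; apply: eq_bigr => b _.
  by rewrite mxE natrX; field.
have l0 := lt0r_neq0 (pos k); have s0 := lt0r_neq0 sigma2_gt0.
have := invmx_cas even k l pos.
set S := \sum_a _ => h.
have -> : S = (k == l)%:R * (q.+1 ^ 2)%:R / (1 - spec theta k) by rewrite -h; field.
rewrite /s1 /s2; have [->|_] := eqVneq k l; last by rewrite !mul0r mulr0.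
rewrite -expr2 sqr_sqrtr ?divr_ge0 // ?ltW // natrX mul1r [RHS](_ : _ = 1) //; field.
by rewrite s0 (lt0r_neq0 (pos l)) addrC natr1 pnatr_eq0.
Qed.

Lemma Ex_prod_fields (f : 'I_n -> T -> R) :
  (forall i x, 0 <= f i x) -> (forall i, moments (f i)) ->
  (forall i, measurable_fun setT (f i :
     g_sigma_algebraType [set E | exists u (B : set R), measurable B /\ E = X i u @^-1` B]
       -> R)) ->
  Ex (fun x => \prod_(i < n) f i x) = \prod_(i < n) Ex (f i).
Proof.
move=> f0 mf sf; apply: EFin_inj; rewrite -ExE; last exact: moments_prod.
apply: integral_prod_independent (sf) _ => //.
- move=> i A [u [C [mC ->]]].
  by rewrite -[X in measurable X]setTI; exact: (@measurable_field _ (X i)).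
- move=> E sE; rewrite (_ : \bigcap_i E i = \bigcap_(i in [set` [set: 'I_n]%SET]) E i).
    by rewrite indep //; apply: eq_bigl => i; rewrite finset.in_setT.
  by apply: eq_bigcapl; split=> i //= _; rewrite finset.in_setT.
- by move=> i; rewrite ExE.
Qed.

(** Independence factors the expectation over the observations, squares being nonnegative. Only the
    factor of the observation of [a] changes, and Wick's formula applies within one observation. *)
Lemma whitened_rec a s :
  Ex (fun x => whitened a x ^+ 2 * \prod_(b <- s) whitened b x ^+ 2) =
  (1 + 2 * (count_mem a s)%:R) * Ex (fun x => \prod_(b <- s) whitened b x ^+ 2).
Proof.
pose F s i x := \prod_(b <- s | b.1 == i) whitened b x ^+ 2.
have split s' x : \prod_(b <- s') whitened b x ^+ 2 = \prod_(i < n) F s' i x.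
  exact: (partition_big (fun b : 'I_n * lattice q => b.1) xpredT).
have mF s' i : moments (F s' i).
  by apply: moments_prod => b; apply: momentsX; exact: moments_whitened.
have ExF s' : Ex (fun x => \prod_(b <- s') whitened b x ^+ 2) = \prod_(i < n) Ex (F s' i).
  rewrite (eq_Ex P (split s')) Ex_prod_fields // => [i x|i].
    by apply: prodr_ge0 => b _; exact: sqr_ge0.
  rewrite (_ : F s' i = fun x => \prod_(b <- [seq b <- s' | b.1 == i]) whitened b x ^+ 2); last first.
    by apply/funext => x; rewrite big_filter.
  apply: measurable_prod => b; rewrite mem_filter => /andP[/eqP <- _].
  apply: measurable_funX; rewrite whitenedE.
  apply: measurable_sum => u; apply: measurable_funM => // _ B mB.
  rewrite setTI; apply: sub_gen_smallest.
  by exists u, B.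
have -> : Ex (fun x => whitened a x ^+ 2 * \prod_(b <- s) whitened b x ^+ 2) =
    Ex (fun x => \prod_(b <- a :: s) whitened b x ^+ 2).
  by apply: eq_Ex => x; rewrite big_cons.
case: a => i k; rewrite !ExF (bigD1 i) //= [in RHS](bigD1 i) //= mulrA; congr (_ * _).
  pose t := [seq b.2 | b <- s & b.1 == i].
  have e x : F s i x = \prod_(l <- t) whitened (i, l) x ^+ 2.
    rewrite /F -big_filter /t big_map; apply: eq_big_seq => -[j l].
    by rewrite mem_filter /= => /andP[/eqP ->].
  have V := field_span_gaussian (gX i) (cX i).
  have := @Ex_prod_sqr_rec _ _ _ P (field_span (X i)) (@field_span_line _ (X i))
    (fun f Vf => let: And3 m _ _ := V f Vf in m)
    (fun f Vf => let: And3 _ m _ := V f Vf in m)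
    (fun f k Vf => let: And3 _ _ m := V f Vf in m k)
    _ (fun l => whitened (i, l)) (fun l => whitened_span (i, l))
    (whitened_orthonormal i) k t.
  rewrite (eq_Ex P (f := F s i) e) (_ : count_mem k t = count_mem (i, k) s).
    move=> <-; apply: eq_Ex => x; rewrite /F big_cons eqxx; congr (_ * _); exact: e.
  rewrite /t count_map count_filter; apply: eq_count => -[j l] /=.
  by rewrite xpair_eqE andbC.
apply: eq_bigr => j ji; apply: eq_Ex => x.
by rewrite /F big_cons eq_sym (negbTE ji).
Qed.

End whitened_field.

(** * Score tests *)

Section high_probability.
Context d (T : measurableType d) (R : realType) (P : probability T R).

(** Only the exceptional set has to be measurable: [Q] will quantify over matrices. *)
Definition whp (eps : R) (Q : T -> Prop) : Prop :=
  exists B, [/\ measurable B, (P B <= eps%:E)%E & forall w, ~ B w -> Q w].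

Lemma whp_sub eps (Q Q' : T -> Prop) : whp eps Q -> (forall w, Q w -> Q' w) -> whp eps Q'.
Proof. by move=> [B [mB PB BQ]] QQ'; exists B; split=> // w /BQ /QQ'. Qed.

Lemma whp_le eps eps' Q : eps <= eps' -> whp eps Q -> whp eps' Q.
Proof.
move=> ee [B [mB PB BQ]]; exists B; split=> //.
by apply: le_trans PB _; rewrite lee_fin.
Qed.

Lemma whp_and eps1 eps2 (Q1 Q2 : T -> Prop) :
  whp eps1 Q1 -> whp eps2 Q2 -> whp (eps1 + eps2) (fun w => Q1 w /\ Q2 w).
Proof.
move=> [B1 [mB1 PB1 BQ1]] [B2 [mB2 PB2 BQ2]]; exists (B1 `|` B2); split.
- exact: measurableU.
- by apply: le_trans (measureU2 _ mB1 mB2) _; rewrite EFinD; exact: leeD.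
- by move=> w /not_orP [n1 n2]; split; [exact: BQ1 | exact: BQ2].
Qed.

Lemma whp_markov eps (f : T -> R) a : moments P f -> (forall x, 0 <= f x) -> 0 < a ->
  Ex P f <= eps * a -> whp eps (fun w => f w < a).
Proof.
move=> mf f0 a0 le; exists [set x | a <= f x]; split.
- have -> : [set x | a <= f x] = setT `&` f @^-1` `[a, +oo[%classic.
    by apply/seteqP; split=> x /=; rewrite in_itv /= andbT => -[].
  by case: mf => mf _; apply: mf => //; exact: measurable_itv.
- apply: le_trans (markov_Ex mf f0 a0) _.
  by rewrite lee_fin ler_pdivrMr.
- by move=> w /negP; rewrite -ltNge.
Qed.

Lemma whp_measure eps (Q : set T) : measurable Q -> whp eps Q -> ((1 - eps)%:E <= P Q)%E.
Proof.
move=> mQ [B [mB PB BQ]].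
have sub : ~` B `<=` Q by move=> w /BQ.
apply: (@le_trans _ _ (P (~` B))).
  by rewrite probability_setC // EFinB; exact: leeB.
by apply: le_measure => //; rewrite inE //; exact: measurableC.
Qed.

End high_probability.

Section cauchy_schwarz_sums.
Context {R : realFieldType} {I : finType}.

Lemma cauchy_schwarz_sum (a b : I -> R) :
  (\sum_i a i * b i) ^+ 2 <= (\sum_i a i ^+ 2) * (\sum_i b i ^+ 2).
Proof.
have : 0 <= \sum_i \sum_j (a i * b j - a j * b i) ^+ 2.
  by apply: sumr_ge0 => i _; apply: sumr_ge0 => j _; exact: sqr_ge0.
rewrite (eq_bigr (fun i => \sum_j a i ^+ 2 * b j ^+ 2 +
   (\sum_j b i ^+ 2 * a j ^+ 2 - 2 * \sum_j (a i * b i) * (a j * b j)))); last first.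
  move=> i _; rewrite mulr_sumr -sumrB -big_split /=.
  by apply: eq_bigr => j _; ring.
rewrite big_split /= sumrB -mulr_sumr -!big_distrlr /= -expr2.
rewrite [X in _ + (X - _)]mulrC; lra.
Qed.

(** The operator norm is at most the Frobenius norm. *)
Lemma quadratic_form_le (F : I -> I -> R) (z : I -> R) :
  (\sum_i \sum_j z i * z j * F i j) ^+ 2 <=
  (\sum_i z i ^+ 2) ^+ 2 * \sum_i \sum_j F i j ^+ 2.
Proof.
apply: le_trans (_ : (\sum_i z i ^+ 2) * \sum_i (\sum_j z j * F i j) ^+ 2 <= _).
  have -> : \sum_i \sum_j z i * z j * F i j = \sum_i z i * (\sum_j z j * F i j).
    apply: eq_bigr => i _; rewrite mulr_sumr.
    by apply: eq_bigr => j _; rewrite mulrA.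
  exact: cauchy_schwarz_sum.
rewrite [X in _ <= X * _]expr2 -[leRHS]mulrA ler_wpM2l ?sumr_ge0 // => [i _|].
  exact: sqr_ge0.
rewrite mulrC mulr_suml ler_sum // => i _; rewrite mulrC.
exact: cauchy_schwarz_sum.
Qed.

End cauchy_schwarz_sums.

Section even_arrays.
Context {R : realType} {q : nat}.
Local Notation p := q.+1.
Local Notation p2 := ((p ^ 2)%N%:R : R).

Lemma Theta_ofD (m1 : {set lattice q}) (a b : 'M[R]_p) :
  Theta_of m1 a -> Theta_of m1 b -> Theta_of m1 (a + b).
Proof.
move=> [[a0 aN] am] [[b0 bN] bm]; split; first split.
- by rewrite entryD a0 b0 addr0.
- by move=> l; rewrite !entryD aN bN.
- move=> l; apply: contraNT => lm; rewrite entryD.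
  have := am l; have := bm l; rewrite (negbTE lm).
  have [->|_ /(_ isT)//] := eqVneq (entry b l) 0.
  by have [->|_ _ /(_ isT)//] := eqVneq (entry a l) 0; rewrite addr0.
Qed.

Lemma Theta_ofZ (m1 : {set lattice q}) c (a : 'M[R]_p) : Theta_of m1 a -> Theta_of m1 (c *: a).
Proof.
move=> [[a0 aN] am]; split; first split.
- by rewrite entryZ a0 mulr0.
- by move=> l; rewrite !entryZ aN.
- by move=> l; rewrite entryZ mulf_eq0 negb_or => /andP[_ /am].
Qed.

Lemma sum_spec0 (a : 'M[R]_p) : Theta a -> \sum_k spec a k = 0.
Proof. by move=> [a0 _]; rewrite sum_spec a0 mulr0. Qed.

Definition as_mx (f : lattice q -> R) : 'M[R]_p := \matrix_(i, j) f (i, j).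

Lemma entry_as_mx f l : entry (as_mx f) l = f l.
Proof. by case: l => i j; rewrite /entry mxE. Qed.

Lemma spec_as_mx f k : spec (as_mx f) k = \sum_l f l * hc l k.
Proof. by apply: eq_bigr => l _; rewrite entry_as_mx. Qed.

Lemma sum_hc_sqr (f : lattice q -> R) : (forall l : lattice q, f (- l) = f l) ->
  \sum_k (\sum_l f l * hc l k) ^+ 2 = p2 * \sum_l f l ^+ 2.
Proof.
move=> fN; under eq_bigr do rewrite -spec_as_mx.
rewrite sum_spec_sqr => [|l]; last by rewrite !entry_as_mx fN.
by congr (_ * _); apply: eq_bigr => l _; rewrite entry_as_mx.
Qed.

End even_arrays.

Section scores.
Context d (T : measurableType d) (R : realType) (P : probability T R).
Local Notation Ex := (Ex P).
Local Notation moments := (moments P).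
Context {q : nat} (n : nat) (S : lattice q -> T -> R).
Local Notation p := q.+1.
Local Notation p2 := ((p ^ 2)%N%:R : R).
Local Notation V := ((n * p ^ 2)%N%:R : R).

Definition centered_form (c : lattice q -> R) w := \sum_k c k * (S k w - n%:R).
Local Notation U := centered_form.

Hypothesis n_gt0 : (0 < n)%N.
Hypothesis S_ge0 : forall k w, 0 <= S k w.
Hypothesis mS : forall k, moments (S k).
Hypothesis ExS : forall k, Ex (S k) = n%:R.
Hypothesis ExUM : forall c c', Ex (fun w => U c w * U c' w) = 2 * n%:R * \sum_k c k * c' k.
Hypothesis ExU4 : forall c c', Ex (fun w => U c w ^+ 2 * U c' w ^+ 2) =
  4 * n%:R ^+ 2 * (\sum_k c k ^+ 2) * (\sum_k c' k ^+ 2) +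
  8 * n%:R ^+ 2 * (\sum_k c k * c' k) ^+ 2 + 48 * n%:R * \sum_k c k ^+ 2 * c' k ^+ 2.

Lemma V_gt0 : 0 < V.
Proof. by rewrite ltr0n muln_gt0 n_gt0 expn_gt0. Qed.

Lemma VE : V = n%:R * p2. Proof. exact: natrM. Qed.

Lemma moments_U c : moments (U c).
Proof.
apply: moments_sum => k; apply: momentsZ; apply: momentsB => //.
exact: moments_cst.
Qed.

Lemma U_sum (J : finType) (z : J -> R) (c : J -> lattice q -> R) w :
  \sum_j z j * U (c j) w = U (fun k => \sum_j z j * c j k) w.
Proof.
rewrite /U; under [RHS]eq_bigr do rewrite mulr_suml.
rewrite exchange_big; apply: eq_bigr => j _; rewrite mulr_sumr.
by apply: eq_bigr => k _; rewrite mulrA.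
Qed.

Lemma ExU_sqr c : Ex (fun w => U c w ^+ 2) = 2 * n%:R * \sum_k c k ^+ 2.
Proof.
by rewrite -ExUM; apply: eq_Ex => w; rewrite expr2.
Qed.

(** Uniformity in [z] is free: for all [z] the sum is the quadratic form of one random matrix, whose
    Frobenius norm is controlled in mean square. *)
Lemma whp_frobenius (J : finType) (c : J -> lattice q -> R) (wt : lattice q -> R) a eps :
  0 < a ->
  2 * n%:R * (\sum_j \sum_j' \sum_k (wt k * c j k * c j' k) ^+ 2) <= eps * a ^+ 2 ->
  whp P eps (fun w => forall z : J -> R,
    `|\sum_k wt k * (\sum_j z j * c j k) ^+ 2 * (S k w - n%:R)| <= a * \sum_j z j ^+ 2).
Proof.
move=> a0 le.
pose F j j' w := U (fun k => wt k * c j k * c j' k) w.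
pose f w := \sum_j \sum_j' F j j' w ^+ 2.
have mF j j' : moments (fun w => F j j' w ^+ 2) by apply: momentsX; exact: moments_U.
have mf : moments f by apply: moments_sum => j; apply: moments_sum => j'; exact: mF.
have f0 w : 0 <= f w.
  by apply: sumr_ge0 => j _; apply: sumr_ge0 => j' _; exact: sqr_ge0.
apply: whp_sub (whp_markov (eps := eps) mf f0 (exprn_gt0 2 a0) _) _.
  rewrite Ex_sum => [|j]; last by apply: moments_sum => j'; exact: mF.
  under eq_bigr => j _.
    rewrite Ex_sum; last by move=> j'; exact: mF.
    under eq_bigr do rewrite ExU_sqr.
    rewrite -mulr_sumr; over.
  by rewrite -mulr_sumr.
move=> w fa z.
have -> : \sum_k wt k * (\sum_j z j * c j k) ^+ 2 * (S k w - n%:R) =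
    \sum_j \sum_j' z j * z j' * F j j' w.
  rewrite /F /U; under [RHS]eq_bigr => j _ do
    (under eq_bigr do rewrite mulr_sumr; rewrite exchange_big /=).
  rewrite exchange_big; apply: eq_bigr => k _.
  rewrite [_ ^+ 2]expr2 big_distrlr /= mulr_sumr mulr_suml; apply: eq_bigr => j _.
  by rewrite mulr_sumr mulr_suml; apply: eq_bigr => j' _; ring.
have z0 : 0 <= \sum_j z j ^+ 2 by apply: sumr_ge0 => j _; exact: sqr_ge0.
rewrite -(@ler_pXn2r _ 2) ?nnegrE ?mulr_ge0 ?(ltW a0) // real_normK ?num_real //.
apply: le_trans (quadratic_form_le _ _) _.
by rewrite exprMn mulrC ler_wpM2r ?exprn_ge0 // ltW.
Qed.

(** * Gain of a step along the score *)

Section gain.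
Variables (m : {set lattice q}) (y u : lattice q -> R) (y0 y1 u1 r : R).
Hypotheses (mN : forall l, l \in m -> - l \in m) (m0 : 0 \notin m).
Local Notation N := (#|m|%:R : R).
Hypotheses (y0_gt0 : 0 < y0) (y_bnd : forall k, y0 <= y k <= y1).
Hypotheses (u1_gt0 : 0 < u1) (u_bnd : forall k, 0 <= u k <= u1) (r_gt0 : 0 < r).
Hypotheses (N_le : N ^+ 2 <= 4 * V) (N_ge : 100 * 65 * y1 ^+ 4 <= N * y0 ^+ 4).

Let y1_ge : y0 <= y1. Proof. by have /andP[] := y_bnd 0; exact: le_trans. Qed.

Let y1_gt0 : 0 < y1. Proof. exact: lt_le_trans y1_ge. Qed.

Let y_ge0 k : 0 <= y k.
Proof. by have /andP[h _] := y_bnd k; exact: le_trans (ltW y0_gt0) h. Qed.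

Let y_pow_le k j : y k ^+ j <= y1 ^+ j.
Proof.
have /andP[_ h] := y_bnd k.
by rewrite lerXn2r // nnegrE ?y_ge0 // ltW.
Qed.

Let N_ge2 : 100 * 65 * y1 ^+ 2 <= N * y0 ^+ 2.
Proof.
have h : 0 < y0 ^+ 2 by exact: exprn_gt0.
have h1 : 0 < y1 ^+ 2 by exact: exprn_gt0.
have le : y0 ^+ 2 <= y1 ^+ 2 by rewrite ler_pXn2r ?nnegrE ?(ltW y0_gt0) ?(ltW y1_gt0).
have e4 (t : R) : t ^+ 4 = t ^+ 2 * t ^+ 2 by ring.
move: N_ge; rewrite !e4; move: (y1 ^+ 2) (y0 ^+ 2) (N) h h1 le => a b M b0 a0 ba hM.
rewrite -(ler_pM2r b0); nra.
Qed.

Let N_ge1 : 1 <= N.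
Proof.
have : N != 0.
  apply/eqP => N0; move: N_ge2; rewrite N0 mul0r leNgt mulr_gt0 // exprn_gt0 //.
by rewrite pnatr_eq0 -lt0n ler1n.
Qed.

Let e l : R := (l \in m)%:R.
(** The cosine of index [l], switched off outside [m], so that sums run over the whole torus. *)
Let cm l k : R := e l * hc l k.

Let cmE l k : cm l k = e l * hc l k. Proof. by []. Qed.

Let e_idem l : e l * e l = e l.
Proof. by rewrite /e; case: (l \in m); rewrite ?mulr1 ?mulr0. Qed.

Let e_ge0 l : 0 <= e l. Proof. by rewrite /e ler0n. Qed.

Let sum_e : \sum_l e l = N.
Proof.
rewrite -sum1_card natr_sum [RHS]big_mkcond; apply: eq_bigr => l _.
by rewrite /e; case: (l \in m).
Qed.

Let eN l : e (- l) = e l.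
Proof.
rewrite /e (_ : (- l \in m) = (l \in m)) //.
by apply/idP/idP => [/mN|/mN //]; rewrite opprK.
Qed.

Let cm_sqr l k : cm l k ^+ 2 <= e l.
Proof.
rewrite exprMn expr2 e_idem -[leRHS]mulr1 ler_wpM2l ?hc_sqr_le1 //.
Qed.

Let sum_cm_sqr_le l : \sum_k cm l k ^+ 2 <= p2 * e l.
Proof.
apply: le_trans (_ : \sum_(k : lattice q) e l <= _); first exact: ler_sum.
by rewrite sumr_const card_prod card_ord mulnn mulr_natl.
Qed.

Let sum_cm_sqr_ge l : p2 / 2 * e l <= \sum_k cm l k ^+ 2.
Proof.
have -> : \sum_k cm l k ^+ 2 = e l * \sum_k hc l k * hc l k.
  by rewrite mulr_sumr; apply: eq_bigr => k _; rewrite exprMn -[in RHS]expr2 expr2 e_idem.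
rewrite sum_hcM eqxx mulrC ler_wpM2l //.
have h : 0 <= (l == - l)%:R * p2 by rewrite mulr_ge0.
by rewrite ler_pM2r // mulrDl mul1r lerDl.
Qed.

Let cy l k := cm l k * y k.
Let Ul l w := U (cy l) w.
Let Q w := \sum_l Ul l w ^+ 2.
Let E1 := 2 * n%:R * \sum_l \sum_k cy l k ^+ 2.

Let cy_sqr_le l k : cy l k ^+ 2 <= cm l k ^+ 2 * y1 ^+ 2.
Proof.
by rewrite exprMn ler_wpM2l ?sqr_ge0 ?y_pow_le.
Qed.

Let mQ : moments Q.
Proof. by apply: moments_sum => l; apply: momentsX; exact: moments_U. Qed.

Let ExQ : Ex Q = E1.
Proof.
rewrite Ex_sum => [|l]; last by apply: momentsX; exact: moments_U.
by rewrite /E1 mulr_sumr; apply: eq_bigr => l _; exact: ExU_sqr.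
Qed.

Let E1_ge : V * N * y0 ^+ 2 <= E1.
Proof.
rewrite /E1 VE -sum_e mulr_sumr mulr_suml mulr_sumr ler_sum // => l _.
apply: le_trans (_ : 2 * n%:R * ((p2 / 2 * e l) * y0 ^+ 2) <= _).
  by rewrite le_eqVlt; apply/orP; left; apply/eqP; field.
rewrite ler_wpM2l ?mulr_ge0 //.
apply: le_trans (_ : (\sum_k cm l k ^+ 2) * y0 ^+ 2 <= _).
  by rewrite ler_wpM2r ?sqr_ge0.
rewrite mulr_suml ler_sum // => k _; rewrite [leRHS]exprMn ler_wpM2l ?sqr_ge0 //.
have /andP[ky0 _] := y_bnd k.
by rewrite lerXn2r // nnegrE ?y_ge0 // ltW.
Qed.

(** The pairings give [E1 ^+ 2] plus a Bessel sum, and the cumulants a term of order [V N ^ 2]. As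
    [N ^ 2 <= 4 V], the variance is of order [V ^ 2 N], a factor [N] below the square of the mean;
    [200 = 8 + 48 * 4]. *)
Let variance_Q : Ex (fun w => (Q w - E1) ^+ 2) <= 200 * V ^+ 2 * N * y1 ^+ 4.
Proof.
have mE c := moments_cst P c.
have -> : Ex (fun w => (Q w - E1) ^+ 2) = Ex (fun w => Q w ^+ 2) - E1 ^+ 2.
  transitivity (Ex (fun w => Q w ^+ 2 + (- 2 * E1) * Q w + E1 ^+ 2)).
    by apply: eq_Ex => w; ring.
  rewrite !ExD ?ExZ ?Ex_cst //; do ?[exact: mQ | exact: mE | apply: momentsX | apply: momentsZ | apply: momentsD].
  by rewrite ExQ -/E1; ring.
pose A l := \sum_k cy l k ^+ 2.
have -> : Ex (fun w => Q w ^+ 2) = E1 ^+ 2 +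
    \sum_l \sum_l' (8 * n%:R ^+ 2 * (\sum_k cy l k * cy l' k) ^+ 2 +
      48 * n%:R * \sum_k cy l k ^+ 2 * cy l' k ^+ 2).
  transitivity (Ex (fun w => \sum_l \sum_l' Ul l w ^+ 2 * Ul l' w ^+ 2)).
    by apply: eq_Ex => w; rewrite expr2 /Q big_distrlr.
  have mm l l' : moments (fun w => Ul l w ^+ 2 * Ul l' w ^+ 2).
    by apply: momentsM; apply: momentsX; exact: moments_U.
  rewrite Ex_sum => [|l]; last by apply: moments_sum => l'; exact: mm.
  rewrite /E1 exprMn [X in _ * X]expr2 big_distrlr /= mulr_sumr -big_split.
  apply: eq_bigr => l _; rewrite Ex_sum => [|l']; last exact: mm.
  rewrite mulr_sumr -big_split; apply: eq_bigr => l' _.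
  by rewrite ExU4 /=; ring.
rewrite addrAC subrr add0r.
have y14 : 0 <= y1 ^+ 4 by rewrite exprn_ge0 // ltW.
apply: le_trans (_ : \sum_l (8 * n%:R ^+ 2 * (p2 ^+ 2 * y1 ^+ 4 * e l) +
    48 * n%:R * (p2 * y1 ^+ 4 * e l * N)) <= _).
  apply: ler_sum => l _; rewrite big_split /= -!mulr_sumr.
  apply: lerD; rewrite ler_wpM2l ?mulr_ge0 ?exprn_ge0 //.
    pose f k := cm l k * y k ^+ 2.
    apply: le_trans (_ : p2 * \sum_k f k ^+ 2 <= _); last first.
      have -> : p2 ^+ 2 * y1 ^+ 4 * e l = p2 * (p2 * e l * y1 ^+ 4) by ring.
      rewrite ler_wpM2l //.
      apply: le_trans (_ : \sum_k cm l k ^+ 2 * y1 ^+ 4 <= _).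
        apply: ler_sum => k _; rewrite /f exprMn ler_wpM2l ?sqr_ge0 // -exprM.
        exact: y_pow_le.
      by rewrite -mulr_suml ler_wpM2r.
    apply: le_trans _ (bessel_hc m f).
    rewrite [leRHS]big_mkcond /= ler_sum // => l' _.
    have [l'm|l'm] := boolP (l' \in m); last first.
      rewrite big1 ?expr0n // => k _.
      have e0 : e l' = 0 by rewrite /e (negbTE l'm).
      by rewrite /cy (cmE l' k) e0 !mul0r mulr0.
    rewrite le_eqVlt; apply/orP; left; apply/eqP; congr (_ ^+ 2).
    apply: eq_bigr => k _; rewrite /cy (cmE l' k).
    by rewrite (_ : e l' = 1) /f; [ring | rewrite /e l'm].
  rewrite -sum_e mulr_sumr ler_sum // => l' _.
  apply: le_trans (_ : \sum_k cm l k ^+ 2 * (e l' * y1 ^+ 4) <= _).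
    apply: ler_sum => k _.
    apply: le_trans (_ : (cm l k ^+ 2 * y1 ^+ 2) * (e l' * y1 ^+ 2) <= _).
      apply: ler_pM; rewrite ?sqr_ge0 ?cy_sqr_le //.
      by apply: le_trans (cy_sqr_le _ _) _; rewrite ler_wpM2r ?sqr_ge0.
    by rewrite le_eqVlt; apply/orP; left; apply/eqP; ring.
  rewrite -mulr_suml; apply: le_trans (_ : (p2 * e l) * (e l' * y1 ^+ 4) <= _).
    by apply: ler_wpM2r; [apply: mulr_ge0 | exact: sum_cm_sqr_le].
  by rewrite le_eqVlt; apply/orP; left; apply/eqP; ring.
have -> : \sum_l (8 * n%:R ^+ 2 * (p2 ^+ 2 * y1 ^+ 4 * e l) +
    48 * n%:R * (p2 * y1 ^+ 4 * e l * N)) =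
    y1 ^+ 4 * (8 * V ^+ 2 * N + 48 * V * N ^+ 2).
  rewrite -[in RHS]sum_e VE !mulr_sumr big_split /= -!mulr_sumr -!mulr_suml -!mulr_sumr sum_e.
  by ring.
rewrite [leRHS]mulrC ler_wpM2l //.
have V0 := V_gt0; have V2 : 0 <= V ^+ 2 by rewrite sqr_ge0.
apply: le_trans (_ : 8 * V ^+ 2 * N + 48 * V * (4 * V) <= _).
  by rewrite lerD2l ler_wpM2l // mulr_ge0 // ltW.
have : 192 * V ^+ 2 * 1 <= 192 * V ^+ 2 * N by rewrite ler_wpM2l // mulr_ge0.
move: (V) (N) => v M; nra.
Qed.

(** Mean of the score [g], which need not vanish when [y] is not constant; [bh] is its direction. *)
Let b l := n%:R * \sum_k cy l k.
Let bh l := b l / Num.sqrt (\sum_l' b l' ^+ 2).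
Let g l w := b l + Ul l w.

Let gE l w : g l w = \sum_k cy l k * S k w.
Proof.
rewrite /g /Ul /b mulr_sumr -big_split; apply: eq_bigr => k _ /=; ring.
Qed.

Let cyN l k : cy (- l) k = cy l k.
Proof. by rewrite /cy !cmE eN hcN. Qed.

Let bN l : b (- l) = b l.
Proof. by rewrite /b; congr (_ * _); apply: eq_bigr => k _; exact: cyN. Qed.

Let gN l w : g (- l) w = g l w.
Proof. by rewrite !gE; apply: eq_bigr => k _; rewrite cyN. Qed.

Let sum_sqr_ge0 (f : lattice q -> R) : 0 <= \sum_l f l ^+ 2.
Proof. by apply: sumr_ge0 => l _; exact: sqr_ge0. Qed.

Let sum_bh_le1 : \sum_l bh l ^+ 2 <= 1.
Proof.
have h := sum_sqr_ge0 b.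
under eq_bigr do rewrite /bh exprMn exprVn sqr_sqrtr //.
rewrite -mulr_suml; have [->|n0] := eqVneq (\sum_l b l ^+ 2) 0; first by rewrite mul0r.
by rewrite divff.
Qed.

(** Projecting [b + U] onto the orthogonal of [b] leaves [U] minus its component along [b]: a mean
    of any size costs at most one direction. *)
Let shift_le w : Q w - (\sum_l bh l * Ul l w) ^+ 2 <= \sum_l g l w ^+ 2.
Proof.
set be := \sum_l b l ^+ 2; set x := \sum_l b l * Ul l w.
have h : 0 <= be by exact: sum_sqr_ge0.
have -> : \sum_l g l w ^+ 2 = be + 2 * x + Q w.
  rewrite /be /x /Q mulr_sumr -!big_split; apply: eq_bigr => l _ /=.
  by rewrite /g; ring.
have -> : (\sum_l bh l * Ul l w) = x / Num.sqrt be.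
  by rewrite /x mulr_suml; apply: eq_bigr => l _; rewrite /bh mulrAC.
rewrite exprMn exprVn sqr_sqrtr //.
have [be0|bn0] := eqVneq be 0.
  have b0 l : b l = 0.
    have := sum_sqr_ge0 b; rewrite -/be; move/eqP: be0; rewrite /be psumr_eq0.
      by move=> /allP /(_ l (mem_index_enum _)); rewrite sqrf_eq0 => /eqP.
    by move=> i _; exact: sqr_ge0.
  have x0 : x = 0 by rewrite /x big1 // => l _; rewrite b0 mul0r.
  by rewrite be0 x0 invr0 !mulr0 !add0r subr0.
have bp : 0 < be by rewrite lt_neqAle eq_sym bn0.
have : 0 <= (be + x) ^+ 2 / be by rewrite divr_ge0 ?sqr_ge0.
have -> : (be + x) ^+ 2 / be = be + 2 * x + x ^+ 2 / be by field.
move: (x ^+ 2 / be) => X; lra.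
Qed.

(** Chebyshev: [8 / 65 = 4 * 200 / (100 * 65)], from the variance bound and [N_ge]. *)
Let whp_Q : whp P (8 / 65) (fun w => (Q w - E1) ^+ 2 < E1 ^+ 2 / 4).
Proof.
have V0 := V_gt0; have N0 : 0 < N := lt_le_trans ltr01 N_ge1.
have y00 : 0 < y0 ^+ 2 := exprn_gt0 2 y0_gt0.
have VN : 0 < V * N * y0 ^+ 2 by rewrite !mulr_gt0.
have E10 : 0 < E1 := lt_le_trans VN E1_ge.
apply: whp_markov.
- by apply: momentsX; apply: momentsB; [exact: mQ | exact: moments_cst].
- by move=> w; exact: sqr_ge0.
- by rewrite divr_gt0 // exprn_gt0.
apply: le_trans variance_Q _.
have le2 : (V * N * y0 ^+ 2) ^+ 2 <= E1 ^+ 2 by rewrite lerXn2r // nnegrE ltW.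
apply: le_trans (_ : 8 / 65 * ((V * N * y0 ^+ 2) ^+ 2 / 4) <= _); last first.
  by rewrite ler_wpM2l // ler_wpM2r.
have -> : (V * N * y0 ^+ 2) ^+ 2 = V ^+ 2 * N * (N * y0 ^+ 4) by ring.
have VN0 : 0 <= V ^+ 2 * N by rewrite mulr_ge0 ?sqr_ge0 // ltW.
have := ler_wpM2l VN0 N_ge.
move: (V ^+ 2) (N) (y1 ^+ 4) (y0 ^+ 4) => v M c d'; lra.
Qed.

Let whp_bh : whp P (1 / 800) (fun w => (\sum_l bh l * Ul l w) ^+ 2 < V * N * y0 ^+ 2 / 4).
Proof.
have V0 := V_gt0; have N0 : 0 < N := lt_le_trans ltr01 N_ge1.
have y00 : 0 < y0 ^+ 2 := exprn_gt0 2 y0_gt0.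
have UE w : \sum_l bh l * Ul l w = U (fun k => \sum_l bh l * cy l k) w by exact: U_sum.
apply: whp_markov.
- apply: momentsX; rewrite (_ : (fun w => _) = U (fun k => \sum_l bh l * cy l k)).
    exact: moments_U.
  by apply/funext => w; exact: UE.
- by move=> w; exact: sqr_ge0.
- by rewrite divr_gt0 // !mulr_gt0.
rewrite (eq_Ex P (g := fun w => U (fun k => \sum_l bh l * cy l k) w ^+ 2)); last first.
  by move=> w; rewrite UE.
rewrite ExU_sqr.
have h : \sum_k (\sum_l bh l * cy l k) ^+ 2 <= p2 * y1 ^+ 2.
  apply: le_trans (_ : \sum_k (\sum_l bh l * hc l k) ^+ 2 * y1 ^+ 2 <= _).
    apply: ler_sum => k _.
    have -> : \sum_l bh l * cy l k = (\sum_l bh l * hc l k) * y k.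
      rewrite mulr_suml; apply: eq_bigr => l _.
      rewrite /cy cmE /bh /b.
      have [lm|lm] := boolP (l \in m); first by rewrite (_ : e l = 1) ?mul1r ?mulrA // /e lm.
      have e0 : e l = 0 by rewrite /e (negbTE lm).
      rewrite big1 ?mulr0 ?mul0r // => k' _.
      by rewrite /cy cmE e0 !mul0r.
    by rewrite exprMn ler_wpM2l ?sqr_ge0 ?y_pow_le.
  rewrite -mulr_suml sum_hc_sqr => [|l]; last by rewrite /bh bN.
  rewrite ler_wpM2r ?sqr_ge0 //.
  by rewrite -[leRHS]mulr1 ler_wpM2l.
apply: le_trans (_ : 2 * n%:R * (p2 * y1 ^+ 2) <= _); first by rewrite ler_wpM2l ?mulr_ge0.
have -> : 2 * n%:R * (p2 * y1 ^+ 2) = V * (2 * y1 ^+ 2) by rewrite VE; ring.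
have := ler_wpM2l (ltW V0) N_ge2; have : 0 <= V * N * y0 ^+ 2 by rewrite !mulr_ge0 // ltW.
move: (V) (N) (y1 ^+ 2) (y0 ^+ 2) => v M c d'; lra.
Qed.

Let whp_quadratic : whp P (1 / 8) (fun w => forall z : lattice q -> R,
    `|\sum_k u k * (\sum_l z l * cm l k) ^+ 2 * (S k w - n%:R)| <=
    (8 * V * u1) * \sum_l z l ^+ 2).
Proof.
have V0 := V_gt0.
apply: whp_frobenius; first by rewrite !mulr_gt0.
apply: le_trans (_ : 2 * n%:R * (p2 * u1 ^+ 2 * N ^+ 2) <= _).
  rewrite ler_wpM2l ?mulr_ge0 // [N ^+ 2]expr2 -sum_e big_distrlr /= mulr_sumr ler_sum // => l _.
  rewrite mulr_sumr ler_sum // => l' _.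
  apply: le_trans (_ : \sum_(k : lattice q) u1 ^+ 2 * (e l * e l') <= _); last first.
    rewrite sumr_const card_prod card_ord mulnn -mulr_natl.
    by rewrite le_eqVlt; apply/orP; left; apply/eqP; ring.
  apply: ler_sum => k _; have /andP[uk0 uk1] := u_bnd k.
  have -> : (u k * cm l k * cm l' k) ^+ 2 = u k ^+ 2 * (cm l k ^+ 2 * cm l' k ^+ 2) by ring.
  apply: ler_pM; first exact: sqr_ge0; first by apply: mulr_ge0; exact: sqr_ge0.
    by rewrite lerXn2r // nnegrE ltW.
  by apply: ler_pM; rewrite ?sqr_ge0 ?cm_sqr.
have -> : 2 * n%:R * (p2 * u1 ^+ 2 * N ^+ 2) = (2 * V * u1 ^+ 2) * N ^+ 2 by rewrite VE; ring.
apply: le_trans (_ : (2 * V * u1 ^+ 2) * (4 * V) <= _).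
  by rewrite ler_wpM2l // !mulr_ge0 ?sqr_ge0 // ltW.
by rewrite le_eqVlt; apply/orP; left; apply/eqP; field.
Qed.

(* A step [h = t g] along the score [g]: its linear gain is [2 t |g|^2], and
   [t] is small enough for the quadratic loss to be at most [t |g|^2]. *)
Lemma whp_gain : whp P (1 / 4) (fun w => exists h : 'M[R]_p,
  [/\ Theta_of m h, forall k, `|spec h k| <= r &
      Num.min (N * y0 ^+ 2 / (36 * u1)) (r * N * y0 / 4) <=
      \sum_k (2 * y k * spec h k - u k * spec h k ^+ 2) * S k w]).
Proof.
have le : (8 / 65 + 1 / 800 + 1 / 8 : R) <= 1 / 4 by lra.
apply: whp_le le _.
apply: whp_sub (whp_and (whp_and whp_Q whp_bh) whp_quadratic) _.
move=> w [[hQ hb] hF].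
have V0 := V_gt0; have N0 : 0 < N := lt_le_trans ltr01 N_ge1.
have y00 : 0 < y0 ^+ 2 := exprn_gt0 2 y0_gt0.
have VN : 0 < V * N * y0 ^+ 2 by rewrite !mulr_gt0.
pose G := \sum_l g l w ^+ 2.
(* On this event [Q w >= E1 / 2], and the direction [bh] removes at most half of that. *)
have G_ge : V * N * y0 ^+ 2 / 4 <= G.
  apply: le_trans (shift_le w).
  have E1g := E1_ge; move: hQ hb E1g VN.
  move: (V * N * y0 ^+ 2) E1 (Q w) ((\sum_l bh l * Ul l w) ^+ 2) => v E q' B; nra.
have G0 : 0 < G by apply: lt_le_trans G_ge; rewrite divr_gt0.
pose A := \sum_l `|g l w|.
have ge l : g l w * e l = g l w.
  rewrite gE mulr_suml; apply: eq_bigr => k _.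
  rewrite /cy cmE; transitivity ((e l * e l) * (hc l k * y k * S k w)); first by ring.
  by rewrite e_idem; ring.
have A2 : A ^+ 2 <= N * G.
  have -> : A = \sum_l e l * `|g l w|.
    apply: eq_bigr => l _; rewrite -{1}ge normrM [in LHS]mulrC; congr (_ * _).
    by rewrite ger0_norm.
  apply: le_trans (cauchy_schwarz_sum _ _) _.
  rewrite le_eqVlt; apply/orP; left; apply/eqP; congr (_ * _).
    by rewrite -sum_e; apply: eq_bigr => l _; rewrite expr2 e_idem.
  by apply: eq_bigr => l _; rewrite real_normK ?num_real.
have A0 : 0 < A.
  rewrite lt_neqAle eq_sym sumr_ge0 // andbT; apply: contraTneq G0 => /eqP.
  rewrite psumr_eq0 // => /allP gA; rewrite -leNgt /G big1 // => l _.
  by have := gA l (mem_index_enum _); rewrite /= normr_eq0 => /eqP ->; rewrite expr0n.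
(* [9 = 1 + 8] adds the mean of the quadratic loss to its fluctuation bound; the other term gives
   [|spec h k| <= t * A <= r], cosines being at most 1. *)
pose t := Num.min (9 * u1 * V)^-1 (r / A).
have uV0 : 0 < 9 * u1 * V by rewrite !mulr_gt0.
have t0 : 0 < t by rewrite lt_min invr_gt0 uV0 divr_gt0.
have t1 : t * (9 * u1 * V) <= 1 by rewrite -ler_pdivlMr // div1r ge_min lexx.
have t2 : t * A <= r by rewrite -ler_pdivlMr // ge_min lexx orbT.
pose h := as_mx (fun l => t * g l w).
have specE k : spec h k = \sum_l (t * g l w) * cm l k.
  rewrite spec_as_mx; apply: eq_bigr => l _.
  by rewrite cmE -{1}ge; ring.
exists h; split.
- split; first split.
  + rewrite entry_as_mx -ge (_ : e 0 = 0) ?mulr0 // /e.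
    by rewrite (negbTE m0).
  + by move=> l; rewrite !entry_as_mx gN.
  + move=> l; rewrite entry_as_mx; apply: contraNT => lm.
    by rewrite -ge (_ : e l = 0) ?mulr0 // /e (negbTE lm).
- move=> k; rewrite spec_as_mx; apply: le_trans t2.
  apply: le_trans (ler_norm_sum _ _ _) _.
  rewrite /A mulr_sumr ler_sum // => l _.
  rewrite !normrM (gtr0_norm t0) -[leRHS]mulr1 ler_wpM2l ?hc_norm_le1 //.
  by rewrite mulr_ge0 // ltW.
have lin : \sum_k 2 * y k * spec h k * S k w = 2 * (t * G).
  transitivity (2 * \sum_l (t * g l w) * g l w).
    under [in RHS]eq_bigr do rewrite [X in _ * X]gE mulr_sumr.
    rewrite exchange_big mulr_sumr; apply: eq_bigr => k _ /=.
    rewrite specE mulr_sumr mulr_suml mulr_sumr; apply: eq_bigr => l _.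
    by rewrite /cy; ring.
  by rewrite /G [t * _]mulr_sumr; congr (_ * _); apply: eq_bigr => l _; ring.
have nu2 : \sum_k spec h k ^+ 2 = p2 * (t ^+ 2 * G).
  under eq_bigr do rewrite spec_as_mx.
  rewrite sum_hc_sqr => [|l]; last by rewrite gN.
  by congr (_ * _); rewrite mulr_sumr; apply: eq_bigr => l _; rewrite exprMn.
have quad : \sum_k u k * spec h k ^+ 2 * S k w <= t ^+ 2 * G * (9 * u1 * V).
  have -> : \sum_k u k * spec h k ^+ 2 * S k w =
      n%:R * \sum_k u k * spec h k ^+ 2 +
      \sum_k u k * (\sum_l (t * g l w) * cm l k) ^+ 2 * (S k w - n%:R).
    rewrite mulr_sumr -big_split; apply: eq_bigr => k _ /=.
    by rewrite -specE; ring.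
  have le1 : n%:R * \sum_k u k * spec h k ^+ 2 <= t ^+ 2 * G * (u1 * V).
    have -> : t ^+ 2 * G * (u1 * V) = n%:R * (u1 * (p2 * (t ^+ 2 * G))) by rewrite VE; ring.
    rewrite ler_wpM2l // -nu2 mulr_sumr ler_sum // => k _.
    by rewrite ler_wpM2r ?sqr_ge0 //; have /andP[] := u_bnd k.
  have := hF (fun l => t * g l w) => /(le_trans (ler_norm _)).
  have -> : \sum_l (t * g l w) ^+ 2 = t ^+ 2 * G.
    by rewrite mulr_sumr; apply: eq_bigr => l _; rewrite exprMn.
  move: (\sum_k u k * (\sum_l _) ^+ 2 * _) => Z le2.
  apply: le_trans (lerD le1 le2) _.
  by rewrite le_eqVlt; apply/orP; left; apply/eqP; ring.
have -> : \sum_k (2 * y k * spec h k - u k * spec h k ^+ 2) * S k w =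
    2 * (t * G) - \sum_k u k * spec h k ^+ 2 * S k w.
  by rewrite -lin -sumrB; apply: eq_bigr => k _; rewrite mulrBl.
have tG : t * G <= 2 * (t * G) - \sum_k u k * spec h k ^+ 2 * S k w.
  have : t ^+ 2 * G * (9 * u1 * V) <= t * G.
    have -> : t ^+ 2 * G * (9 * u1 * V) = t * G * (t * (9 * u1 * V)) by ring.
    by rewrite -[leRHS]mulr1 ler_wpM2l // mulr_ge0 // ltW.
  move: quad; lra.
apply: le_trans tG; rewrite /t minr_pMl ?(ltW G0) // le_min !ge_min.
apply/andP; split; apply/orP; [left|right].
  rewrite -ler_pdivrMl ?invr_gt0 // invrK.
  apply: le_trans G_ge; rewrite le_eqVlt; apply/orP; left; apply/eqP.
  by field; rewrite !lt0r_neq0.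
(* [r G / A >= r N y0 / 4] results from [A ^ 2 <= N G], [G >= V N y0 ^ 2 / 4] and [N ^ 2 <= 4 V]. *)
rewrite [leRHS]mulrAC ler_pdivlMr //.
have -> : r * N * y0 / 4 * A = r * (N * y0 * A / 4) by ring.
rewrite ler_wpM2l ?(ltW r_gt0) // ler_pdivrMr // [leRHS]mulrC.
rewrite -(@ler_pXn2r _ 2) ?nnegrE ?mulr_ge0 ?(ltW A0) ?(ltW y0_gt0) ?(ltW G0) //.
rewrite !exprMn; apply: le_trans (_ : N ^+ 2 * y0 ^+ 2 * (N * G) <= _).
  by rewrite ler_wpM2l // mulr_ge0 ?sqr_ge0.
have : N ^+ 2 * (N * y0 ^+ 2 * G) <= 4 * V * (N * y0 ^+ 2 * G).
  by rewrite ler_wpM2r // !mulr_ge0 // ltW.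
have : (V * N * y0 ^+ 2 / 4) * G <= G * G by rewrite ler_wpM2r // ltW.
move: (N) (V) (y0 ^+ 2) (G) => M v c G'; nra.
Qed.

End gain.

Section competitors.
Variables (m : {set lattice q}) (theta : 'M[R]_p) (rho : R).
Local Notation N := (#|m|%:R : R).
Local Notation lam k := (1 - spec theta k).
Hypotheses (mN : forall l, l \in m -> - l \in m) (m0 : 0 \notin m).
Hypothesis N_le : N ^+ 2 <= 4 * V.

(** For the scores of the field, this is the least-squares criterion in units of [sigma2 / V]. *)
Definition score_crit (vt : 'M[R]_p) w := \sum_k (1 - spec vt k) ^+ 2 / lam k * S k w.

(** * Comparison with the empty model *)

Section empty_model.
Hypotheses (rho_gt2 : 2 < rho) (Tt : Theta_plus_of m rho theta).

Let lam_bnd k : 0 < lam k < rho.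
Proof. by case: (iffLR (Theta_plus_ofP _ _ _) Tt). Qed.

Let Tmt : Theta_of m theta.
Proof. by case: Tt. Qed.

Let del k := spec theta k.
(** The weight [1 / lam k] truncated at 2, so that no bound degrades when [theta] approaches the
    boundary. *)
Let u k := (Num.max (lam k) (1 / 2))^-1.
(** Since [16 * tau ^ 2 = tau], the variance of the linear term in [whp_linear] is at most
    [n tau B], the lower bound on its mean gain. *)
Let tau : R := 1 / 16.
Let t0 : 0 < tau. Proof. by rewrite divr_gt0. Qed.

Let y k := u k * (1 - tau * del k).

Let max_ge k : 1 / 2 <= Num.max (lam k) (1 / 2).
Proof. by rewrite le_max lexx orbT. Qed.

Let max_gt0 k : 0 < Num.max (lam k) (1 / 2).
Proof. by apply: lt_le_trans (max_ge k); rewrite divr_gt0. Qed.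

Let u_bnd k : 0 <= u k <= 2.
Proof.
rewrite invr_ge0 (ltW (max_gt0 k)) /= -[leRHS]invrK lef_pV2 ?posrE ?max_gt0 //.
by apply: le_trans (max_ge k); rewrite div1r.
Qed.

Let u_max k : u k * Num.max (lam k) (1 / 2) = 1.
Proof. by rewrite mulVf // lt0r_neq0. Qed.

(** Where [lam k > 1 / 2], [y k = (1 - tau) / lam k + tau]: the shrinkage keeps [y] above [tau]
    however large [lam k] is. *)
Let y_bnd k : tau <= y k <= 2.
Proof.
have /andP[u0 _] := u_bnd k; have := u_max k; have := lam_bnd k; have := u_bnd k.
rewrite /y /del; case: (leP (lam k) (1 / 2)) => h.
  rewrite /tau; move: u0 h; move: (spec _ _) (u k) => s v; nra.
rewrite /tau; move: u0 h; move: (spec _ _) (u k) => s v; nra.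
Qed.

Let B := \sum_k u k * del k ^+ 2.

Let B_ge0 : 0 <= B.
Proof.
by apply: sumr_ge0 => k _; rewrite mulr_ge0 ?sqr_ge0 //; have /andP[] := u_bnd k.
Qed.

(* Since [del] has mean zero, [u] may be replaced with [u - 1] in the sum. *)
Let sum_u_ge : B / 2 <= \sum_k u k * del k.
Proof.
have -> : \sum_k u k * del k = \sum_k (u k - 1) * del k.
  under [RHS]eq_bigr do rewrite mulrBl mul1r.
  by rewrite sumrB (sum_spec0 (proj1 Tmt)) subr0.
rewrite /B mulr_suml ler_sum // => k _.
have := u_max k; have := lam_bnd k; have := u_bnd k.
rewrite /del; case: (leP (lam k) (1 / 2)) => h.
  move: h; move: (spec _ _) (u k) => s v h _ hs hv.
  have -> : v = 2 by lra.
  nra.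
move: h; move: (spec _ _) (u k) => s v h hv hs e.
have -> : (v - 1) * s = v * s ^+ 2 by rewrite (_ : v - 1 = v * s); [ring | lra].
have : 0 <= v * s ^+ 2 by rewrite mulr_ge0 ?sqr_ge0 //; case/andP: hv.
lra.
Qed.

(** The threshold comes from [(x / 2 + 4) ^ 2 >= 8 x], where [x = n tau B] bounds the variance. *)
Let whp_linear : whp P (1 / 8) (fun w => `|2 * tau * U (fun k => u k * del k) w| <
  n%:R * tau * B / 2 + 4).
Proof.
set c := fun k => u k * del k; set x := n%:R * tau * B.
have x0 : 0 <= x by rewrite !mulr_ge0 // /tau.
have h : 0 < x / 2 + 4 by lra.
have mU := moments_U c.
apply: whp_sub (whp_markov (f := fun w => (2 * tau * U c w) ^+ 2) (a := (x / 2 + 4) ^+ 2) _ _ _ _) _.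
- by apply: momentsX; apply: momentsZ.
- by move=> w; exact: sqr_ge0.
- exact: exprn_gt0.
- rewrite (eq_Ex P (g := fun w => (2 * tau) ^+ 2 * U c w ^+ 2)); last by move=> w; rewrite exprMn.
  rewrite ExZ; last by apply: momentsX.
  rewrite ExU_sqr.
  have le : \sum_k c k ^+ 2 <= 2 * B.
    rewrite /B mulr_sumr ler_sum // => k _; rewrite /c exprMn mulrA ler_wpM2r ?sqr_ge0 //.
    by have /andP[u0 u2] := u_bnd k; rewrite expr2 ler_wpM2r.
  apply: le_trans (_ : (2 * tau) ^+ 2 * (2 * n%:R * (2 * B)) <= _).
    by rewrite ler_wpM2l ?sqr_ge0 // ler_wpM2l // mulr_ge0.
  have -> : (2 * tau) ^+ 2 * (2 * n%:R * (2 * B)) = x by rewrite /x /tau; field.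
  have := sqr_ge0 (x / 2 - 4); lra.
- by move=> w /=; rewrite -{1}(sqr_sqrtr (sqr_ge0 (2 * tau * U c w))) ltr_pXn2r ?nnegrE ?sqrtr_ge0 ?(ltW h) // sqrtr_sqr.
Qed.

Let whp_square : whp P (1 / 8) (fun w => \sum_k (tau ^+ 2 * u k * del k ^+ 2) * S k w <
  n%:R * tau * B / 2 + 1).
Proof.
set x := n%:R * tau * B.
have x0 : 0 <= x by rewrite !mulr_ge0 // /tau.
have tt0 : 0 <= tau ^+ 2 by exact: sqr_ge0.
have mm k : moments (fun w => tau ^+ 2 * u k * del k ^+ 2 * S k w) by apply: momentsZ.
apply: whp_markov; first by apply: moments_sum.
- move=> w; apply: sumr_ge0 => k _; rewrite mulr_ge0 // mulr_ge0 ?sqr_ge0 // mulr_ge0 //.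
  by have /andP[] := u_bnd k.
- by lra.
rewrite Ex_sum //; under eq_bigr do rewrite ExZ // ExS.
have -> : \sum_k tau ^+ 2 * u k * del k ^+ 2 * n%:R = x / 16.
  rewrite /x /B -mulr_suml /tau [RHS]mulrAC [in RHS]mulrC -!mulrA.
  under eq_bigr do rewrite -mulrA.
  by rewrite -mulr_sumr; field.
lra.
Qed.

(** Where the truncation acts, the term is nonnegative because [mu] lies in [[0, 2]], so lowering
    its weight lowers the sum: the truncated gain bounds the true one from below. *)
Let ler_wpM_max l (mu : R) : 0 < l -> (l <= 1 / 2 -> 0 <= mu <= 2) ->
  (Num.max l (1 / 2))^-1 * (mu * (2 - mu)) <= mu * (2 - mu) / l.
Proof.
move=> l0; have -> : mu * (2 - mu) / l = l^-1 * (mu * (2 - mu)) by rewrite mulrC.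
case: leP => // l2 /(_ isT) /andP[mu0 mu2].
by rewrite ler_wpM2r ?mulr_ge0 ?subr_ge0 // lef_pV2 // posrE divr_gt0.
Qed.

Let competitor_bnd s v : 0 < 1 - s < rho -> `|v| <= tau / 2 -> 0 < 1 - (tau * s + v) < rho.
Proof.
rewrite ler_norml /tau => /andP[? ?] /andP[? ?].
by apply/andP; split; move: rho_gt2; lra.
Qed.

(** Moving from 0 to [tau *: theta] has a mean linear gain of at least [x = n tau B]; noise and
    quadratic loss cost at most [x / 2 + 4] and [x / 2 + 1]. The move thus loses at most 5, which
    half of the gain [N tau ^ 2 / 72] of the further step [h] covers. *)
Lemma whp_empty_model : 100 * 65 * 2 ^+ 4 <= N * (1 / 16) ^+ 4 -> 10 * 72 <= N * (1 / 16) ^+ 2 ->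
  whp P (1 / 2) (fun w => exists2 h, Theta_plus_of m rho h &
    N * (1 / 16) ^+ 2 / 144 <= score_crit 0 w - score_crit h w).
Proof.
rewrite -/tau => N1 N2.
(* The radius [tau / 2] ensures [mu >= 0] wherever [lam k <= 1 / 2], since there
   [tau * del k >= tau / 2]. *)
have gain := whp_gain mN m0 t0 y_bnd (ltr0n _ 2) u_bnd
  (divr_gt0 t0 (ltr0n _ 2)) N_le N1.
have le : (1 / 4 + 1 / 8 + 1 / 8 : R) <= 1 / 2 by lra.
apply: whp_le le _.
apply: whp_sub (whp_and (whp_and gain whp_linear) whp_square) _.
move=> w [[[h [Th hr hg]] hl] hs].
have spec_h k : spec (tau *: theta + h) k = tau * del k + spec h k.
  by rewrite specD specZ.
exists (tau *: theta + h).
  apply/Theta_plus_ofP; split; first by apply: Theta_ofD => //; exact: Theta_ofZ.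
  move=> k; rewrite spec_h; have := hr k; have := lam_bnd k.
  by move=> ? ?; exact: competitor_bnd.
apply: le_trans (_ : \sum_k u k * ((tau * del k + spec h k) * (2 - (tau * del k + spec h k))) * S k w <= _); last first.
  rewrite -sumrB ler_sum // => k _; rewrite -mulrBl ler_wpM2r // spec_h.
  have s0 : spec (0 : 'M[R]_p) k = 0 by rewrite -(scale0r 0) specZ mul0r.
  rewrite s0 subr0 expr1n -mulrBl.
  set mu := tau * del k + spec h k.
  have -> : 1 - (1 - mu) ^+ 2 = mu * (2 - mu) by ring.
  apply: ler_wpM_max => [|hl2]; first by case/andP: (lam_bnd k).
  have := hr k; have := lam_bnd k; move: hl2.
  by rewrite ler_norml /mu /del /tau => ? /andP[? ?] /andP[? ?]; apply/andP; split; lra.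
pose T0 := 2 * tau * U (fun k => u k * del k) w - \sum_k (tau ^+ 2 * u k * del k ^+ 2) * S k w.
have -> : \sum_k u k * ((tau * del k + spec h k) * (2 - (tau * del k + spec h k))) * S k w =
    2 * tau * n%:R * (\sum_k u k * del k) + T0 +
    \sum_k (2 * y k * spec h k - u k * spec h k ^+ 2) * S k w.
  rewrite /T0 /U /y !mulr_sumr -sumrB -!big_split; apply: eq_bigr => k _ /=.
  by ring.
have T0_ge : - 5 <= 2 * tau * n%:R * (\sum_k u k * del k) + T0.
  have : 2 * tau * n%:R * (B / 2) <= 2 * tau * n%:R * (\sum_k u k * del k).
    by rewrite ler_wpM2l // !mulr_ge0 // ltW.
  have -> : 2 * tau * n%:R * (B / 2) = n%:R * tau * B by field.
  move: hl hs; rewrite ltr_norml /T0 => /andP[].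
  move: (n%:R * tau * B) (2 * tau * U _ w) (\sum_k _ * S k w) (2 * tau * n%:R * _).
  by move=> a b c e; lra.
move: hg T0_ge N2; rewrite ge_min => /orP[|].
  move: (N * tau ^+ 2) (2 * tau * n%:R * _ + T0) (\sum_k _ * S k w) => a b c.
  have -> : 36 * 2 = 72 :> R by ring.
  by move=> *; lra.
have -> : tau / 2 * N * tau / 4 = N * tau ^+ 2 / 8 by field.
move: (N * tau ^+ 2) (2 * tau * n%:R * _ + T0) (\sum_k _ * S k w) => a b c.
by move=> *; lra.
Qed.
End empty_model.

(** * Comparison with all the parameters of a small model *)

Section nonempty_model.
Hypothesis Tt : Theta_of m theta.
Variables (m1 : {set lattice q}) (fmin fmax : R).
Local Notation N1 := (#|m1|%:R : R).
Local Notation gap := (Num.min fmin (rho - fmax)).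
Hypotheses (m1N : forall l, l \in m1 -> - l \in m1) (m1m : m1 \subset m).
Hypotheses (fmin_gt0 : 0 < fmin) (fmax_lt : fmax < rho).
Hypothesis (lam_bnd : forall k, fmin <= lam k <= fmax).
Hypothesis N_ge : 100 * 65 <= N.
Hypothesis V_ge : 64 * fmax ^+ 2 * ((N1 + 1) ^+ 2 + N) <= V * fmin ^+ 2.
Hypothesis gap_ge : 48 ^+ 2 * fmax * (N1 + 1) <= gap * N.

(** For [vt] in [Theta_of m1], the part of [vt - theta] outside [m1] does not depend on [vt]: it is
    [off]. All these differences lie in the span of the cosines of [m1] and of one extra direction,
    [off] normalized, indexed by [inr tt]; hence the bounds in [N1 + 1]. *)
Let J := (lattice q + unit)%type.

Let sumJ (F : J -> R) : \sum_j F j = \sum_l F (inl l) + F (inr tt).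
Proof. by rewrite big_sumType /=; congr (_ + _); rewrite (big_pred1 tt) //; case. Qed.

Let fmax_gt0 : 0 < fmax.
Proof. by have /andP[h1 h2] := lam_bnd 0; apply: lt_le_trans fmin_gt0 (le_trans h1 h2). Qed.

Let lam_gt0 k : 0 < lam k.
Proof. by have /andP[h1 _] := lam_bnd k; exact: lt_le_trans h1. Qed.

Let e1 l : R := (l \in m1)%:R.
Let off l := - entry theta l * (1 - e1 l).
Let off_norm := Num.sqrt (\sum_l off l ^+ 2).
Let c (j : J) k :=
  if j is inl l then e1 l * hc l k else (\sum_l off l * hc l k) / off_norm.
Let e' (j : J) := if j is inl l then e1 l else 1.

Let sum_e1 : \sum_l e1 l = N1.
Proof.
rewrite -sum1_card natr_sum [RHS]big_mkcond; apply: eq_bigr => l _.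
by rewrite /e1; case: (l \in m1).
Qed.

Let e1_sqr l : e1 l ^+ 2 = e1 l.
Proof. by rewrite /e1; case: (l \in m1); rewrite ?expr1n ?expr0n. Qed.

Let e1_ge0 l : 0 <= e1 l. Proof. by rewrite /e1 ler0n. Qed.

Let e1N l : e1 (- l) = e1 l.
Proof.
rewrite /e1 (_ : (- l \in m1) = (l \in m1)) //.
by apply/idP/idP => [/m1N|/m1N //]; rewrite opprK.
Qed.

Let offN l : off (- l) = off l.
Proof. by rewrite /off e1N -(proj2 (proj1 Tt)). Qed.

Let sum_off_ge0 : 0 <= \sum_l off l ^+ 2.
Proof. by apply: sumr_ge0 => l _; exact: sqr_ge0. Qed.

Let divr_le1 (a : R) : 0 <= a -> a / a <= 1.
Proof. by have [->|a0 _] := eqVneq a 0; rewrite ?mul0r ?divff. Qed.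

Let cl_sqr l k : c (inl l) k ^+ 2 <= e1 l.
Proof. by rewrite /c exprMn e1_sqr -[leRHS]mulr1 ler_wpM2l ?hc_sqr_le1. Qed.

Let cr_sqr k : c (inr tt) k ^+ 2 <= N.
Proof.
rewrite /c exprMn exprVn sqr_sqrtr //.
have -> : \sum_l off l * hc l k = \sum_l off l * ((l \in m)%:R * hc l k).
  apply: eq_bigr => l _; have [_|lm] := boolP (l \in m); first by rewrite mul1r.
  rewrite mul0r mulr0 /off (_ : entry theta l = 0) ?oppr0 ?mul0r //.
  by apply/eqP; apply: contraNT lm; exact: (proj2 Tt).
apply: le_trans (_ : (\sum_l off l ^+ 2) * N / (\sum_l off l ^+ 2) <= _); last first.
  by rewrite mulrAC -[leRHS]mul1r ler_wpM2r // divr_le1.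
rewrite ler_wpM2r ?invr_ge0 //; apply: le_trans (cauchy_schwarz_sum _ _) _.
have -> : N = \sum_l ((l \in m)%:R : R).
  by rewrite -sum1_card natr_sum big_mkcond; apply: eq_bigr => l _; case: (l \in m).
rewrite ler_wpM2l // ler_sum // => l _.
case: (l \in m); last by rewrite mul0r expr0n.
by rewrite mul1r hc_sqr_le1.
Qed.

Let sum_c_sqr j : \sum_k c j k ^+ 2 <= p2 * e' j.
Proof.
case: j => [l|[]].
  apply: le_trans (_ : \sum_(k : lattice q) e1 l <= _); first by apply: ler_sum.
  by rewrite sumr_const card_prod card_ord mulnn mulr_natl.
rewrite /c /= mulr1; under eq_bigr do rewrite exprMn exprVn sqr_sqrtr //.
rewrite -mulr_suml sum_hc_sqr // -mulrA -[leRHS]mulr1 ler_wpM2l //.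
exact: divr_le1.
Qed.

(** The square of the extra direction is only bounded by [N] pointwise, not by 1; its fourth powers
    cost this additional [N]. *)
Let corner (j j' : J) : R := if (j, j') is (inr _, inr _) then N else 0.

Let sum_cM_sqr j j' : \sum_k (c j k * c j' k) ^+ 2 <= p2 * (e' j * e' j' + corner j j').
Proof.
have cl l i : \sum_k (c (inl l) k * c i k) ^+ 2 <= p2 * (e1 l * e' i + 0).
  rewrite addr0 mulrCA; apply: le_trans (_ : e1 l * \sum_k c i k ^+ 2 <= _); last first.
    by rewrite ler_wpM2l.
  rewrite mulr_sumr ler_sum // => k _; rewrite exprMn ler_wpM2r ?sqr_ge0 //.
case: j j' => [l|[]] [l'|[]]; rewrite /corner; do ?exact: cl.
  under eq_bigr do rewrite mulrC.
  by rewrite [e' _ * _]mulrC; exact: cl.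
apply: le_trans (_ : N * \sum_k c (inr tt) k ^+ 2 <= _).
  rewrite mulr_sumr ler_sum // => k _; rewrite exprMn ler_wpM2r ?sqr_ge0 //.
apply: le_trans (_ : N * (p2 * 1) <= _); first by rewrite ler_wpM2l // sum_c_sqr.
by rewrite /= mulr1 mulrC ler_wpM2l // mul1r lerDr.
Qed.

Let sum_e' : \sum_j e' j = N1 + 1.
Proof. by rewrite sumJ sum_e1. Qed.

(** [V_ge] makes the fluctuation at most half of [V / fmax], the lower bound on the mean, so that
    the quadratic form stays coercive. *)
Let whp_quadratic : whp P (1 / 8) (fun w => forall z : J -> R,
    `|\sum_k (lam k)^-1 * (\sum_j z j * c j k) ^+ 2 * (S k w - n%:R)| <=
    (V / (2 * fmax)) * \sum_j z j ^+ 2).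
Proof.
have V0 := V_gt0.
apply: whp_frobenius; first by rewrite divr_gt0 // mulr_gt0.
apply: le_trans (_ : 2 * n%:R * (fmin ^- 2 * (p2 * ((N1 + 1) ^+ 2 + N))) <= _).
  rewrite ler_wpM2l ?mulr_ge0 //.
  have -> : (N1 + 1) ^+ 2 + N = \sum_j \sum_j' (e' j * e' j' + corner j j').
    rewrite expr2 -sum_e' big_distrlr /=.
    under [RHS]eq_bigr do rewrite big_split.
    rewrite big_split /=; congr (_ + _); rewrite sumJ big1 => [|l _]; last first.
      by rewrite big1.
    by rewrite add0r sumJ big1 ?add0r.
  rewrite !mulr_sumr ler_sum // => j _; rewrite !mulr_sumr ler_sum // => j' _.
  apply: le_trans (_ : fmin ^- 2 * \sum_k (c j k * c j' k) ^+ 2 <= _); last first.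
    by rewrite ler_wpM2l ?invr_ge0 ?sqr_ge0.
  rewrite mulr_sumr ler_sum // => k _; rewrite -mulrA exprMn ler_wpM2r ?sqr_ge0 //.
  have /andP[h _] := lam_bnd k.
  by rewrite exprVn lef_pV2 ?posrE ?exprn_gt0 // lerXn2r // nnegrE ltW.
have -> : 2 * n%:R * (fmin ^- 2 * (p2 * ((N1 + 1) ^+ 2 + N))) =
    V * (64 * fmax ^+ 2 * ((N1 + 1) ^+ 2 + N)) / (32 * fmax ^+ 2 * fmin ^+ 2).
  rewrite VE; field.
  by rewrite !lt0r_neq0.
have -> : 1 / 8 * (V / (2 * fmax)) ^+ 2 = V * (V * fmin ^+ 2) / (32 * fmax ^+ 2 * fmin ^+ 2).
  by field; rewrite !lt0r_neq0.
have h : 0 <= (32 * fmax ^+ 2 * fmin ^+ 2)^-1.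
  by rewrite invr_ge0 !mulr_ge0 // ltW.
by rewrite ler_wpM2r // ler_wpM2l // ltW.
Qed.

Let W w := \sum_j U (c j) w ^+ 2.

Let whp_W : whp P (1 / 8) (fun w => W w < 16 * V * (N1 + 1)).
Proof.
have V0 := V_gt0; have mU j := moments_U (c j).
apply: whp_markov; first by apply: moments_sum => j; exact: momentsX.
- by move=> w; apply: sumr_ge0 => j _; exact: sqr_ge0.
- by rewrite !mulr_gt0 // ltr_wpDl.
rewrite Ex_sum => [|j]; last exact: momentsX.
under eq_bigr do rewrite ExU_sqr.
rewrite -mulr_sumr; apply: le_trans (_ : 2 * n%:R * (p2 * (N1 + 1)) <= _).
  rewrite ler_wpM2l ?mulr_ge0 // -sum_e' mulr_sumr ler_sum //.
by rewrite VE le_eqVlt; apply/orP; left; apply/eqP; field.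
Qed.

Lemma score_critB (b : 'M[R]_p) w :
  score_crit theta w - score_crit (theta + b) w =
  \sum_k (2 * spec b k - (lam k)^-1 * spec b k ^+ 2) * S k w.
Proof.
rewrite -sumrB; apply: eq_bigr => k _; rewrite specD.
by field; rewrite lt0r_neq0.
Qed.

(** Against [theta], any [vt] gains twice a linear term minus a quadratic one. The quadratic term is
    at least some [a], and the square of the linear one at most [a b] with [b = 2 fmax W / V], so
    the gain is at most [b <= gap N / 72]. The step from [theta] gains twice that bound. *)
Lemma whp_nonempty_model : whp P (1 / 2) (fun w => exists2 h, Theta_plus_of m rho h &
  forall vt, Theta_of m1 vt -> gap * N / 72 <= score_crit vt w - score_crit h w).
Proof.
have V0 := V_gt0.
have gap0 : 0 < gap by rewrite lt_min fmin_gt0 subr_gt0.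
have gap2 : 0 < gap / 2 by rewrite divr_gt0.
have iu k : 0 <= (lam k)^-1 <= fmin^-1.
  by rewrite invr_ge0 (ltW (lam_gt0 k)) lef_pV2 ?posrE //; case/andP: (lam_bnd k).
have N_ge' : 100 * 65 * 1 ^+ 4 <= N * 1 ^+ 4 by rewrite expr1n !mulr1.
have ifmin : 0 < fmin^-1 by rewrite invr_gt0.
have y_bnd (k : lattice q) : 1 <= (fun=> 1 : R) k <= 1 by rewrite lexx.
(* At [theta] the linear and quadratic weights are [1] and [1 / lam k]; the radius [gap / 2] keeps
   [theta + h] inside the domain. *)
have gain := whp_gain mN m0 ltr01 y_bnd ifmin iu gap2 N_le N_ge'.
clear y_bnd.
have le : (1 / 4 + 1 / 8 + 1 / 8 : R) <= 1 / 2 by lra.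
apply: whp_le le _.
apply: whp_sub (whp_and (whp_and gain whp_quadratic) whp_W) _.
move=> w [[[h [Th hr hg]] hq] hW].
have g1 : gap <= fmin by rewrite ge_min lexx.
have g2 : gap <= rho - fmax by rewrite ge_min lexx orbT.
exists (theta + h).
  apply/Theta_plus_ofP; split; first exact: Theta_ofD.
  move=> k; rewrite specD; have := hr k; have := lam_bnd k; rewrite ler_norml.
  move: g1 g2 gap0; move: gap (spec theta k) (spec h k) => g s v *.
  by apply/andP; split; lra.
move=> vt Tvt.
have {hg} hg : gap * N / 36 <= score_crit theta w - score_crit (theta + h) w.
  rewrite score_critB; under eq_bigr => k _ do rewrite -[2]mulr1.
  apply: le_trans hg; rewrite le_min expr1n !mulr1 invfM invrK.
  have Ng : gap * N <= fmin * N by rewrite ler_wpM2r.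
  have Ng0 : 0 <= gap * N by rewrite mulr_ge0 // ltW.
  apply/andP; split; first by move: Ng; move: (N) gap => M g; lra.
  by move: Ng0; move: (N) gap => M g; lra.
suff : - (gap * N / 72) <= score_crit vt w - score_crit theta w.
  move: hg; move: (gap * N) (score_crit theta w) (score_crit (theta + h) w) (score_crit vt w).
  by move=> g a b c'; lra.
pose ze := vt - theta.
have Tze : Theta_of m ze.
  apply: Theta_ofD; last by rewrite -scaleN1r; exact: Theta_ofZ.
  by case: Tvt => Tv sv; split=> // l /sv; exact: fintype.subsetP l.
have -> : score_crit vt w - score_crit theta w =
    \sum_k (lam k)^-1 * spec ze k ^+ 2 * S k w - 2 * \sum_k spec ze k * S k w.
  rewrite -[vt](subrK theta) [vt - theta + _]addrC -opprB score_critB -/ze.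
  rewrite mulr_sumr -sumrB -sumrN; apply: eq_bigr => k _; ring.
pose z (j : J) := if j is inl l then entry ze l * e1 l else off_norm.
have ze_off l : entry ze l * (1 - e1 l) = off l.
  rewrite /ze entryD -scaleN1r entryZ mulN1r mulrDl -/(off l) /e1.
  have [_|lm] := boolP (l \in m1); first by rewrite subrr mulr0 add0r.
  rewrite (_ : entry vt l = 0) ?mul0r ?add0r //.
  by apply/eqP; apply: contraNT lm; exact: (proj2 Tvt).
have sqr_norm : off_norm ^+ 2 = \sum_l off l ^+ 2 by rewrite sqr_sqrtr.
(* If [off] vanishes, division by [off_norm] returns 0 and the decomposition still holds. *)
have off_div (a : R) : (off_norm = 0 -> a = 0) -> off_norm * (a / off_norm) = a.
  move=> a0; have [on0|on0] := eqVneq off_norm 0; first by rewrite a0 // mul0r mulr0.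
  by rewrite mulrC divfK.
have specE k : spec ze k = \sum_j z j * c j k.
  rewrite sumJ /= off_div => [|on0]; last first.
    have : \sum_l off l ^+ 2 == 0 by rewrite -sqr_norm on0 expr0n.
    rewrite psumr_eq0 => [/allP o0|l _]; last exact: sqr_ge0.
    apply: big1 => l _; have := o0 l (mem_index_enum _).
    by rewrite sqrf_eq0 => /eqP ->; rewrite mul0r.
  rewrite -big_split; apply: eq_bigr => l _ /=; rewrite -ze_off.
  have := e1_sqr l; rewrite expr2 => h2; rewrite mulrA -[_ * e1 l * e1 l]mulrA h2.
  by ring.
pose Z := \sum_j z j ^+ 2.
have ZE : \sum_l entry ze l ^+ 2 = Z.
  rewrite /Z sumJ sqr_norm -big_split; apply: eq_bigr => l _ /=.
  by rewrite -ze_off /e1; case: (l \in m1) => /=; ring.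
have lin : \sum_k spec ze k * S k w = \sum_j z j * U (c j) w.
  rewrite U_sum /U; under [RHS]eq_bigr do rewrite -specE mulrBr.
  by rewrite sumrB -mulr_suml (sum_spec0 (proj1 Tze)) mul0r subr0.
have lin2 : (\sum_k spec ze k * S k w) ^+ 2 <= Z * W w.
  by rewrite lin; exact: cauchy_schwarz_sum.
have quad : V / (2 * fmax) * Z <= \sum_k (lam k)^-1 * spec ze k ^+ 2 * S k w.
  have := hq z; rewrite ler_norml => /andP[+ _].
  rewrite (eq_bigr (fun k => (lam k)^-1 * spec ze k ^+ 2 * S k w -
    n%:R * ((lam k)^-1 * spec ze k ^+ 2))) => [|k _]; last by rewrite specE; ring.
  rewrite sumrB -mulr_sumr -/Z.
  have : n%:R * (fmax^-1 * (p2 * Z)) <= n%:R * \sum_k (lam k)^-1 * spec ze k ^+ 2.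
    rewrite ler_wpM2l // -ZE -sum_spec_sqr; last exact: (proj2 (proj1 Tze)).
    rewrite mulr_sumr ler_sum // => k _; rewrite ler_wpM2r ?sqr_ge0 //.
    by rewrite lef_pV2 ?posrE //; case/andP: (lam_bnd k).
  have -> : n%:R * (fmax^-1 * (p2 * Z)) = V / (2 * fmax) * Z + V / (2 * fmax) * Z.
    by rewrite VE; field; rewrite lt0r_neq0.
  move: (V / (2 * fmax) * Z) (\sum_k _ * S k w) => a b.
  by move: (n%:R * _) => e; lra.
have Z0 : 0 <= Z by apply: sumr_ge0 => j _; exact: sqr_ge0.
have W0 : 0 <= W w by apply: sumr_ge0 => j _; exact: sqr_ge0.
have h1 : 2 * fmax * W w / V <= gap * N / 72.
  rewrite ler_pdivrMr //.
  apply: le_trans (_ : 2 * fmax * (16 * V * (N1 + 1)) <= _).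
    by apply: ler_wpM2l; [exact: mulr_ge0 (ler0n _ 2) (ltW fmax_gt0) | exact: ltW].
  have := ler_wpM2l (ltW V0) gap_ge.
  by move: (gap) (V) (N) (N1) => g v M M1; lra.
set x := \sum_k _ * S k w in lin lin2 *.
have ac : x ^+ 2 <= (V / (2 * fmax) * Z) * (2 * fmax * W w / V).
  rewrite (_ : _ * _ = Z * W w) //.
  by move: (V) V0 => v v0; field; rewrite !lt0r_neq0.
have a0 : 0 <= V / (2 * fmax) * Z by rewrite mulr_ge0 // divr_ge0 ?mulr_ge0 // ltW.
have c0 : 0 <= 2 * fmax * W w / V by rewrite divr_ge0 ?mulr_ge0 // ltW.
move: quad h1 ac a0 c0; move: (V / (2 * fmax) * Z) (2 * fmax * W w / V) (gap * N / 72) => a b g.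
move: (\sum_k _ * _ ^+ 2 * _) => s sa bg x2 a0 b0.
have : 2 * x <= a + b.
  rewrite leNgt; apply/negP => lt; have := sqr_ge0 (a - b); nra.
lra.
Qed.

End nonempty_model.
End competitors.
End scores.

(** * Selection of the model *)

(** The linear constraints are closed. They are enough for the estimators, as the lower bounds on
    the criterion hold on the whole of [Theta_of m1]. *)
Lemma closure_Theta_plus_of {R : realType} {q : nat} (m : {set lattice q}) (rho : R) :
  closure (Theta_plus_of m rho) `<=` Theta_of m.
Proof.
move=> A clA.
have near (e : R) : 0 < e ->
    exists2 M, Theta_of m M & forall u, `|entry A u - entry M u| < e.
  move=> e0; have [M [[TM _ _] AM]] := clA _ (nbhsx_ballx A e e0).
  by case: AM => _ AM; exists M => // -[i j]; exact: AM.
have eq0 (a : R) : (forall e, 0 < e -> `|a| < e + e) -> a = 0.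
  move=> h; apply/eqP; rewrite -normr_le0 leNgt; apply/negP => a0.
  have a2 : 0 < `|a| / 2 by rewrite divr_gt0.
  by have := h _ a2; rewrite -splitr ltxx.
split; first split.
- apply: eq0 => e e0; have [M [[M0 _] _] /(_ 0)] := near e e0.
  by rewrite M0 subr0 => /lt_trans; apply; rewrite ltrDl.
- move=> u; apply/eqP; rewrite -subr_eq0; apply/eqP; apply: eq0 => e e0.
  have [M [[_ MN] _] AM] := near e e0.
  rewrite -(subrKA (entry M u)) (le_lt_trans (ler_normD _ _)) // ltrD //.
  by rewrite MN distrC.
- move=> u; apply: contraNT => um; apply/eqP; apply: eq0 => e e0.
  have [M [_ Mm] /(_ u)] := near e e0.
  have -> : entry M u = 0 by apply/eqP; apply: contraNT um; exact: Mm.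
  by rewrite subr0 => /lt_trans; apply; rewrite ltrDl.
Qed.

(** * Scores of the observed fields *)

Section field_scores.
Context d (T : measurableType d) (R : realType) (P : probability T R).
Context {n q : nat} (X : 'I_n -> lattice q -> {RV P >-> R}).
Variables (theta : 'M[R]_q.+1) (sigma2 : R).
Local Notation p := q.+1.
Local Notation V := ((n * p ^ 2)%N%:R : R).
Hypothesis even : forall u, entry theta u = entry theta (- u).
Hypothesis pos : forall k, 0 < 1 - spec theta k.
Hypothesis sigma2_gt0 : 0 < sigma2.
Hypothesis gX : forall i, gaussian_field (X i).
Hypothesis cX : forall i, centered_field (X i).
Hypothesis covX : forall i, has_covmx (X i) (sigma2 *: invmx (1%:M - Cmx theta)).
Hypothesis indep : independent_fields X.
Local Notation Z := (whitened X theta sigma2).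

Definition score k w := \sum_i Z (i, k) w ^+ 2.
Local Notation U := (centered_form n score).

Let mZ := moments_whitened theta sigma2 gX cX.
Let Z_rec := whitened_rec even pos sigma2_gt0 gX cX covX indep.

Lemma score_ge0 k w : 0 <= score k w.
Proof. by apply: sumr_ge0 => i _; exact: sqr_ge0. Qed.

Lemma moments_score k : moments P (score k).
Proof. by apply: moments_sum => i; exact: momentsX. Qed.

Lemma Ex_score k : Ex P (score k) = n%:R.
Proof.
rewrite Ex_sum => [|i]; last exact: momentsX.
rewrite (eq_bigr (fun=> 1)) => [|i _]; first by rewrite sumr_const card_ord.
rewrite (eq_Ex P (g := fun w => Z (i, k) w * Z (i, k) w)) => [|w]; last by rewrite expr2.
by rewrite (whitened_orthonormal even pos sigma2_gt0 gX cX covX) eqxx.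
Qed.

Lemma centered_form_score c : U c = cchi2 Z (fun a => c a.2).
Proof.
apply/funext => w; rewrite /centered_form /cchi2 /score.
rewrite -(pair_bigA _ (fun i k => c k * (Z (i, k) w ^+ 2 - 1))) exchange_big /=.
apply: eq_bigr => k _; rewrite -mulr_sumr; congr (_ * _).
by rewrite sumrB sumr_const card_ord.
Qed.

Lemma sum_snd (F : lattice q -> R) :
  \sum_(a : 'I_n * lattice q) F a.2 = n%:R * \sum_k F k.
Proof.
rewrite -(pair_bigA _ (fun (i : 'I_n) k => F k)) /=.
by rewrite sumr_const card_ord mulr_natl.
Qed.

Lemma Ex_scoreM c c' : Ex P (fun w => U c w * U c' w) = 2 * n%:R * \sum_k c k * c' k.
Proof.
by rewrite !centered_form_score (Ex_cchi2M mZ Z_rec) (sum_snd (fun k => c k * c' k)) mulrA.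
Qed.

Lemma Ex_score_sqrM c c' : Ex P (fun w => U c w ^+ 2 * U c' w ^+ 2) =
  4 * n%:R ^+ 2 * (\sum_k c k ^+ 2) * (\sum_k c' k ^+ 2) +
  8 * n%:R ^+ 2 * (\sum_k c k * c' k) ^+ 2 + 48 * n%:R * \sum_k c k ^+ 2 * c' k ^+ 2.
Proof.
rewrite !centered_form_score (Ex_cchi2_sqrM mZ Z_rec).
rewrite (sum_snd (fun k => c k ^+ 2)) (sum_snd (fun k => c' k ^+ 2)).
rewrite (sum_snd (fun k => c k * c' k)) (sum_snd (fun k => c k ^+ 2 * c' k ^+ 2)).
by ring.
Qed.

Lemma ls_criterion_score (vt : 'M[R]_p) w : Theta vt ->
  ls_criterion (fun i u => X i u w) vt = sigma2 / V * score_crit score theta vt w.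
Proof.
move=> Tv; rewrite ls_criterion_spec // mulrAC mulrC; congr (_ / _).
rewrite exchange_big /= mulr_sumr; apply: eq_bigr => k _.
under eq_bigr do rewrite (hartley_whitened X pos sigma2_gt0).
by rewrite -mulr_sumr -mulr_sumr /score; ring.
Qed.

End field_scores.

Section selection.
Context {R : realType} {q n : nat} (x : 'I_n -> lattice q -> R).
Variables (rho : R) (pen : {set lattice q} -> R).
Variables (theta_hat : {set lattice q} -> 'M[R]_q.+1) (m_hat m' m1 : {set lattice q}).

(** The estimator of [m'] does at least as well as [h], while that of a submodel of [m1] lies in
    [Theta_of m1] and so loses at least [G] against [h], more than the penalty can give back. *)
Lemma selected_not_sub (h : 'M[R]_q.+1) (G : R) :
  (forall m, models R m ->
    is_argmin (ls_criterion x) (closure (Theta_plus_of m rho)) (theta_hat m)) ->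
  is_argmin (fun m => ls_criterion x (theta_hat m) + pen m) (models R (q := q)) m_hat ->
  models R m' -> Theta_plus_of m' rho h ->
  (forall vt, Theta_of m1 vt -> G <= ls_criterion x vt - ls_criterion x h) ->
  (forall m, models R m -> pen m' - pen m < G) ->
  ~~ (m_hat \subset m1).
Proof.
move=> th [Mm mh] Mm' Th hG hpen; apply/negP => sub.
have [cl _] := th _ Mm; have [_ /(_ h (subset_closure Th)) le1] := th _ Mm'.
have [Tt sm] := closure_Theta_plus_of cl.
have T1 : Theta_of m1 (theta_hat m_hat) by split=> // u /sm; exact: fintype.subsetP u.
have := hG _ T1; have := hpen _ Mm; have := mh _ Mm'; move: le1; lra.
Qed.

End selection.

(** * Choice of the dimension level *)

Section constants.
Context {R : realType}.

(* The minimum is positive when [fmin] and [fmax] are extreme eigenvalues; the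
   test only makes the function positive on all other inputs. *)
Definition dimension_rate (eta rho fmin fmax : R) : R :=
  let x := Num.min 1 (Num.min (fmin ^+ 2 / (10 ^+ 3 * fmax ^+ 2))
    (Num.min fmin (rho - fmax) / (10 ^+ 6 * fmax))) in
  if 0 < x then x else 1.

Lemma dimension_rate_gt0 eta rho fmin fmax : 0 < dimension_rate eta rho fmin fmax.
Proof. by rewrite /dimension_rate; case: ifP. Qed.

Lemma dimension_rate_le1 eta rho fmin fmax : dimension_rate eta rho fmin fmax <= 1.
Proof.
rewrite /dimension_rate; move: (Num.min (_ / _) _) => z /=.
by case: ifP => _; rewrite ?ge_min lexx.
Qed.

Lemma dimension_rate_le eta rho fmin fmax (L := dimension_rate eta rho fmin fmax) :
  0 < fmin -> 0 < fmax -> fmax < rho ->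
  10 ^+ 3 * fmax ^+ 2 * L <= fmin ^+ 2 /\
  10 ^+ 6 * fmax * L <= Num.min fmin (rho - fmax).
Proof.
move=> a0 b0 br; rewrite /L /dimension_rate; set x := Num.min 1 _.
have g0 : 0 < Num.min fmin (rho - fmax) by rewrite lt_min a0 subr_gt0.
have b1 : 0 < 10 ^+ 3 * fmax ^+ 2 by rewrite mulr_gt0 ?exprn_gt0.
have b2 : 0 < 10 ^+ 6 * fmax by rewrite mulr_gt0 ?exprn_gt0.
have -> : 0 < x by rewrite !lt_min ltr01 !divr_gt0 // exprn_gt0.
have x1 : x <= fmin ^+ 2 / (10 ^+ 3 * fmax ^+ 2) by rewrite !ge_min lexx orbT.
have x2 : x <= Num.min fmin (rho - fmax) / (10 ^+ 6 * fmax).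
  by rewrite !ge_min lexx !orbT.
by rewrite mulrC -ler_pdivlMr // x1 mulrC -ler_pdivlMr // x2.
Qed.

(* Here [M1] and [M] are cardinals of models, [mu] is the minimum of the square
   root of [V] and of [p^2], and the level [L * mu] is at least 1. *)
Lemma level_bounds (fmin fmax g L mu V M M1 : R) :
  0 < fmin -> 0 < fmax -> 0 < L -> L <= 1 ->
  10 ^+ 3 * fmax ^+ 2 * L <= fmin ^+ 2 -> 10 ^+ 6 * fmax * L <= g ->
  0 <= mu -> mu ^+ 2 <= V -> 1 <= L * mu -> 0 <= M -> M ^+ 2 <= 4 * V ->
  mu <= 72 * M -> 0 <= M1 -> M1 <= 2 * (L * mu) ->
  64 * fmax ^+ 2 * ((M1 + 1) ^+ 2 + M) <= V * fmin ^+ 2 /\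
  48 ^+ 2 * fmax * (M1 + 1) <= g * M.
Proof.
move=> a0 b0 L0 L1 ha hg mu0 muV Lmu M0 MV muM M10 M1L.
have V0 : 0 <= V by apply: le_trans muV; exact: sqr_ge0.
have M1le : M1 + 1 <= 3 * (L * mu) by lra.
have sq : (M1 + 1) ^+ 2 <= 9 * (L * V).
  apply: le_trans (_ : (3 * (L * mu)) ^+ 2 <= _).
    by rewrite lerXn2r // nnegrE ?addr_ge0 ?mulr_ge0 // ltW.
  have -> : (3 * (L * mu)) ^+ 2 = 9 * (L * (L * mu ^+ 2)) by ring.
  rewrite ler_wpM2l // ler_wpM2l ?(ltW L0) // -[leRHS]mul1r.
  by apply: ler_pM; rewrite ?(ltW L0) ?sqr_ge0.
(* A level of at least 1 gives [L ^ 2 V >= 1], which trades [M <= 2 sqrt V] for a bound carrying the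
   factor [L]. *)
have ML : M <= 2 * (L * V).
  have LV : 1 <= L ^+ 2 * V.
    apply: le_trans (_ : L ^+ 2 * mu ^+ 2 <= _); last by rewrite ler_wpM2l ?sqr_ge0.
    by rewrite -exprMn; apply: exprn_ege1.
  rewrite -(@ler_pXn2r _ 2) ?nnegrE ?mulr_ge0 ?(ltW L0) //.
  apply: le_trans MV _.
  have -> : (2 * (L * V)) ^+ 2 = 4 * V * (L ^+ 2 * V) by ring.
  by rewrite -[leLHS]mulr1 ler_wpM2l // mulr_ge0.
split.
  apply: le_trans (_ : 64 * fmax ^+ 2 * (11 * (L * V)) <= _).
    by rewrite ler_wpM2l ?mulr_ge0 ?sqr_ge0 //; lra.
  have := ler_wpM2l V0 ha; have : 0 <= V * (fmax ^+ 2 * L).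
    by rewrite !mulr_ge0 ?sqr_ge0 // ltW.
  move: (fmax ^+ 2) (fmin ^+ 2) => b a; lra.
apply: le_trans (_ : 48 ^+ 2 * fmax * (3 * (L * (72 * M))) <= _).
  apply: ler_wpM2l; first by rewrite mulr_ge0 ?exprn_ge0 // ltW.
  by apply: le_trans M1le _; rewrite ler_wpM2l // ler_wpM2l // ltW.
have := ler_wpM2r M0 hg; have : 0 <= fmax * L * M by rewrite !mulr_ge0 // ltW.
lra.
Qed.

End constants.

(** The eigenvalues have mean 1. This bounds [gap] by 1, which lets the universal gain over the
    empty model dominate the penalty. *)
Lemma phi_min_le1 {R : realType} {q : nat} (theta : 'M[R]_q.+1) : Theta theta ->
  phi_min (1%:M - Cmx theta) <= 1.
Proof.
move=> Tt; have [_ _ le] := phi_min_lam (Theta_even Tt).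
have : \sum_(k : lattice q) (1 - phi_min (1%:M - Cmx theta)) >= 0.
  have <- : \sum_k (1 - spec theta k - phi_min (1%:M - Cmx theta)) =
      \sum_(k : lattice q) (1 - phi_min (1%:M - Cmx theta)).
    under eq_bigr do rewrite addrAC.
    by rewrite sumrB (sum_spec0 Tt) subr0.
  by apply: sumr_ge0 => k _; rewrite subr_ge0.
rewrite sumr_const -mulr_natl pmulr_rge0 ?subr_ge0 // ltr0n.
by apply/card_gt0P; exists 0.
Qed.

Lemma Theta_of_set0 {R : realType} {q : nat} (vt : 'M[R]_q.+1) :
  Theta_of finset.set0 vt -> vt = 0.
Proof.
move=> [_ s]; apply: entry_inj => l; rewrite [RHS]mxE; apply/eqP.
by apply: contraT => /s; rewrite finset.in_set0.
Qed.

Theorem proposition4p1 (R : realType) :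
  exists (K1 : R) (p0 : nat) (L : R -> R -> R -> R -> R),
  [/\ 0 < K1, (0 < p0)%N, (forall a b c e, 0 < L a b c e)
    & forall (rho eta : R) (q n : nat),
      2 < rho -> 0 < eta < 1 -> (p0 <= q.+1)%N -> (1 <= n)%N ->
      forall m' : {set lattice q},
      models R m' ->
      (dimension (R := R) m')%:R <= Num.sqrt ((n * q.+1 ^ 2)%N%:R : R) ->
      (forall m, models R m ->
         (dimension (R := R) m)%:R <= Num.sqrt ((n * q.+1 ^ 2)%N%:R : R) ->
         m \subset m') ->
      forall (theta : 'M[R]_q.+1) (sigma2 : R),
      Theta_plus_of m' rho theta -> 0 < sigma2 ->
      let A := 1%:M - Cmx theta in
      forall (d : measure_display) (T : measurableType d) (P : probability T R)
        (X : 'I_n -> lattice q -> {RV P >-> R}),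
      (forall i, [/\ gaussian_field (X i), centered_field (X i),
         stationary_field (X i) & has_covmx (X i) (sigma2 *: invmx A)]) ->
      independent_fields X ->
      forall pen : {set lattice q} -> R,
      (forall m, models R m -> 0 <= pen m) ->
      (forall m, models R m ->
         pen m' - pen m <=
         K1 * (1 - eta) * sigma2 * Num.min (phi_min A) (rho - phi_max A) *
         (((dimension (R := R) m')%:R - (dimension (R := R) m)%:R)
            / (n * q.+1 ^ 2)%N%:R)) ->
      forall (theta_hat : {set lattice q} -> T -> 'M[R]_q.+1)
        (m_hat : T -> {set lattice q}),
      (forall m w, models R m ->
         is_argmin (ls_criterion (fun i u => X i u w))
           (closure (Theta_plus_of m rho)) (theta_hat m w)) ->
      (forall m, measurable (m_hat @^-1` [set m])) ->
      (forall w,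
         is_argmin (fun m => ls_criterion (fun i u => X i u w) (theta_hat m w) + pen m)
           (models R (q := q)) (m_hat w)) ->
      ((2^-1)%:E <=
       P [set w | (L eta rho (phi_min A) (phi_max A) *
                   Num.min (Num.sqrt (n * q.+1 ^ 2)%N%:R) (q.+1 ^ 2)%N%:R
                   < (dimension (R := R) (m_hat w))%:R)%R])%E].
Proof.
(* The requirement [N_ge] of [whp_gain] for [y1 = 2] and [y0 = 1 / 16]. *)
pose N0 : R := 100 * 65 * 2 ^+ 4 * 16 ^+ 4.
(* [1 / 40000] lies below both gain constants, [1 / (144 * 16 ^ 2)] and [1 / 72]; the threshold on
   [p] yields [N >= N0] through [p <= 72 N]. *)
exists (200 * 200)^-1, (maxn 72 (Num.Def.archi_bound (72 * N0))), dimension_rate.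
split; [by rewrite invr_gt0 | by rewrite leq_max | exact: dimension_rate_gt0 |].
move=> rho eta q n rho2 /andP[eta0 eta1]; rewrite geq_max => /andP[p72 pN0] n0.
move=> m' Mm' dm' m'_max theta sigma2 Tt s0 A d T P X hX indep pen pen0 hpen.
move=> theta_hat m_hat hth mm_hat hm_hat.
set V : R := (n * q.+1 ^ 2)%N%:R in dm' m'_max hpen *.
set mu := Num.min _ _; set L := dimension_rate _ _ _ _.
have [Tmt lam_bnd] := iffLR (Theta_plus_ofP _ _ _) Tt.
have even := Theta_even (proj1 Tmt).
have pos k : 0 < 1 - spec theta k by case/andP: (lam_bnd k).
have V0 : 0 < V := V_gt0 R n0.
pose N : R := #|m'|%:R.
have [pN muN] : (q.+1%:R <= 72 * N) /\ (mu <= 72 * N) := largest_model_card n0 p72 m'_max.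
have N_ge : N0 <= N.
  have : 72 * N0 < q.+1%:R.
    by apply: lt_le_trans (unstable.ltr_bound _) _; rewrite ler_nat.
  by move=> /lt_le_trans /(_ pN); rewrite ltr_pM2l // => /ltW.
have N_pow : 100 * 65 * 2 ^+ 4 <= N * (1 / 16) ^+ 4.
  apply: le_trans (_ : N0 * (1 / 16) ^+ 4 <= _); last by rewrite ler_wpM2r ?exprn_ge0.
  have e : 16 * (1 / 16) = 1 :> R by field.
  by rewrite /N0 -[leRHS]mulrA -exprMn e expr1n [leRHS]mulr1.
have N_pow2 : N * (1 / 16) ^+ 4 <= N * (1 / 16) ^+ 2.
  by rewrite ler_wpM2l // ler_wiXn2l //; lra.
have N_pow0 : N * (1 / 16) ^+ 2 <= N by rewrite -[leRHS]mulr1 ler_wpM2l // exprn_ile1 //; lra.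
have N_ge1 : 10 * 72 <= N * (1 / 16) ^+ 2.
  by move: N_pow N_pow2; move: (N * (1 / 16) ^+ 2) (N * (1 / 16) ^+ 4) => a b; lra.
have N_ge2 : 100 * 65 <= N.
  by move: N_pow N_pow2 N_pow0; move: (N * (1 / 16) ^+ 2) (N * (1 / 16) ^+ 4) => a b; lra.
have sqrtV0 : 0 <= Num.sqrt V by exact: sqrtr_ge0.
have sqrtV2 : Num.sqrt V ^+ 2 = V by rewrite sqr_sqrtr // ltW.
have N_le : N ^+ 2 <= 4 * V.
  have : N <= 2 * Num.sqrt V.
    apply: le_trans (_ : 2 * (dimension (R := R) m')%:R <= _); last by rewrite ler_wpM2l.
    by rewrite -natrM ler_nat; exact: models_card_le.
  move=> le; have -> : 4 * V = (2 * Num.sqrt V) ^+ 2 by rewrite exprMn sqrtV2; ring.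
  by rewrite lerXn2r // nnegrE ?mulr_ge0.
have mu0 : 0 <= mu by rewrite le_min sqrtV0 ler0n.
have mu_le : mu <= Num.sqrt V by rewrite ge_min lexx.
have muV : mu ^+ 2 <= V by rewrite -[leRHS]sqrtV2 lerXn2r // nnegrE.
have L0 : 0 < L := dimension_rate_gt0 _ _ _ _.
have L1 : L <= 1 := dimension_rate_le1 _ _ _ _.
have [kmin fminE fmin_le] := phi_min_lam even; have [kmax fmaxE fmax_ge] := phi_max_lam even.
rewrite -/A in fminE fmin_le fmaxE fmax_ge.
have fmin0 : 0 < phi_min A by rewrite fminE.
have fmax0 : 0 < phi_max A by rewrite fmaxE.
have fmax_rho : phi_max A < rho by rewrite fmaxE; case/andP: (lam_bnd kmax).
set gap := Num.min _ _ in hpen.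
have gap0 : 0 < gap by rewrite lt_min fmin0 subr_gt0.
have gap1 : gap <= 1 by rewrite ge_min (phi_min_le1 (proj1 Tmt)).
set E : set T := [set w | _].
have mE : measurable E.
  rewrite (_ : E = \bigcup_(m in [set m | L * mu < (dimension (R := R) m)%:R])
      (m_hat @^-1` [set m])).
    by apply: fin_bigcup_measurable => //; exact: finite_finset.
  apply/seteqP; split=> w /=; first by move=> h; exists (m_hat w).
  by move=> [m h mw]; rewrite /E /= mw.
have -> : (2^-1)%:E = (1 - 1 / 2)%:E :> \bar R by congr (_%:E); field.
apply: whp_measure => //.
pose cand (m : {set lattice q}) := `[< models R m >] && ((dimension (R := R) m)%:R <= L * mu).
(* If no model has dimension at most [L * mu], the selected one exceeds the level on every
   outcome. *)
have [/existsP[mc cand_mc]|/existsPn no_cand] := boolP [exists m, cand m]; last first.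
  exists set0; split=> //; first by rewrite measure0 lee_fin.
  move=> w _; have [Mm _] := hm_hat w.
  have := no_cand (m_hat w); rewrite /cand negb_and -ltNge => /orP[|//].
  by move=> /negP; case; exact/asboolP.
(* Models are nested, so the one of maximal cardinality contains every model below the level. *)
have [m1 /andP[/asboolP Mm1 dm1] m1_max] := @arg_maxnP _ mc cand (fun m => #|m|) cand_mc.
have m1_sub : m1 \subset m'.
  apply: m'_max => //; apply: le_trans dm1 _; apply: le_trans mu_le.
  by rewrite -[leRHS]mul1r ler_wpM2r.
have not_sub m : models R m -> ~~ (m \subset m1) -> L * mu < (dimension (R := R) m)%:R.
  move=> Mm; rewrite ltNge; apply: contra => dm.
  have le : (#|m| <= #|m1|)%N by apply: m1_max; rewrite /cand dm andbT; apply/asboolP.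
  have [//|sub] := orP (models_total Mm Mm1).
  by have /eqP -> : m1 == m by rewrite eqEcard sub.
have M1_le : #|m1|%:R <= 2 * (L * mu).
  apply: le_trans (_ : 2 * (dimension (R := R) m1)%:R <= _); last by rewrite ler_wpM2l.
  by rewrite -natrM ler_nat; exact: models_card_le.
have gX i : gaussian_field (X i) by case: (hX i).
have cX i : centered_field (X i) by case: (hX i).
have covX i : has_covmx (X i) (sigma2 *: invmx A) by case: (hX i).
pose S := score X theta sigma2.
have S0 k w : 0 <= S k w by exact: score_ge0.
have mS := moments_score theta sigma2 gX cX.
have ES := Ex_score even pos s0 gX cX covX.
have EM := Ex_scoreM even pos s0 gX cX covX indep.
have EM4 := Ex_score_sqrM even pos s0 gX cX covX indep.
have mN := models_opp Mm'; have m0 := models_0 Mm'.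
have N00 : 0 < N by apply: lt_le_trans N_ge2; rewrite mulr_gt0.
have gain : whp P (1 / 2) (fun w => exists2 h, Theta_plus_of m' rho h & forall vt,
    Theta_of m1 vt -> gap * (N / (200 * 200)) < score_crit S theta vt w - score_crit S theta h w).
  have [Lmu|Lmu] := leP 1 (L * mu).
    have [ha hg] := dimension_rate_le eta fmin0 fmax0 fmax_rho.
    have [V_ge gap_ge] := level_bounds fmin0 fmax0 L0 L1 ha hg mu0 muV Lmu (ltW N00)
      N_le muN (ler0n _ _) M1_le.
    have bnd k : phi_min A <= 1 - spec theta k <= phi_max A by rewrite fmin_le fmax_ge.
    apply: whp_sub (whp_nonempty_model n0 mS EM EM4 mN m0 N_le Tmt (models_opp Mm1) m1_sub
      fmin0 fmax_rho bnd N_ge2 V_ge gap_ge) _.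
    move=> w [h Th hh]; exists h => // vt /hh; apply: lt_le_trans.
    rewrite -/gap -/N -mulrA ltr_pM2l // ltr_pM2l // ltf_pV2 ?posrE ?mulr_gt0 //.
    lra.
  have m1_0 : m1 = finset.set0.
    apply/eqP; rewrite -cards_eq0 -leqn0 (leq_trans (models_card_le Mm1)) //.
    rewrite leqn0 muln_eq0 /= -leqn0 -ltnS -(ltr_nat R).
    exact: le_lt_trans dm1 Lmu.
  apply: whp_sub (whp_empty_model n0 S0 mS ES EM EM4 mN m0 N_le rho2 Tt N_pow N_ge1) _.
  move=> w [h Th hh]; exists h => // vt; rewrite m1_0 => /Theta_of_set0 ->.
  apply: lt_le_trans hh; apply: le_lt_trans (_ : N / (200 * 200) < _).
    by rewrite -[leRHS]mul1r ler_wpM2r // divr_ge0 ?mulr_ge0.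
  by rewrite -/N -mulrA ltr_pM2l //; lra.
apply: whp_sub gain _ => w [h Th hh].
have [Mm _] := hm_hat w; apply: not_sub => //.
have TTh : Theta h by case: Th => -[].
pose G := sigma2 / V * (gap * (N / (200 * 200))).
apply: (@selected_not_sub _ _ _ _ rho pen (theta_hat ^~ w) _ m' _ h G _ (hm_hat w)) => //.
- by move=> m; exact: hth.
- move=> vt Tvt; rewrite !(ls_criterion_score X pos s0) //; last by case: Tvt.
  by rewrite -mulrBr ler_pM2l ?divr_gt0 // ltW // hh.
move=> m Mm1'; apply: le_lt_trans (hpen m Mm1') _.
set D : R := _%:R - _%:R.
have D_le : D <= N.
  apply: le_trans (_ : (dimension (R := R) m')%:R <= _); first by rewrite /D gerBl.
  by rewrite ler_nat; exact: dimension_le_card.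
have lt : (1 - eta) * D < N.
  apply: le_lt_trans (_ : (1 - eta) * N < _); first by rewrite ler_wpM2l // subr_ge0 ltW.
  by rewrite -[ltRHS]mul1r ltr_pM2r // gtrBl.
have -> : (200 * 200)^-1 * (1 - eta) * sigma2 * gap * (D / V) =
    sigma2 / V * (gap * ((1 - eta) * D / (200 * 200))) by ring.
by rewrite /G ltr_pM2l ?divr_gt0 // ltr_pM2l // ltr_pM2r // invr_gt0 mulr_gt0.
Qed.
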